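(* Let $(\boldsymbol q(t),\hat u(t))$, $t\in[0,T]$, be a trajectory of the sub-Riemannian (SR) control system, with $q(t)$ its projection to $Q$. For the SR geodesic problem the following conditions are equivalent: (a) The pair $(\boldsymbol q(t),\hat u(t))$ is an abnormal SR extremal. (b) The smallest distribution along $q(t)$ which is $F_{t\tau}$-invariant along $q(t)$ and contains $\mathcal D_{q(t)}$, i.e. $$F_\bullet(\mathcal D)_{q(t)}=\operatorname{span}_{\mathbb R}\{TF_{t\tau}(Y)\ |\ Y\in\mathcal D_{q(\tau)},\ 0\le\tau\le T\},$$ is of rank smaller than $\dim Q$. Here $F_{t\tau}$ is the time-dependent flow on $Q$ of the time-dependent vector field $f_{\hat u(t)}$. Moreover, condition (b) depends only on $f_{\hat u(t)}$ and $\mathcal D$ along $q(t)$ (that is, it does not depend on the choice of the extension of the velocity field $f_{\hat u(t)}(q(t))$ to a $\mathcal D$-valued Caratheodory time-dependent vector field in a neighborhood of $q(t)$).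
   Context: **SR geodesic problem.** $Q$ is a smooth manifold, $\mathcal D\subset TQ$ a smooth distribution of constant rank $d$, $g:\mathcal D\times\mathcal D\to\mathbb R$ a symmetric positive-definite bilinear form (SR metric). Locally $\mathcal D=\langle f_1,\dots,f_d\rangle$ with smooth $f_i$, $U=\mathbb R^d$, $f_u(q)=f(q,u)=\sum_iu^if_i(q)$. Controls $u(t)$ are measurable and locally bounded. The SR geodesic problem: on a fixed interval $[0,T]$ with fixed end-points $q(0),q(T)$, minimize $\int_0^TL(q,u)\,dt$, $L(q,u)=\frac12g(f_u(q),f_u(q))$, subject to $\dot q=f_{u}(q)$ a.e. The extended system on $\boldsymbol Q=Q\times\mathbb R\ni(q,q_0)=\boldsymbol q$ is $\dot{\boldsymbol q}=\boldsymbol f_u(\boldsymbol q)=f_u(q)+\frac12g(f_u(q),f_u(q))\partial_{q_0}$, and a trajectory is written $(\boldsymbol q(t),\hat u(t))$ with $\boldsymbol q(t)=(q(t),q_0(t))$, $q_0(t)=\int_0^tL(q(s),\hat u(s))\,ds$. $F_{t\tau}$ and $\boldsymbol F_{t\tau}$ denote the time-dependent (TD) flows of $f_{\hat u(t)}$ on $Q$ and of $\boldsymbol f_{\hat u(t)}$ on $\boldsymbol Q$ ($t\mapsto F_{t\tau}(q)$ is the integral curve with value $q$ at time $\tau$); they are local diffeomorphisms. **Extremals.** Let $\boldsymbol{\mathcal R}\subset T\boldsymbol Q$ be the line field spanned by $\partial_{q_0}$ and $\boldsymbol{\mathcal R}^-_{\boldsymbol q}=\{-r\partial_{q_0}:r\in\mathbb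 R_+\}$. A point $t$ is regular for $\hat u$ if for every open $O\ni\hat u(t)$, $\mu(\hat u^{-1}(O)\cap V')/\mu(V')\to1$ as the open interval $V'\ni t$ shrinks to $t$. For regular $t\in(0,T)$ let $$\boldsymbol{\mathcal K}_t=\operatorname{cl}\Big\{\sum_{i=1}^kT\boldsymbol F_{tt_i}\big[\boldsymbol f_{v_i}(\boldsymbol q(t_i))-\boldsymbol f_{\hat u(t_i)}(\boldsymbol q(t_i))\big]\delta t_i\Big\}\subset T_{\boldsymbol q(t)}\boldsymbol Q,$$ over finite sequences of regular points $0<t_1\le\dots\le t_k\le t$, $v_i\in U$, $\delta t_i\ge0$; for non-regular $t\in(0,T]$ (including $T$) let $\boldsymbol{\mathcal K}_t=\bigcup_{\tau\le t,\ \tau\text{ regular}}T\boldsymbol F_{t\tau}(\boldsymbol{\mathcal K}_\tau)$, and $\boldsymbol{\mathcal K}_0=\{0\}$. A hyperplane $\ker\lambda\subset T_{\boldsymbol q(t)}\boldsymbol Q$ ($\lambda\neq0$) separates $\boldsymbol{\mathcal K}_t$ from $\boldsymbol{\mathcal R}^-_{\boldsymbol q(t)}$ if, up to the sign of $\lambda$, $\langle\lambda,k\rangle\le0\le\langle\lambda,-\partial_{q_0}\rangle$ for all $k\in\boldsymbol{\mathcal K}_t$. A trajectory $(\boldsymbol q(t),\hat u(t))$ is an SR extremal if it satisfies the necessary conditions of the Pontryagin Maximum Principle, i.e. there is a curve of hyperplanes $\boldsymbol{\mathcal H}_t\subset T_{\boldsymbol q(t)}\boldsymbol Q$, $t\in[0,T]$,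 with $T\boldsymbol F_{t\tau}(\boldsymbol{\mathcal H}_\tau)=\boldsymbol{\mathcal H}_t$ for $0\le\tau\le t\le T$, each $\boldsymbol{\mathcal H}_t$ separating $\boldsymbol{\mathcal K}_t$ from $\boldsymbol{\mathcal R}^-_{\boldsymbol q(t)}$. It is abnormal if such a curve can be chosen with $\boldsymbol{\mathcal R}_{\boldsymbol q(t)}\subset\boldsymbol{\mathcal H}_t$ for every $t\in[0,T]$. **Distributions along curves.** A distribution $\mathcal B$ along $q(t)$ is a family of linear subspaces $\mathcal B_{q(t)}\subset T_{q(t)}Q$; it is $F_{t\tau}$-invariant along $q(t)$ if $\mathcal B_{q(t)}=TF_{t\tau}(\mathcal B_{q(\tau)})$ for all $t,\tau\in[0,T]$ (so its rank is constant). A Caratheodory time-dependent vector field is one which in local coordinates is locally bounded, differentiable in the space variable, measurable in $t$, with spatial derivative locally bounded, continuous in the space variable and measurable in $t$. *)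

(* Defs.v *)
From HB Require Import structures.
From mathcomp Require Export all_boot all_order all_algebra.
From mathcomp Require Export all_classical all_reals all_analysis.

Set Implicit Arguments.
Unset Strict Implicit.
Unset Printing Implicit Defensive.

Export Order.TTheory GRing.Theory Num.Theory.
Export numFieldNormedType.Exports.

Local Open Scope classical_set_scope.
Local Open Scope ring_scope.

Section Lebesgue.
Context {R : realType}.

(* the source carries the Lebesgue, not the Borel, sigma-algebra *)
Definition lebesgue_measurable_fun (I : set R) (h : R -> R) :=
  @measurable_fun _ _ (caratheodory_type (@wlength R idfun)^*%mu)
    (measurableTypeR R) I h.

End Lebesgue.

Section Smooth.
Context {R : realType} {V W : normedModType R}.

Fixpoint Ck (k : nat) (S : set V) (h : V -> W) : Prop :=
  if k is k'.+1 then
    (forall x, S x -> differentiable h x) /\ (forall v, Ck k' S ('D_v h))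
  else forall x, S x -> {for x, continuous h}.

(* C^oo on S; meaningful for open S *)
Definition smooth_on (S : set V) (h : V -> W) := forall k, Ck k S h.

End Smooth.

(* An atlas with one preferred chart [chart p] around each point [p], with
   domain [dom p] and inverse [inv_chart p].  The tangent space at [p] is
   represented by the model space [V]: a tangent vector at [p] is given by its
   coordinates in the chart [chart p]. *)
Record atlas (R : realType) (V : normedModType R) (M : topologicalType) :=
  Atlas {
    dom : M -> set M ;
    chart : M -> M -> V ;
    inv_chart : M -> V -> M }.

Section Manifold.
Context {R : realType} {V : normedModType R} {M : topologicalType}.
Variable A : atlas V M.

Record smooth_manifold : Prop := SmoothManifold {
  mfd_hausdorff : hausdorff_space M ;
  mfd_second_countable : @second_countable M ;
  mfd_dom_open : forall p, open (dom A p) ;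
  mfd_dom_mem : forall p, dom A p p ;
  mfd_image_open : forall p, open (chart A p @` dom A p) ;
  mfd_chartK : forall p x, dom A p x -> inv_chart A p (chart A p x) = x ;
  mfd_chart_cts : forall p x, dom A p x -> {for x, continuous (chart A p)} ;
  mfd_inv_cts : forall p x, dom A p x ->
    {for chart A p x, continuous (inv_chart A p)} ;
  mfd_transition : forall p p',
    smooth_on (chart A p @` (dom A p `&` dom A p'))
              (chart A p' \o inv_chart A p) }.

(* coordinates in [chart A p] of the tangent vector [v] at [x] *)
Definition coord_change (x p : M) (v : V) : V :=
  'd (chart A p \o inv_chart A x) (chart A x x) v.

(* the vector field [X] read in [chart A p] *)
Definition local_rep (X : M -> V) (p : M) (x : V) : V :=
  coord_change (inv_chart A p x) p (X (inv_chart A p x)).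

Definition smooth_field (S : set M) (X : M -> V) :=
  forall p, smooth_on (chart A p @` (dom A p `&` S)) (local_rep X p).

Definition smooth_function (S : set M) (h : M -> R^o) :=
  forall p, smooth_on (chart A p @` (dom A p `&` S)) (h \o inv_chart A p).

(* for [F : M -> M], the tangent map [T_x M -> T_(F x) M] *)
Definition tangent_map (F : M -> M) (x : M) : V -> V :=
  'd (chart A (F x) \o F \o inv_chart A x) (chart A x x).

Definition abs_continuous_on (I : set R) (h : R -> V) :=
  forall e : R, 0 < e -> exists2 delta : R, 0 < delta &
    forall (k : nat) (a b : 'I_k -> R),
      (forall i, [/\ I (a i), I (b i) & a i <= b i]) ->
      (forall i j, i != j -> b i <= a j \/ b j <= a i) ->
      \sum_(i < k) (b i - a i) < delta ->
      \sum_(i < k) `|h (b i) - h (a i)| < e.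

Definition has_velocity (c : R -> M) (t : R) (v : V) :=
  is_derive (t : R^o) 1 (chart A (c t) \o c : R^o -> V) v.

(* [c] solves x' = X t x on [a, b] in the sense of Caratheodory, staying in the
   domain [O] of the time-dependent field [X] *)
Definition integral_curve (O : set (R * M)) (X : R -> M -> V) (a b : R)
    (c : R -> M) :=
  [/\ forall t, a <= t <= b -> O (t, c t),
      forall t, a <= t <= b -> exists2 e : R, 0 < e &
        let I := [set s | a <= s <= b /\ `|s - t| <= e] in
        (forall s, I s -> dom A (c t) (c s)) /\
        abs_continuous_on I (chart A (c t) \o c)
    & {ae (@lebesgue_measure R),
        forall t, a <= t <= b -> has_velocity c t (X t (c t))}].

(* [flow O X t tau x] is the value at time [t] of the integral curve with value
   [x] at time [tau]; it is [x] if there is no such curve *)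
Definition flow (O : set (R * M)) (X : R -> M -> V) (t tau : R) (x : M) : M :=
  xget x [set y | exists c,
    [/\ integral_curve O X (Num.min t tau) (Num.max t tau) c,
        c tau = x & c t = y]].

End Manifold.

(* the atlas of [M x R] *)
Definition extended_atlas (R : realType) (V : normedModType R)
    (M : topologicalType) (A : atlas V M) :
    atlas (V * R^o)%type (M * R)%type :=
  @Atlas R (V * R^o)%type (M * R)%type
    (fun p => dom A p.1 `*` setT)
    (fun p x => (chart A p.1 x.1, x.2))
    (fun p y => (inv_chart A p.1 y.1, y.2)).

Section TimeDependentFields.
Context {R : realType} {n : nat} {Q : topologicalType}.
Variable A : atlas 'rV[R]_n Q.

(* [X] need only be meaningful on the part of the open set [O] lying over
   [0, T] *)
Definition caratheodory (T : R) (O : set (R * Q)) (X : R -> Q -> 'rV[R]_n) :=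
  forall t0 p, 0 <= t0 <= T -> O (t0, p) ->
  exists e C : R, 0 < e /\
    let I := [set t | 0 <= t <= T /\ `|t - t0| < e] in
    let N := ball (chart A p p) e in
    let Xp t := local_rep A (X t) p in
    [/\ N `<=` chart A p @` dom A p,
        forall t x, I t -> N x -> O (t, inv_chart A p x),
        forall t x, I t -> N x ->
          [/\ `|Xp t x| <= C,
              differentiable (Xp t) x,
              forall v, `|'d (Xp t) x v| <= C * `|v| &
              forall v, {for x, continuous (fun y => 'd (Xp t) y v)}] &
        forall x i, N x ->
          lebesgue_measurable_fun I (fun t => Xp t x ord0 i) /\
          forall v, lebesgue_measurable_fun I (fun t => 'd (Xp t) x v ord0 i)].

End TimeDependentFields.

Section SubRiemannian.
Context {R : realType} {n : nat} {Q : topologicalType}.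
Variable A : atlas 'rV[R]_n Q.

Definition local_frame (d : nat) (D : Q -> {vspace 'rV[R]_n}) (S : set Q)
    (f : 'I_d -> Q -> 'rV[R]_n) :=
  [/\ open S, forall i, smooth_field A S (f i) &
      forall p, S p -> D p = <<[seq f i p | i : 'I_d]>>%VS].

Definition smooth_distribution (d : nat) (D : Q -> {vspace 'rV[R]_n}) :=
  (forall p, \dim (D p) = d) /\
  (forall p, exists (S : set Q) (f : 'I_d -> Q -> 'rV[R]_n),
     S p /\ local_frame D S f).

Record sr_metric (D : Q -> {vspace 'rV[R]_n})
    (g : Q -> 'rV[R]_n -> 'rV[R]_n -> R) : Prop := SRMetric {
  srg_sym : forall p v w, v \in D p -> w \in D p -> g p v w = g p w v ;
  srg_linear : forall p a v v' w, v \in D p -> v' \in D p -> w \in D p ->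
    g p (a *: v + v') w = a * g p v w + g p v' w ;
  srg_pos : forall p v, v \in D p -> v != 0 -> 0 < g p v v ;
  srg_smooth : forall (S : set Q) (X Y : Q -> 'rV[R]_n), open S ->
    smooth_field A S X -> smooth_field A S Y ->
    (forall p, S p -> X p \in D p /\ Y p \in D p) ->
    smooth_function A S (fun p => g p (X p) (Y p)) }.

End SubRiemannian.

Section Control.
Context {R : realType} {d : nat}.

Definition admissible_control (T : R) (u : R -> 'rV[R]_d) :=
  (forall i, lebesgue_measurable_fun `[0, T] (fun t => u t ord0 i)) /\
  (forall t, 0 <= t <= T -> exists e C : R, 0 < e /\
     forall s, 0 <= s <= T -> `|s - t| < e -> `|u s| <= C).

(* only interior points of [0, T] are considered *)
Definition regular_point (T : R) (u : R -> 'rV[R]_d) (t : R) :=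
  0 < t < T /\
  forall O : set 'rV[R]_d, open O -> O (u t) ->
  forall e : R, 0 < e -> exists2 delta : R, 0 < delta &
  forall a b : R, a < t < b -> b - a < delta ->
    `| fine (completed_lebesgue_measure (u @^-1` O `&` `]a, b[))
       / fine (completed_lebesgue_measure (`]a, b[%classic : set R)) - 1 | < e.

End Control.

Section GeodesicProblem.
Context {R : realType} {n d : nat} {Q : topologicalType}.
Variables (A : atlas 'rV[R]_n Q) (g : Q -> 'rV[R]_n -> 'rV[R]_n -> R).
(* the frame [f] of the distribution is given on the subset [W] of [Q] *)
Variables (W : set Q) (f : 'I_d -> Q -> 'rV[R]_n).
Variables (T : R) (u : R -> 'rV[R]_d).

Definition control_field (v : 'rV[R]_d) (x : Q) : 'rV[R]_n :=
  \sum_(i < d) v ord0 i *: f i x.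

Definition lagrangian (x : Q) (v : 'rV[R]_d) : R :=
  2^-1 * g x (control_field v x) (control_field v x).

Definition extended_field (v : 'rV[R]_d) (x : Q * R) : 'rV[R]_n * R^o :=
  (control_field v x.1, lagrangian x.1 v).

(* domains of [f_u] and of the extended field, over all times *)
Definition frame_domain : set (R * Q) := [set x | W x.2].
Definition extended_domain : set (R * (Q * R)) := [set x | W x.2.1].

Definition sr_trajectory (qq : R -> Q * R) :=
  integral_curve A frame_domain (fun t => control_field (u t)) 0 T
    (fun t => (qq t).1) /\
  forall t, 0 <= t <= T ->
    (qq t).2 = \int[completed_lebesgue_measure]_(s in `[0, t])
                 lagrangian (qq s).1 (u s).

Definition control_flow : R -> R -> Q -> Q :=
  flow A frame_domain (fun t => control_field (u t)).

Definition extended_flow : R -> R -> Q * R -> Q * R :=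
  flow (extended_atlas A) extended_domain (fun t => extended_field (u t)).

Variable qq : R -> Q * R.

(* the tangent map of the extended flow F_(t,tau) at the point qq(tau) *)
Definition extended_transport (t tau : R) :
    'rV[R]_n * R^o -> 'rV[R]_n * R^o :=
  tangent_map (extended_atlas A) (extended_flow t tau) (qq tau).

Definition regular_cone (t : R) : set ('rV[R]_n * R^o) :=
  closure [set w | exists (k : nat) (s : 'I_k -> R) (v : 'I_k -> 'rV[R]_d)
      (ds : 'I_k -> R),
    [/\ forall i, regular_point T u (s i) /\ s i <= t,
        forall i j : 'I_k, (i <= j)%N -> s i <= s j,
        forall i, 0 <= ds i &
        w = \sum_(i < k) ds i *: extended_transport t (s i)
              (extended_field (v i) (qq (s i))
               - extended_field (u (s i)) (qq (s i)))]].

Definition pmp_cone (t : R) : set ('rV[R]_n * R^o) :=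
  [set w | (t = 0 /\ w = 0) \/
    (0 < t /\ regular_point T u t /\ regular_cone t w) \/
    (0 < t /\ ~ regular_point T u t /\
     exists tau, [/\ tau <= t, regular_point T u tau &
       (extended_transport t tau @` regular_cone tau) w])].

Definition cost_line : set ('rV[R]_n * R^o) := [set (0, r) | r in setT].

Definition negative_cost_ray : set ('rV[R]_n * R^o) :=
  [set (0, - r) | r in [set r : R^o | 0 <= r]].

(* [H] is a hyperplane separating [K] from [N] *)
Definition separates (H K N : set ('rV[R]_n * R^o)) :=
  exists l : {linear ('rV[R]_n * R^o)%type -> R^o},
    [/\ exists v, l v != 0,
        H = [set v | l v = 0],
        forall k, K k -> l k <= 0 &
        forall r, N r -> 0 <= l r].

Definition pmp_hyperplanes (H : R -> set ('rV[R]_n * R^o)) :=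
  (forall tau t, 0 <= tau -> tau <= t -> t <= T ->
     extended_transport t tau @` H tau = H t) /\
  (forall t, 0 <= t <= T -> separates (H t) (pmp_cone t) negative_cost_ray).

Definition sr_extremal := exists H, pmp_hyperplanes H.

Definition abnormal_sr_extremal := exists H, pmp_hyperplanes H /\
  forall t, 0 <= t <= T -> cost_line `<=` H t.

End GeodesicProblem.

Section AlongCurve.
Context {R : realType} {n : nat} {Q : topologicalType}.
Variables (A : atlas 'rV[R]_n Q) (T : R) (q : R -> Q).

(* distributions along [q] are families [B : R -> set 'rV_n], with [B t] a
   subset of the tangent space at [q t]; only [t] in [0, T] matters *)

Definition linear_span (S : set 'rV[R]_n) : set 'rV[R]_n :=
  [set w | exists (k : nat) (a : 'I_k -> R) (v : 'I_k -> 'rV[R]_n),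
    (forall i, S (v i)) /\ w = \sum_(i < k) a i *: v i].

Definition distribution_along (B : R -> set 'rV[R]_n) :=
  forall t, 0 <= t <= T ->
    B t 0 /\ forall a v w, B t v -> B t w -> B t (a *: v + w).

Definition flow_invariant (F : R -> R -> Q -> Q) (B : R -> set 'rV[R]_n) :=
  forall t tau, 0 <= t <= T -> 0 <= tau <= T ->
    B t = tangent_map A (F t tau) (q tau) @` B tau.

Definition contains_distribution (D : Q -> {vspace 'rV[R]_n})
    (B : R -> set 'rV[R]_n) :=
  forall t, 0 <= t <= T -> forall v, v \in D (q t) -> B t v.

Definition smallest_invariant (F : R -> R -> Q -> Q)
    (D : Q -> {vspace 'rV[R]_n}) (B : R -> set 'rV[R]_n) :=
  [/\ distribution_along B, flow_invariant F B, contains_distribution D B &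
      forall B', distribution_along B' -> flow_invariant F B' ->
        contains_distribution D B' ->
        forall t, 0 <= t <= T -> B t `<=` B' t].

Definition flow_span (F : R -> R -> Q -> Q) (D : Q -> {vspace 'rV[R]_n})
    (t : R) : set 'rV[R]_n :=
  linear_span [set w | exists tau Y, [/\ 0 <= tau <= T, Y \in D (q tau) &
    w = tangent_map A (F t tau) (q tau) Y]].

(* [n] is the dimension of [Q] *)
Definition rank_lt_dim (B : R -> set 'rV[R]_n) :=
  forall t, 0 <= t <= T -> exists U : {vspace 'rV[R]_n},
    B t = [set v | v \in U] /\ (\dim U < n)%N.

(* [X] is a [D]-valued Caratheodory field on the neighborhood [O] of the graph
   of [q] which extends the velocity field [Y t] along [q] *)
Definition velocity_extension (D : Q -> {vspace 'rV[R]_n})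
    (Y : R -> 'rV[R]_n) (O : set (R * Q)) (X : R -> Q -> 'rV[R]_n) :=
  [/\ open O,
      forall t, 0 <= t <= T -> O (t, q t),
      caratheodory A T O X,
      forall t p, 0 <= t <= T -> O (t, p) -> X t p \in D p &
      {ae (@lebesgue_measure R),
        forall t, 0 <= t <= T -> X t (q t) = Y t}].

End AlongCurve.

(* Main.v *)
From HB Require Import structures.
From mathcomp Require Import measurable_realfun ftc ring lra.
Require Import Defs.

Set Implicit Arguments.
Unset Strict Implicit.
Unset Printing Implicit Defensive.

Local Open Scope classical_set_scope.
Local Open Scope ring_scope.

(* The tangent maps of the flow along [q] are, in charts, the resolvents of the
   linearized equation; so they are linear isomorphisms [DF t s] with
   [DF t s \o DF s r = DF t r], and the span of all [DF t s (D (q s))] is the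
   smallest invariant distribution containing [D].

   The extended field does not depend on [q_0], hence the extended transport
   sends [(v, r)] to a vector whose first component is [DF t s v].  Hyperplanes
   [H t] containing the cost line are therefore given by a covector [lam] at
   time 0 through [H t = {(v, r) | lam (DF 0 t v) = 0}].  At a regular time [s]
   the elementary variations [u s + w] and [u s - w] both lie in the cone, so a
   separating [H s] contains [D (q s)]; almost every time is regular (Lebesgue
   density) and [s |-> lam (DF 0 s (f i (q s)))] is continuous, so [lam] kills
   the whole span.  Conversely a covector killing the span gives an abnormal
   extremal.

   If [X] is another [D]-valued extension of the velocity of [q] then
   [Z = X t - f_(u t)] vanishes at [q t] for almost every [t]; as [Z] is a
   combination of the frame with coefficients bounded by [|Z|], its derivative
   at [q t] takes values in [D (q t)].  For [lam] killing the span for [f_u] at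
   time [r], the function [t |-> lam (DF r t (DX t s Y))] is locally Lipschitz
   with zero derivative almost everywhere, hence constant, and so [lam] kills
   the span for [X] as well. *)

(** * Calculus in normed spaces with coordinates *)

Section ZmodReflection.

(** Tangent maps of the flow are available only after existence, uniqueness and differentiability
    are established for right-hand sides that are merely measurable in time. The estimates work on
    intervals with [L * (b - a) <= 2^-1] inside one chart. Each local statement is therefore phrased
    additively in the interval, and [cousin] extends it to [[0, T]] without choosing a chain of
    charts. Velocities exist only almost everywhere, so increments of solutions are estimated
    through [ae_derivative_bound], which combines absolute continuity with a bound on the
    derivative. The flow theory is applied twice, on [Q] and on [Q * R]. This is why the model space
    is an arbitrary normed space with [coordinates], and why the two fields are brought to the
    common form [\sum_j a j t *: Y j x]. When two extensions of the velocity are compared, the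
    coefficients of [Z] in the frame have no known regularity, so the product rule cannot be applied
    to them; only their size enters. *)

Inductive zexpr := ZVar of nat | ZAdd of zexpr & zexpr | ZOpp of zexpr | ZZero.

Fixpoint zeval (V : zmodType) (e : seq V) (t : zexpr) : V :=
  match t with
  | ZVar n => nth 0 e n
  | ZAdd a b => zeval e a + zeval e b
  | ZOpp a => - zeval e a
  | ZZero => 0
  end.

Fixpoint zcoef (t : zexpr) (i : nat) : int :=
  match t with
  | ZVar n => (n == i)%:Z
  | ZAdd a b => zcoef a i + zcoef b i
  | ZOpp a => - zcoef a i
  | ZZero => 0
  end.

Lemma zevalE (V : zmodType) (e : seq V) t :
  zeval e t = \sum_(i < size e) nth 0 e i *~ zcoef t i.
Proof.
elim: t => [n|a IHa b IHb|a IHa|] /=.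
- have [ns|sn] := ltnP n (size e).
    rewrite (bigD1 (Ordinal ns)) //= eqxx mulr1z big1 ?addr0// => i.
    by rewrite -val_eqE /= eq_sym => /negPf ->; rewrite mulr0z.
  rewrite nth_default// big1// => i _.
  by rewrite gtn_eqF ?mulr0z// (leq_trans _ sn).
- by rewrite IHa IHb -big_split; apply: eq_bigr => i _; rewrite mulrzDr.
- by rewrite IHa -sumrN; apply: eq_bigr => i _; rewrite mulrNz.
- by rewrite big1// => i _; rewrite mulr0z.
Qed.

(** Equal integer coefficients at every atom force equal values. The test is a computation in [int],
    so the tactic below closes a goal with the proof [isT]. *)
Lemma zmod_reflect (V : zmodType) (e : seq V) t1 t2 :
  all (fun i => zcoef t1 i == zcoef t2 i) (iota 0 (size e)) ->
  zeval e t1 = zeval e t2.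
Proof.
move=> /allP H; rewrite !zevalE; apply: eq_bigr => i _.
by rewrite (eqP (H i _))// mem_iota /= add0n.
Qed.

End ZmodReflection.

Ltac zmod_lookup x e :=
  match e with
  | ?y :: ?e' => match constr:(tt) with
                 | _ => let _ := match goal with _ => unify x y end in constr:(0%N)
                 | _ => let n := zmod_lookup x e' in constr:(n.+1)
                 end
  end.
Ltac zmod_add x e :=
  match constr:(tt) with
  | _ => let _ := zmod_lookup x e in e
  | _ => constr:(x :: e)
  end.
Ltac zmod_atoms t e :=
  lazymatch t with
  | (?a + ?b)%R => let e := zmod_atoms a e in zmod_atoms b e
  | (- ?a)%R => zmod_atoms a e
  | 0%R => e
  | _ => zmod_add t e
  end.
Ltac zmod_quote t e :=
  lazymatch t with
  | (?a + ?b)%R => let a := zmod_quote a e in let b := zmod_quote b e in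
                   constr:(ZAdd a b)
  | (- ?a)%R => let a := zmod_quote a e in constr:(ZOpp a)
  | 0%R => constr:(ZZero)
  | _ => let n := zmod_lookup t e in constr:(ZVar n)
  end.
(* Both sides are compared as integral combinations of atoms, after pushing
   scalings to the atoms. *)
Ltac zmod :=
  rewrite ?(scalerDl, scalerDr, scalerBl, scalerBr, scaleNr, scalerN, scale1r);
  lazymatch goal with
  | |- @eq ?V ?a ?b =>
    let e := zmod_atoms a (@nil V) in
    let e := zmod_atoms b e in
    let ta := zmod_quote a e in
    let tb := zmod_quote b e in
    exact: (@zmod_reflect _ e ta tb isT)
  end.

(** * From short intervals to a whole interval *)

Section Cousin.
Context {R : realType}.

(** The supremum of the [t] with [P a t] is attained and cannot lie below [b]. Every passage from
    local to global goes through this form: additivity replaces compactness, and the short intervals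
    only have to contain their tag [t]. *)
Lemma cousin (P : R -> R -> Prop) (a b : R) : a <= b ->
  (forall x y z, a <= x -> x <= y -> y <= z -> z <= b -> P x y -> P y z -> P x z) ->
  (forall t, a <= t <= b -> exists2 e, 0 < e &
     forall x y, a <= x -> x <= t -> t <= y -> y <= b -> y - x < e -> P x y) ->
  P a b.
Proof.
move=> ab Padd Ploc.
pose S := [set t | a <= t <= b /\ P a t].
have Sa : S a.
  split; first by rewrite lexx ab.
  have [|e e0 H] := Ploc a; first by rewrite lexx ab.
  by apply: H => //; rewrite subrr.
have ubS : ubound S b by move=> t [/andP[]].
have hsS : has_sup S by split; [exists a | exists b].
have sb : sup S <= b by apply: ge_sup => //; exists a.
have as_ : a <= sup S by apply: ub_le_sup => //; exists b.
have [|e e0 H] := Ploc (sup S); first by rewrite as_ sb.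
have e20 : 0 < e / 2 by rewrite divr_gt0.
have [t [/andP[at_ tb] Pat] st] := sup_adherent e20 hsS.
have ts : t <= sup S by apply: ub_le_sup => //; [exists b | split => //; rewrite at_ tb].
(* The point [t] lies less than [e / 2] below the supremum and [s'] at most [e / 3] above it, so
   [[t, s']] is shorter than [e]. *)
pose s' := Num.min b (sup S + e / 3).
have s's : sup S <= s' by rewrite /s' le_min sb /= lerDl divr_ge0 // ltW.
have s'b : s' <= b by rewrite /s' ge_min lexx.
have s'e : s' <= sup S + e / 3 by rewrite /s' ge_min lexx orbT.
have Pas' : P a s'.
  apply: (Padd _ t) => //; first exact: le_trans s's.
  by apply: H => //; lra.
have : s' <= sup S.
  apply: ub_le_sup; first by exists b.
  by split=> //; rewrite (le_trans as_ s's) s'b.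
rewrite /s' minElt; case: ifPn => [_ bs|_ H2]; last by exfalso; lra.
by move: Pas'; rewrite (_ : s' = b) //; apply/eqP; rewrite eq_le s'b (le_trans bs).
Qed.

End Cousin.

Section EpsilonDelta.
Context {R : realType}.
Implicit Types V W : normedModType R.

Lemma nbhs_normE V (x : V) (P : set V) :
  nbhs x P <-> exists2 d : R, 0 < d & forall y, `|y - x| < d -> P y.
Proof.
split=> [/nbhs_ballP[d d0 H]|[d d0 H]].
  by exists d => // y yx; apply: H; rewrite -ball_normE /= distrC.
apply/nbhs_ballP; exists d => // y; rewrite -ball_normE /= => yx.
by apply: H; rewrite distrC.
Qed.

Lemma continuousE V W (f : V -> W) (x : V) : {for x, continuous f} <->
  forall e : R, 0 < e -> exists2 d : R, 0 < d & forall y, `|y - x| < d -> `|f y - f x| <= e.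
Proof.
split=> [/cvgrPdist_le H e e0|H].
  have /nbhs_normE[d d0 {}H] := H _ e0.
  by exists d => // y /H /=; rewrite distrC.
apply/cvgrPdist_le => e e0; have [d d0 {}H] := H e e0.
by apply/nbhs_normE; exists d => // y /H /=; rewrite distrC.
Qed.

(** Division-free forms of derivability and differentiability, which turn the calculus rules into
    direct estimates. In [frechet] the map [L] is an arbitrary function; linearity and continuity
    are asked for only when converting back to [differentiable]. *)
Definition der V (f : R -> V) (t : R) (v : V) := forall e : R, 0 < e ->
  exists2 d : R, 0 < d & forall s, `|s - t| < d ->
    `|f s - f t - (s - t) *: v| <= e * `|s - t|.

Definition frechet V W (f : V -> W) (x : V) (L : V -> W) := forall e : R, 0 < e ->
  exists2 d : R, 0 < d & forall y, `|y - x| < d ->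
    `|f y - f x - L (y - x)| <= e * `|y - x|.

Lemma is_derive_der V (f : R -> V) (t : R) (v : V) :
  is_derive (t : R^o) 1 (f : R^o -> V) v <-> der f t v.
Proof.
split=> [[dft dfv]|H].
- have : (fun h : R^o => h^-1 *: ((f \o shift (t : R^o)) (h *: 1) - f t)) @ 0^' --> v.
    by rewrite -dfv; exact: dft.
  move=> /cvgrPdist_le C e e0; have [d /= d0 D] := C e e0.
  exists d => // s sd; have [->|st] := eqVneq s t.
    by rewrite !subrr normr0 scale0r subr0 normr0 mulr0.
  have st0 : s - t != 0 by rewrite subr_eq0.
  have := D (s - t); rewrite /= sub0r normrN => /(_ sd st0).
  rewrite [(s - t) *: 1]mulr1 subrK => D'.
  have -> : f s - f t - (s - t) *: v = - ((s - t) *: (v - (s - t)^-1 *: (f s - f t))).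
    by rewrite scalerBr scalerA mulfV// scale1r opprB.
  by rewrite normrN normrZ mulrC ler_wpM2r.
- have C : (fun h : R^o => h^-1 *: ((f \o shift (t : R^o)) (h *: 1) - f t)) @ 0^' --> v.
    apply/cvgrPdist_le => e e0; have [d d0 D] := H e e0.
    exists d => //= h /=; rewrite sub0r normrN => hd h0.
    have := D (h + t); rewrite addrK => /(_ hd).
    rewrite -ler_pdivrMr ?normr_gt0// => /(le_trans _); apply.
    rewrite [h *: 1]mulr1.
    have -> : v - h^-1 *: (f (h + t) - f t) = - (h^-1 *: (f (h + t) - f t - h *: v)).
      by rewrite [h^-1 *: (_ - h *: v)]scalerBr scalerA mulVf// scale1r opprB.
    by rewrite normrN normrZ normrV ?unitfE// mulrC.
  by split; [apply/cvg_ex; exists v | apply/cvg_lim => //; exact: norm_hausdorff].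
Qed.

Lemma differentiable_frechet V W (f : V -> W) (x : V) :
  differentiable f x -> frechet f x ('d f x).
Proof.
move=> /diff_locally /eqaddoP H e e0.
have /nbhs_normE[d d0 D] := H e e0; exists d => // y yx.
have := D (y - x); rewrite subr0 => /(_ yx) /=.
by rewrite !fctE /= subrK opprD addrA.
Qed.

Lemma frechet_differentiable V W (f : V -> W) (x : V) (L : {linear V -> W}) :
  continuous L -> frechet f x L -> differentiable f x /\ 'd f x = L :> (V -> W).
Proof.
move=> Lc fL.
have E : f \o shift x = cst (f x) + L +o_ 0 id.
  apply/eqaddoP => e e0; have [d d0 D] := fL e e0.
  apply/nbhs_normE; exists d => // h; rewrite subr0 => hd.
  have := D (h + x); rewrite addrK => /(_ hd).
  by rewrite !fctE /= opprD addrA.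
have dE : 'd f x = L :> (V -> W) by apply: diff_unique.
by split => //; apply/diff_locallyP; rewrite dE.
Qed.

(** The error splits into that of [f] at the increment of [c], and the image under [L] of the error
    of [c]; the bound [K] controls the second part. *)
Lemma der_frechet V W (c : R -> V) (f : V -> W) (t : R) (v : V) (L : {linear V -> W}) (K : R) :
  0 <= K -> (forall w, `|L w| <= K * `|w|) ->
  der c t v -> frechet f (c t) L -> der (f \o c) t (L v).
Proof.
move=> K0 LK ct fL e e0.
(* [M] is a local Lipschitz constant of [c] at [t]: the slope [|v|] plus an error of rate 1. *)
pose M := `|v| + 1.
have M0 : 0 < M by rewrite ltr_wpDl.
have K1 : 0 < K + 1 by rewrite ltr_wpDl.
have [d1 d10 D1] := ct 1 ltr01.
have e1 : 0 < e / 2 / M by rewrite !divr_gt0.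
have e2 : 0 < e / 2 / (K + 1) by rewrite !divr_gt0.
have [d2 d20 D2] := fL _ e1.
have [d3 d30 D3] := ct _ e2.
exists (Num.min d1 (Num.min (d2 / M) d3)); first by rewrite !lt_min d10 d30 divr_gt0.
move=> s; rewrite !lt_min => /and3P[sd1 sd2 sd3] /=.
have cst : `|c s - c t| <= M * `|s - t|.
  rewrite -[c s - c t](subrK ((s - t) *: v)) (le_trans (ler_normD _ _))//.
  by rewrite normrZ mulrDl addrC mulrC lerD2l D1.
have csd : `|c s - c t| < d2.
  by apply: le_lt_trans cst _; rewrite mulrC -ltr_pdivlMr.
have H2 := D2 _ csd; have H3 := D3 _ sd3.
have -> : f (c s) - f (c t) - (s - t) *: L v =
    (f (c s) - f (c t) - L (c s - c t)) + L (c s - c t - (s - t) *: v).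
  by rewrite !(linearB L) !(linearZ_LR L); zmod.
apply: le_trans (ler_normD _ _) _; apply: le_trans (lerD H2 (LK _)) _.
have -> : e * `|s - t| = e / 2 * `|s - t| + e / 2 * `|s - t| by rewrite -mulrDl -splitr.
apply: lerD.
  apply: (@le_trans _ _ (e / 2 / M * (M * `|s - t|))); first by rewrite ler_wpM2l// ltW.
  by rewrite mulrA divfK// gt_eqF.
apply: (@le_trans _ _ ((K + 1) * (e / 2 / (K + 1) * `|s - t|))).
  by apply: ler_pM => //; rewrite lerDl.
by rewrite mulrA [(K + 1) * _]mulrC divfK// gt_eqF.
Qed.

Lemma der_eq V (f g : R -> V) t v : (exists2 d : R, 0 < d & forall s, `|s - t| < d -> f s = g s) ->
  der f t v -> der g t v.
Proof.
move=> [d d0 fg] ft e e0; have [d' d'0 D] := ft e e0.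
exists (Num.min d d'); first by rewrite lt_min d0.
move=> s; rewrite lt_min => /andP[sd sd'].
by rewrite -!fg ?subrr ?normr0//; exact: D.
Qed.

Lemma near_interior (a b t : R) : a < t < b ->
  exists2 d : R, 0 < d & forall s, `|s - t| < d -> a <= s <= b.
Proof.
move=> /andP[at_ tb]; exists (Num.min (t - a) (b - t)); first by rewrite lt_min !subr_gt0 at_.
move=> s; rewrite lt_min !ltr_norml => /andP[/andP[s1 s2] /andP[s3 s4]].
by apply/andP; split; lra.
Qed.

Lemma der_eq_interior V (f g : R -> V) a b t v : a < t < b ->
  (forall s, a <= s <= b -> f s = g s) -> der f t v -> der g t v.
Proof.
by move=> /near_interior[d d0 D] fg; apply: der_eq; exists d => // s /D; exact: fg.
Qed.

Lemma frechet_eq V W (f g : V -> W) x L : (exists2 d : R, 0 < d & forall s, `|s - x| < d -> f s = g s) ->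
  frechet f x L -> frechet g x L.
Proof.
move=> [d d0 fg] ft e e0; have [d' d'0 D] := ft e e0.
exists (Num.min d d'); first by rewrite lt_min d0.
move=> s; rewrite lt_min => /andP[sd sd'].
by rewrite -!fg ?subrr ?normr0//; exact: D.
Qed.

Lemma derD V (f g : R -> V) t v w : der f t v -> der g t w ->
  der (fun s => f s + g s) t (v + w).
Proof. by move=> /is_derive_der fv /is_derive_der gw; apply/is_derive_der; exact: is_deriveD. Qed.

Lemma derB V (f g : R -> V) t v w : der f t v -> der g t w ->
  der (fun s => f s - g s) t (v - w).
Proof. by move=> /is_derive_der fv /is_derive_der gw; apply/is_derive_der; exact: is_deriveB. Qed.

Lemma der_uniq V (f : R -> V) t v w : der f t v -> der f t w -> v = w.
Proof. by move=> /is_derive_der[_ <-] /is_derive_der[_ <-]. Qed.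

Lemma der_scale V (f : R -> R) t r (v : V) : der f t r -> der (fun s => f s *: v) t (r *: v).
Proof.
move=> fr e e0; have v1 : 0 < `|v| + 1 by rewrite ltr_wpDl.
have [|d d0 D] := fr (e / (`|v| + 1)); first by rewrite divr_gt0.
exists d => // s sd; rewrite -scalerBl [(s - t) *: (r *: v)]scalerA -scalerBl normrZ.
apply: (@le_trans _ _ (e / (`|v| + 1) * `|s - t| * (`|v| + 1))).
  by apply: ler_pM => //; [exact: D | rewrite lerDl].
by rewrite mulrAC divfK// gt_eqF.
Qed.

Lemma der_sum V (I : finType) (f : I -> R -> V) t (v : I -> V) :
  (forall i, der (f i) t (v i)) -> der (fun s => \sum_i f i s) t (\sum_i v i).
Proof.
move=> H; rewrite -[X in der X]/(fun s => \sum_(i <- index_enum I) f i s).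
elim: (index_enum I) => [|i r IH].
  rewrite big_nil => e e0; exists 1 => // s _; rewrite !big_nil subr0 scaler0 subrr normr0.
  by rewrite mulr_ge0// ltW.
rewrite big_cons; apply: der_eq (derD (H i) IH).
by exists 1 => // s _; rewrite big_cons.
Qed.

(** Functions such as [fun v => l (DF t s v)] are linear but not bundled; this makes the bounds and
    derivative rules for linear maps applicable to them. *)
Lemma mk_linear V W (f : V -> W) :
  (forall a v w, f (a *: v + w) = a *: f v + f w) ->
  {L : {linear V -> W} | forall v, L v = f v}.
Proof.
move=> fl.
by exists (HB.pack_for {linear V -> W} f (GRing.isLinear.Build R V W _ f fl)).
Qed.

End EpsilonDelta.

Section Coordinates.
Context {R : realType}.

(* A common finite-dimensionality interface for ['rV_n] and ['rV_n * R^o]. *)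
Record coordinates (V : normedModType R) := Coordinates {
  cdim : nat;
  cvec : 'I_cdim -> V;
  coef : 'I_cdim -> V -> R;
  coef_linear : forall i a v w, coef i (a *: v + w) = a * coef i v + coef i w;
  coef_bound : forall i v, `|coef i v| <= `|v|;
  coefK : forall v, v = \sum_i coef i v *: cvec i }.

Arguments cvec {V} c i.
Arguments coef {V} c i v.

Variables (V : normedModType R) (B : coordinates V).

Definition cbound := \sum_i `|cvec B i|.

Lemma cbound_ge0 : 0 <= cbound.
Proof. by apply: sumr_ge0. Qed.

Lemma coef0 i : coef B i 0 = 0.
Proof. by have := coef_linear i 1 (0 : V) 0; rewrite scale1r addr0 mul1r; lra. Qed.

Lemma coefD i (v w : V) : coef B i (v + w) = coef B i v + coef B i w.
Proof. by have := coef_linear i 1 v w; rewrite scale1r mul1r. Qed.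

Lemma coefZ i a (v : V) : coef B i (a *: v) = a * coef B i v.
Proof. by have := coef_linear i a v 0; rewrite !addr0 coef0 addr0. Qed.

Lemma coefN i (v : V) : coef B i (- v) = - coef B i v.
Proof. by rewrite -scaleN1r coefZ mulN1r. Qed.

Lemma coefBr i (v w : V) : coef B i (v - w) = coef B i v - coef B i w.
Proof. by rewrite coefD coefN. Qed.

Lemma coef_sum i (I : finType) (v : I -> V) : coef B i (\sum_j v j) = \sum_j coef B i (v j).
Proof. by elim/big_rec2: _ => [|j y1 y2 _ <-]; rewrite ?coef0// coefD. Qed.

Lemma norm_coef_le (v : V) (M : R) :
  (forall i, `|coef B i v| <= M) -> `|v| <= M * cbound.
Proof.
move=> H; rewrite [v in leLHS](coefK B) (le_trans (ler_norm_sum _ _ _))//.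
by rewrite mulr_sumr ler_sum// => i _; rewrite normrZ ler_wpM2r.
Qed.

Lemma linear_bound (W : normedModType R) (L : {linear V -> W}) :
  exists2 K : R, 0 <= K & forall v, `|L v| <= K * `|v|.
Proof.
exists (\sum_i `|L (cvec B i)|); first by apply: sumr_ge0.
move=> v; rewrite [v in leLHS](coefK B) linear_sum (le_trans (ler_norm_sum _ _ _))//.
rewrite mulr_suml ler_sum// => i _.
by rewrite linearZ_LR normrZ mulrC ler_wpM2l// coef_bound.
Qed.

Lemma linear_continuous_coord (W : normedModType R) (L : {linear V -> W}) : continuous L.
Proof.
move=> x; apply/continuousE => e e0; have [K K0 H] := linear_bound L.
exists (e / (K + 1)); first by rewrite divr_gt0// ltr_wpDl.
move=> y yx; rewrite -linearB (le_trans (H _))//.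
apply: (@le_trans _ _ ((K + 1) * `|y - x|)); first by rewrite ler_wpM2r// lerDl.
by rewrite mulrC -ler_pdivlMr ?ltr_wpDl// ltW.
Qed.

Lemma frechet_diff (W : normedModType R) (f : V -> W) x (L : {linear V -> W}) :
  frechet f x L -> differentiable f x /\ forall v, 'd f x v = L v.
Proof.
by move=> /(frechet_differentiable (@linear_continuous_coord _ L))[? ->].
Qed.

Lemma der_coef (f : R -> V) t v i : der f t v -> der (fun s => coef B i (f s)) t (coef B i v : R^o).
Proof.
move=> fv e e0; have [d d0 D] := fv e e0; exists d => // s sd.
rewrite -coefBr [(s - t) *: _](_ : _ = coef B i ((s - t) *: v)); last by rewrite coefZ.
by rewrite -coefBr; apply: le_trans (coef_bound _ _) _; exact: D.
Qed.

End Coordinates.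

Arguments cvec {R V} c i.
Arguments coef {R V} c i v.

(** A vector-valued map has no common intermediate point, so the mean value theorem is applied to
    each coordinate along the segment; recombining the coordinates costs the factor [cbound BW]. *)
Lemma lipschitz_segment (R : realType) (V : normedModType R) (B : coordinates V) (W : normedModType R) (BW : coordinates W) (f : V -> W) (S : set V) (K : R) :
  0 <= K ->
  (forall x y r, S x -> S y -> 0 <= r <= 1 -> S (x + r *: (y - x))) ->
  (forall x, S x -> differentiable f x /\ forall v, `|'d f x v| <= K * `|v|) ->
  forall x y, S x -> S y -> `|f y - f x| <= (K * cbound BW) * `|y - x|.
Proof.
move=> K0 Sc Sd x y Sx Sy; rewrite mulrAC; apply: norm_coef_le => i.
pose c (r : R) := x + r *: (y - x).
have cd r : der c r (y - x).
  move=> e e0; exists 1 => // s _; rewrite /c.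
  have -> : x + s *: (y - x) - (x + r *: (y - x)) - (s - r) *: (y - x) = 0 by zmod.
  by rewrite normr0 mulr_ge0// ltW.
have fd r : 0 <= r <= 1 -> der (fun r => coef BW i (f (c r)) : R^o) r (coef BW i ('d f (c r) (y - x))).
  move=> r01; apply: der_coef; have [df _] := Sd _ (Sc _ _ r Sx Sy r01).
  have [M M0 HM] := linear_bound B ('d f (c r)).
  exact: (der_frechet M0 HM (cd r) (differentiable_frechet df)).
have [r /andP[r0 r1] E] : exists2 r, 0 <= r <= 1 & coef BW i (f (c 1)) - coef BW i (f (c 0)) = coef BW i ('d f (c r) (y - x)).
  have [||r /itvP r01 E] := @MVT R (fun r => coef BW i (f (c r))) (fun r => coef BW i ('d f (c r) (y - x))) 0 1 ltr01.
  - move=> r /itvP r01; apply/is_derive_der; apply: fd.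
    by rewrite !r01.
  - apply: derivable_within_continuous => r /itvP r01.
    by have /fd/is_derive_der[] : 0 <= r <= 1 by rewrite !r01.
  by exists r; [rewrite !r01 | rewrite E subr0 mulr1].
have c1 : c 1 = y by rewrite /c; zmod.
have c0 : c 0 = x by rewrite /c scale0r addr0.
rewrite coefBr -c1 -[in X in _ - X]c0 E; apply: le_trans (coef_bound _ _) _.
by have [_] := Sd _ (Sc _ _ r Sx Sy (introT andP (conj r0 r1))); rewrite c1; exact.
Qed.

(** * Lebesgue measurable functions and absolutely continuous curves *)

Section LebesgueMeasurable.
Context {R : realType}.
Implicit Types (h : R -> R).

Notation cara := (caratheodory_type (@wlength R idfun)^*%mu).
Notation mu := (@lebesgue_measure R).
Notation cmu := (@completed_lebesgue_measure R).

Lemma ae_impl (P Q : R -> Prop) : (forall t, P t -> Q t) ->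
  {ae mu, forall t, P t} -> {ae mu, forall t, Q t}.
Proof. by move=> PQ; apply: filterS; [exact: (ae_filter_ringOfSetsType mu)|exact: PQ]. Qed.

Lemma ae_impl2 (P Q S : R -> Prop) : (forall t, P t -> Q t -> S t) ->
  {ae mu, forall t, P t} -> {ae mu, forall t, Q t} -> {ae mu, forall t, S t}.
Proof. by move=> PQ; apply: filterS2; [exact: (ae_filter_ringOfSetsType mu)|exact: PQ]. Qed.

Lemma ae_closed_interval (P : R -> Prop) a b : {ae mu, forall t, a < t < b -> P t} ->
  {ae mu, forall t, a <= t <= b -> P t}.
Proof.
have nab : {ae mu, forall t, ~ [set a; b] t}.
  exists [set a; b]; split; last by move=> x /= /contrapT.
    by apply: measurableU; exact: measurable_set1.
  by apply: countable_lebesgue_measure0; exact: finite_set_countable.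
apply: ae_impl2 nab => t nt Pt /andP[at_ tb]; apply: Pt.
rewrite !lt_neqAle at_ tb !andbT; apply/andP.
by split; apply/eqP => E; apply: nt; [left|right].
Qed.

Lemma ae_all (I : countType) (P : I -> R -> Prop) :
  (forall i, {ae mu, forall t, P i t}) -> {ae mu, forall t, forall i, P i t}.
Proof.
move=> H; have : {ae mu, forall t, forall n, oapp (P^~ t) True (unpickle n)}.
  apply/ae_foralln => n; case: unpickle => [i|] /=; first exact: H.
  exact: aeW.
by apply: ae_impl => t Pt i; have := Pt (pickle i); rewrite pickleK.
Qed.

Lemma lebesgue_measurable_borel (E : set R) :
  measurable (E : set (measurableTypeR R)) -> measurable (E : set cara).
Proof. exact: sub_caratheodory. Qed.

(** The Lebesgue sigma-algebra is the completion of the Borel one, so a measurable set is a Borel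
    set up to part of a Borel null set. *)
Lemma measurable_caraP (E : set R) : measurable (E : set cara) ->
  exists B N : set R, [/\ measurable (B : set (measurableTypeR R)),
   measurable (N : set (measurableTypeR R)),
   mu N = 0%E, B `<=` E & E `<=` B `|` N].
Proof.
move=> mE.
have : completed_algebra_gen mu E.
  by rewrite -g_sigma_completed_algebra_genE completed_caratheodory_measurable.
move=> [B mB [M [N [mN N0 MN]] <-]]; exists B, N; split => //.
exact: setUS.
Qed.

(** For each rational [q] the preimage of the ray above [q] is Borel up to a null set. Discarding
    the union [N] of these countably many null sets makes the preimage of every ray a countable
    union of Borel sets. This prepares the use of [FTC1], which concerns Borel integrands. *)
Lemma borel_representative h : lebesgue_measurable_fun setT h ->
  exists k (N : set R), [/\ measurable_fun setT (k : measurableTypeR R -> measurableTypeR R),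
    measurable (N : set (measurableTypeR R)), mu N = 0%E,
    (forall x, ~ N x -> k x = h x) & (forall x, N x -> k x = 0)].
Proof.
move=> mh.
have mE (q : rat) : measurable (h @^-1` `]ratr q, +oo[%classic : set cara).
  by rewrite -[X in measurable X]setTI; apply: mh => //; exact: measurable_itv.
pose A q := sval (cid (measurable_caraP (mE q))).
have /all_sig[B HB] q : {B | [/\ measurable (A q : set (measurableTypeR R)),
   measurable (B : set (measurableTypeR R)),
   mu B = 0%E, A q `<=` h @^-1` `]ratr q, +oo[ &
   h @^-1` `]ratr q, +oo[ `<=` A q `|` B]}.
  by apply: cid; rewrite /A; case: cid.
pose N := \bigcup_q B q.
have mN : measurable (N : set (measurableTypeR R)).
  by apply: bigcupT_measurable_rat => q; have [] := HB q.
have N0 : mu N = 0%E.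
  have : mu.-negligible (\bigcup_n (oapp B set0 (unpickle n))).
    apply: negligible_bigcup => n; case: unpickle => [q|] /=; last first.
      exact: negligible_set0.
    by have [_ mB B0 _ _] := HB q; exists (B q); split.
  move=> nN; apply/negligibleP; first exact: mN.
  apply: negligibleS nN => x [q _ Bqx].
  by exists (pickle q); [exact: I | rewrite pickleK].
exists (fun x : R => if `[< N x >] then 0 else h x), N; split => //; last 2 first.
- by move=> x Nx; case: asboolP.
- by move=> x Nx; case: asboolP.
move=> _; apply: (measurability _ (RGenOInfty.measurableE R)) => //.
move=> _ -[_ [r ->] <-]; rewrite setTI.
have -> : (fun x => if `[< N x >] then 0 else h x) @^-1` `]r, +oo[ =
   (\bigcup_q (if (r < ratr q) then A q `\` N else set0)) `|` (if r < 0 then N else set0).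
  apply/seteqP; split=> x /=; rewrite in_itv/= andbT.
    case: asboolP => Nx rx; first by right; rewrite rx.
    left; have [q] := rat_in_itvoo rx; rewrite in_itv/= => /andP[rq qx].
    exists q; first exact: I.
    rewrite rq; split; last exact: Nx.
    have [_ _ _ _ /(_ x)] := HB q; rewrite /= in_itv/= andbT => /(_ qx)[//|Bx].
    by exfalso; apply: Nx; exists q; [exact: I|].
  case=> [[q _]|]; last by case: ifPn => // r0 Nx; case: asboolP.
  case: ifPn => // rq [Ax Nx]; case: asboolP => // _.
  have [_ _ _ /(_ _ Ax) + _] := HB q; rewrite /= in_itv/= andbT.
  exact: lt_trans.
apply: measurableU; last by case: ifP.
apply: bigcupT_measurable_rat => q; case: ifP => _; last exact: measurable0.
by apply: measurableD => //; have [] := HB q.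
Qed.

(** Change of variables along the identity, which is measurable from the Lebesgue to the Borel
    sigma-algebra and pushes [cmu] forward to [mu]. *)
Lemma lebesgue_integral_cmu (k : R -> R) (D : set R) :
  measurable (D : set (measurableTypeR R)) ->
  measurable_fun setT (k : measurableTypeR R -> measurableTypeR R) ->
  cmu.-integrable D (EFin \o k) ->
  \int[cmu]_(x in D) k x = \int[mu]_(x in D) k x.
Proof.
move=> mD mk ik; congr fine.
have mid : measurable_fun [set: cara] (idfun : cara -> measurableTypeR R).
  by move=> _ E mE; rewrite setTI preimage_id; exact: sub_caratheodory.
have := @integral_pushforward _ _ cara (measurableTypeR R) R idfun mid cmu D (EFin \o k).
rewrite preimage_id => <- //; last exact/measurable_EFinP.
Qed.

Lemma cmu_itv (i : interval R) : cmu [set` i] = mu [set` i].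
Proof. by []. Qed.

Lemma bounded_cmu_integrable (D : set R) h K : measurable (D : set cara) ->
  (cmu D < +oo)%E -> lebesgue_measurable_fun D h ->
  (forall t, D t -> `|h t| <= K) -> cmu.-integrable D (EFin \o h).
Proof.
move=> mD Doo mh hK; apply: (@measurable_bounded_integrable _ cara R cmu h D mD) => //.
exists K; split; first exact: num_real.
by move=> M /ltW KM x /hK /le_trans; apply.
Qed.

Lemma measurable_itv_cara (i : interval R) : measurable ([set` i] : set cara).
Proof. by apply: lebesgue_measurable_borel; exact: measurable_itv. Qed.

Lemma cmu_bnd (x y : bool) (a b : R) : a <= b ->
  cmu [set` Interval (BSide x a) (BSide y b)] = (b - a)%:E.
Proof.
move=> ab; rewrite cmu_itv lebesgue_measure_itv /= lte_fin.
by move: ab; rewrite le_eqVlt => /predU1P[->|ab]; [rewrite ltxx subrr|rewrite ab EFinB].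
Qed.

Definition primitive h (a t : R) := \int[cmu]_(s in `[a, t]) h s.

Section primitive.
Variables (a b : R) (h : R -> R) (K : R).
Hypotheses (mh : lebesgue_measurable_fun `[a, b] h)
  (hK : forall t, a <= t <= b -> `|h t| <= K).

Lemma integrable_sub (i : interval R) : [set` i] `<=` `[a, b] -> a <= b ->
  cmu.-integrable [set` i] (EFin \o h).
Proof.
move=> iab ab; apply: (@integrableS _ _ _ cmu `[a, b]) => //; try exact: measurable_itv_cara.
apply: (@bounded_cmu_integrable _ h K) => //; first exact: measurable_itv_cara.
by rewrite cmu_bnd// ltry.
Qed.

Lemma primitive_sub s t : a <= s -> s <= t -> t <= b ->
  primitive h a t - primitive h a s = \int[cmu]_(x in `]s, t]) h x.
Proof.
move=> as_ st tb; rewrite /primitive (@itv_bndbnd_setU _ _ _ (BRight s)); last 2 first.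
- by rewrite bnd_simp.
- by rewrite bnd_simp.
rewrite Rintegral_setU; try exact: measurable_itv_cara.
- by rewrite addrAC subrr add0r.
- rewrite -itv_bndbnd_setU ?bnd_simp//; apply: integrable_sub; last first.
    by rewrite (le_trans as_)// (le_trans st).
  by apply: subset_itvl; rewrite bnd_simp.
- by apply/disj_setPS => x [] /=; rewrite !in_itv /= => /andP[_ xs] /andP[/lt_geF]; rewrite xs.
Qed.

Lemma primitive_lipschitz s t : a <= s -> s <= t -> t <= b ->
  `|primitive h a t - primitive h a s| <= K * (t - s).
Proof.
move=> as_ st tb; rewrite primitive_sub//.
have ih : cmu.-integrable `]s, t] (EFin \o h).
  apply: integrable_sub; last by rewrite (le_trans as_)// (le_trans st).
  by move=> x /=; rewrite !in_itv /= => /andP[/ltW sx xt]; rewrite (le_trans as_)//= (le_trans xt).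
apply: le_trans (le_normr_Rintegral _ ih) _; first exact: measurable_itv_cara.
have -> : K * (t - s) = \int[cmu]_(x in `]s, t]) K.
  rewrite Rintegral_cst; last exact: measurable_itv_cara.
  by congr (_ * _); exact/esym/(congr1 fine (@cmu_bnd false false s t st)).
apply: le_Rintegral; first exact: measurable_itv_cara.
- exact: integrable_norm.
- apply: (@bounded_cmu_integrable _ (cst K) `|K|); first exact: measurable_itv_cara.
  + by rewrite cmu_bnd// ltry.
  + exact: measurable_cst.
  + by [].
- move=> x /=; rewrite in_itv /= => /andP[sx xt]; apply: hK.
  by rewrite (le_trans as_ (ltW sx)) (le_trans xt).
Qed.

Lemma primitive_der : {ae mu, forall t, a < t < b -> der (primitive h a : R -> R^o) t (h t)}.
Proof.
have [ba|ab] := leP b a.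
  by apply: aeW => t /andP[at_ tb]; exfalso; lra.
pose D := `[a, b]%classic : set R.
have mD : measurable (D : set cara) by exact: measurable_itv_cara.
have [k [N [mk mN N0 kh k0]]] : exists k (N : set R), [/\ measurable_fun setT (k : measurableTypeR R -> measurableTypeR R),
    measurable (N : set (measurableTypeR R)), mu N = 0%E,
    (forall x, ~ N x -> k x = (h \_ D) x) & (forall x, N x -> k x = 0)].
  by apply: borel_representative; exact/(measurable_restrictT _ mD).1.
have kK t : `|k t| <= `|K|.
  have [Nt|Nt] := pselect (N t); first by rewrite k0// normr0.
  rewrite kh// patchE; case: ifPn => [|_]; last by rewrite normr0.
  by rewrite inE /D /= in_itv /= => /hK /le_trans; apply; exact: ler_norm.
have ik (f : R -> R) (i : interval R) : (forall t, `|f t| <= `|K|) ->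
    measurable_fun setT (f : measurableTypeR R -> measurableTypeR R) ->
    (cmu [set` i] < +oo)%E -> mu.-integrable [set` i] (EFin \o f).
  move=> fK mf ioo; apply: measurable_bounded_integrable => //.
  - exact: measurable_funTS.
  - exists `|K|; split; first exact: num_real.
    by move=> M /ltW KM x _; exact: le_trans KM.
have mkD : measurable_fun setT (k \_ D : measurableTypeR R -> measurableTypeR R).
  by apply/(measurable_restrictT _ _).1; [exact: measurable_itv | exact: measurable_funTS].
have kD t : `|(k \_ D) t| <= `|K|.
  by rewrite patchE; case: ifP => _ //; rewrite normr0.
have ioo y : (cmu `[a, y] < +oo)%E.
  have [ay|ya] := leP a y; first by rewrite cmu_bnd// ltry.
  rewrite set_itv_ge ?bnd_simp -?ltNge//.
  by rewrite (_ : cmu set0 = 0%E) ?ltry//; exact: measure0.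
have locf : locally_integrable [set: R] (k \_ D).
  by apply: integrable_locally; [exact: measurable_itv | exact: ik].
(* The primitive of [h] is also that of its Borel representative cut off outside [[a, b]]; the
   values of the two integrands agree off [N], so the derivative found for one serves the other. *)
have prE s : a <= s <= b -> primitive h a s = \int[mu]_(x in `[a, s]) (k \_ D) x.
  move=> /andP[as_ sb].
  have sub : `[a, s] `<=` (D : set R).
    by move=> x /=; rewrite /D /= !in_itv /= => /andP[-> /le_trans]; exact.
  have mhs : lebesgue_measurable_fun `[a, s] h by exact: (measurable_funS mD sub mh).
  have mks : lebesgue_measurable_fun setT k.
    move=> _ E mE; rewrite setTI; apply: lebesgue_measurable_borel.
    by rewrite -[X in measurable X]setTI; exact: mk.
  rewrite /primitive.
  have -> : \int[cmu]_(x in `[a, s]) h x = \int[cmu]_(x in `[a, s]) k x.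
    congr fine; apply: ae_eq_integral.
    - exact: measurable_itv_cara.
    - by apply/measurable_EFinP; exact: mhs.
    - by apply/measurable_EFinP; exact: measurable_funTS.
    - exists N; split => //; first exact: lebesgue_measurable_borel.
      move=> x /= xN; apply: contrapT => Nx; apply: xN => xas.
      by rewrite kh// patchE mem_set//; exact: sub.
  rewrite lebesgue_integral_cmu//; first last.
  - apply: (@bounded_cmu_integrable _ k `|K|) => //; first exact: measurable_itv_cara.
    exact: measurable_funTS.
  by apply: eq_Rintegral => x; rewrite inE => /sub xD; rewrite patchE mem_set.
have := @FTC1 R (k \_ D) (BLeft a) (fun y => ik _ _ kD mkD (ioo y)) locf.
have nN : {ae mu, forall t, ~ N t}.
  by exists N; split => // x /= /contrapT.
apply: ae_impl2 nN => t Nt /= H tab; have /andP[at_ tb] := tab.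
have [|dF FE] := H; first by rewrite lte_fin.
have kt : (k \_ D) t = h t.
  have tD : t \in D by rewrite inE /D /= in_itv /= !ltW.
  by rewrite patchE tD kh// patchE tD.
have /is_derive_der : is_derive (t : R^o) 1 ((fun y => \int[mu]_(x in `[a, y]) (k \_ D) x) : R^o -> R^o) (h t).
  by split; [exact: dF | rewrite -kt -FE derive1E].
by apply: der_eq_interior tab _ => s sab; rewrite prE.
Qed.

End primitive.

Lemma dominated_primitive (a b : R) (h : nat -> R -> R) (K : R) : a <= b ->
  (forall n, lebesgue_measurable_fun `[a, b] (h n)) ->
  (forall n t, a <= t <= b -> `|h n t| <= K) ->
  (forall t, a <= t <= b -> h ^~ t @ \oo --> (0 : R)) ->
  (fun n => \int[cmu]_(t in `[a, b]) `|h n t|) @ \oo --> (0 : R).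
Proof.
move=> ab mh hK h0.
have mD : measurable (`[a, b]%classic : set cara) by exact: measurable_itv_cara.
have [] := @dominated_convergence _ cara R cmu `[a, b] mD (fun n => EFin \o h n) (cst 0%E) (EFin \o cst K).
- by move=> n; apply/measurable_EFinP; exact: mh.
- exact: measurable_cst.
- apply: aeW => t /=; rewrite in_itv => /h0.
  by move=> H; apply: cvg_EFin => //; apply: nearW.
- apply: (@bounded_cmu_integrable _ (cst K) `|K|) => //.
  + by rewrite cmu_bnd// ltry.
  + exact: measurable_cst.
- by apply: aeW => t n /=; rewrite in_itv /= lee_fin => /hK.
move=> _ H _; apply: fine_cvg; apply: cvg_trans H.
apply: near_eq_cvg; apply: nearW => n /=; apply: eq_integral => t _ /=.
by rewrite subr0.
Qed.

End LebesgueMeasurable.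

(** * Almost everywhere derivative bounds, superposition, regular times *)

Section LebesgueFacts.
Context {R : realType}.

Notation cara := (caratheodory_type (@wlength R idfun)^*%mu).
Notation mu := (@lebesgue_measure R).
Notation cmu := (@completed_lebesgue_measure R).

(** Closed intervals listed from left to right between [x] and [y], gaps allowed. As a recursive
    predicate it is stable under concatenation, as [cousin] requires. *)
Fixpoint ordered_chain (x : R) (s : seq (R * R)) (y : R) : Prop :=
  if s is p :: s' then [/\ x <= p.1, p.1 <= p.2 & ordered_chain p.2 s' y] else x <= y.

Lemma ordered_chain_le x s y : ordered_chain x s y -> x <= y.
Proof.
elim: s x => //= p s IH x [xp pp /IH]; exact/le_trans/(le_trans xp).
Qed.

Lemma ordered_chain_cat x s y s' z : ordered_chain x s y -> ordered_chain y s' z ->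
  ordered_chain x (s ++ s') z.
Proof.
elim: s x => /= [|p s IH] x.
  by case: s' => /= [xy|p s' xy [yp ? ?]]; [exact: le_trans | split => //; exact: le_trans yp].
by move=> [xp pp ps] yz; split => //; exact: IH.
Qed.

Lemma ordered_chain_nth x s y i : ordered_chain x s y -> (i < size s)%N ->
  [/\ x <= (nth (0, 0) s i).1, (nth (0, 0) s i).1 <= (nth (0, 0) s i).2 & (nth (0, 0) s i).2 <= y].
Proof.
elim: s x i => //= p s IH x [|i] /= [xp pp ps].
  by split => //; exact: ordered_chain_le ps.
rewrite ltnS => /(IH _ _ ps)[h1 h2 h3]; split => //.
by rewrite (le_trans xp)// (le_trans pp).
Qed.

Lemma ordered_chain_nth2 x s y i j : ordered_chain x s y -> (i < j)%N -> (j < size s)%N ->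
  (nth (0, 0) s i).2 <= (nth (0, 0) s j).1.
Proof.
elim: s x i j => //= p s IH x [|i] [|j] //= [xp pp ps]; rewrite !ltnS.
  by move=> _ /(ordered_chain_nth ps)[].
exact: IH ps.
Qed.

Lemma ordered_chain_measure (U : set R) x s y :
  measurable (U : set (measurableTypeR R)) -> ordered_chain x s y ->
  (forall p, p \in s -> `[p.1, p.2] `<=` U) ->
  ((\sum_(p <- s) (p.2 - p.1))%:E <= mu (U `&` `[x, y[))%E.
Proof.
move=> mU; elim: s x => [|p s IH] x /=; first by rewrite big_nil measure_ge0.
move=> [xp pp ps] sU; rewrite big_cons EFinD.
have mI z : measurable ((U `&` `[z, y[) : set (measurableTypeR R)).
  by apply: measurableI => //; exact: measurable_itv.
(* Half-open intervals make consecutive members of the chain disjoint, so the measures add. *)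
apply: (@le_trans _ _ (mu (`[p.1, p.2[ `|` (U `&` `[p.2, y[)))).
  rewrite measureU; first last.
  - apply/seteqP; split => // z [] /=; rewrite !in_itv /= => /andP[_ zp] [_ /andP[pz _]].
    by move: zp; rewrite ltNge pz.
  - exact: mI.
  - exact: measurable_itv.
  apply: leeD; last by apply: IH => // q qs; apply: sU; rewrite inE qs orbT.
  apply: (@le_trans _ _ (mu `[p.1, p.2[)) => //.
  rewrite lebesgue_measure_itv /= lte_fin.
  by have [_|h] := ltP p.1 p.2; rewrite ?EFinB// lee_fin subr_le0.
apply: le_measure; rewrite ?inE; first by apply: measurableU => //; exact: measurable_itv.
  exact: mI.
have py := ordered_chain_le ps.
move=> z [|[Uz]] /=; rewrite !in_itv /= => /andP[z1 z2].
  split; first by apply: (sU p); rewrite ?inE ?eqxx//= in_itv /= z1 ltW.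
  by rewrite (le_trans xp)//= (lt_le_trans z2).
by split => //; rewrite z2 (le_trans xp)// (le_trans pp).
Qed.

(** The exceptional times are covered by an open [U] of measure below [delta]. A short interval
    tagged at a good time obeys the slope bound; one tagged at an exceptional time lies in [U] and
    is put in the list [s]. The total length of [s] is then below [delta], and absolute continuity
    bounds its total variation. *)
Lemma ae_derivative_bound (V : normedModType R) (H : R -> V) (a b K : R) :
  a <= b -> 0 <= K -> abs_continuous_on [set s | a <= s <= b] H ->
  {ae mu, forall t, a < t < b -> exists2 v, der H t v & `|v| <= K} ->
  `|H b - H a| <= K * (b - a).
Proof.
move=> ab K0 Hac Hae; apply/ler_addgt0Pr => e e0.
(* Half of [e] pays for the excess slope [e'] over the whole interval, half for the exceptional
   intervals; the [+ 1] covers the case [a = b]. *)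
pose e' := e / 2 / (b - a + 1).
have ba1 : 0 < b - a + 1 by rewrite ltr_wpDl// subr_ge0.
have e'0 : 0 < e' by rewrite !divr_gt0.
have [delta delta0 Hd] := Hac _ (divr_gt0 e0 (ltr0n _ 2)).
(* The endpoints join the exceptional set, because the derivative is controlled only in the
   interior. *)
pose N := [set t | ~ (a < t < b -> exists2 v, der H t v & `|v| <= K)] `|` [set a; b].
have Nnull : mu.-negligible N.
  apply: negligibleU; first exact: Hae.
  exists [set a; b]; split => //.
    by apply: measurableU; exact: measurable_set1.
  by apply: countable_lebesgue_measure0; exact: finite_set_countable.
have [U [oU NU Ud]] := outer_measure_open_le N (divr_gt0 delta0 (ltr0n _ 2)).
have {}Ud : (mu U < delta%:E)%E.
  apply: le_lt_trans Ud _; rewrite (negligible_outer_measure N).1// add0e lte_fin.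
  by rewrite ltr_pdivrMr// mulr_natr mulr2n ltrDl.
have mU : measurable (U : set (measurableTypeR R)) by exact: open_measurable.
pose P x y := exists s : seq (R * R), [/\ ordered_chain x s y,
  (forall p, p \in s -> `[p.1, p.2] `<=` U) &
  `|H y - H x| <= (K + e') * (y - x) + \sum_(p <- s) `|H p.2 - H p.1|].
have [s [sc sU Hs]] : P a b.
  apply: cousin => //.
  - move=> x y z _ _ _ _ [s [sc sU sH]] [s' [s'c s'U s'H]]; exists (s ++ s'); split.
    + exact: ordered_chain_cat s'c.
    + by move=> p; rewrite mem_cat => /orP[/sU|/s'U].
    + rewrite big_cat /= -[H z - H x](_ : (H y - H x) + (H z - H y) = _); last by zmod.
      apply: le_trans (ler_normD _ _) _; apply: le_trans (lerD sH s'H) _.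
      by rewrite le_eqVlt; apply/orP; left; apply/eqP; lra.
  - move=> t /andP[at_ tb]; have [/NU Ut|] := pselect (N t).
      have /nbhs_normE[d d0 dU] : nbhs t U by exact: open_nbhs_nbhs.
      exists d => // x y ax xt ty yb xyd; exists [:: (x, y)]; split.
      + by split => //=; exact: le_trans ty.
      + move=> p; rewrite inE => /eqP -> z /=; rewrite in_itv /= => /andP[xz zy].
        by apply: dU; rewrite ltr_norml; apply/andP; split; lra.
      + rewrite big_cons big_nil addr0 lerDr; apply: mulr_ge0; first by rewrite addr_ge0// ltW.
        by rewrite subr_ge0; exact: le_trans ty.
    move=> /not_orP[/contrapT tv /not_orP[ta tb']].
    have [|v Hv vK] := tv.
      rewrite !lt_neqAle at_ tb !andbT; apply/andP; split; apply/eqP => E.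
        by apply: ta.
      by apply: tb'.
    have [d d0 D] := Hv _ e'0; exists d => // x y ax xt ty yb xyd.
    exists [::]; split => //=; first exact: le_trans ty.
    rewrite big_nil addr0.
    have st s : x <= s <= y -> `|H s - H t| <= (K + e') * `|s - t|.
      move=> /andP[xs sy].
      rewrite -[H s - H t](subrK ((s - t) *: v)); apply: le_trans (ler_normD _ _) _.
      rewrite normrZ mulrDl addrC; apply: lerD; first by rewrite mulrC ler_wpM2r.
      by apply: D; rewrite ltr_norml; apply/andP; split; lra.
    have -> : H y - H x = (H y - H t) - (H x - H t) by zmod.
    apply: le_trans (ler_normB _ _) _.
    apply: (@le_trans _ _ ((K + e') * `|y - t| + (K + e') * `|x - t|)).
      by apply: lerD; apply: st; rewrite lexx ?andbT// (le_trans xt).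
    rewrite ger0_norm ?subr_ge0// ler0_norm ?subr_le0//.
    by rewrite le_eqVlt; apply/orP; left; apply/eqP; lra.
apply: le_trans Hs _.
have sm := ordered_chain_measure mU sc sU.
have H2 : \sum_(p <- s) `|H p.2 - H p.1| < e / 2.
  rewrite (big_nth (0, 0)) big_mkord.
  apply: (Hd _ (fun i => (nth (0, 0) s i).1) (fun i => (nth (0, 0) s i).2)).
  - move=> i; have [h1 h2 h3] := ordered_chain_nth sc (ltn_ord i).
    by split => //=; [rewrite h1 (le_trans h2)|rewrite h3 andbT (le_trans h1)].
  - move=> i j ij; have [lij|lji|E] := ltngtP i j.
    + by left; exact: (ordered_chain_nth2 sc).
    + by right; exact: (ordered_chain_nth2 sc).
    + by move: ij; rewrite -val_eqE /= E eqxx.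
  - rewrite -(big_mkord xpredT (fun i => (nth (0, 0) s i).2 - (nth (0, 0) s i).1)).
    rewrite -(big_nth (0, 0) xpredT (fun p => p.2 - p.1)) -lte_fin.
    apply: le_lt_trans sm _; apply: le_lt_trans Ud.
    apply: le_measure; rewrite ?inE; [|exact: mU|exact: subIsetl].
    by apply: measurableI => //; exact: measurable_itv.
have H1 : e' * (b - a) <= e / 2.
  rewrite /e' mulrAC ler_pdivrMr// ler_wpM2l//; first by rewrite divr_ge0// ltW.
  by rewrite lerDl.
rewrite mulrDl -addrA lerD2l [e]splitr; apply: lerD; first exact: H1.
exact: ltW.
Qed.

(** Replace [y] by samples on a grid: on each cell the function is [X] at a fixed point, hence
    measurable. Refining the grid converges pointwise, by continuity of [X t] on [S] and the
    Lipschitz bound on [y]. *)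
Lemma measurable_superposition (V : normedModType R) (X : R -> V -> R) (S : set V)
    (y : R -> V) (a b C : R) :
  (forall x, S x -> lebesgue_measurable_fun `[a, b] (X ^~ x)) ->
  (forall t x, a <= t <= b -> S x -> forall e : R, 0 < e -> exists2 d : R, 0 < d &
    forall z, S z -> `|z - x| < d -> `|X t z - X t x| <= e) ->
  (forall s t, a <= s <= b -> a <= t <= b -> `|y t - y s| <= C * `|t - s|) ->
  (forall t, a <= t <= b -> S (y t)) ->
  lebesgue_measurable_fun `[a, b] (fun t => X t (y t)).
Proof.
move=> mX cX yC yS.
(* [g k t] is the last point of the grid of step [1 / k.+1] from [a] that is not after [t]. *)
pose g (k : nat) (t : R) := a + (Num.truncn ((t - a) * k.+1%:R))%:R / k.+1%:R.
have k0 (k : nat) : 0 < (k.+1%:R : R) by rewrite ltr0n.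
have gle k t : a <= t -> g k t <= t.
  move=> at_; rewrite /g -lerBrDl ler_pdivrMr// truncn_le// mulr_ge0 ?subr_ge0//.
have gge k t : a <= g k t by rewrite /g lerDl divr_ge0.
have glt k t : a <= t -> t - g k t <= k.+1%:R^-1.
  move=> at_; have := truncnS_gt ((t - a) * k.+1%:R).
  move=> H; rewrite /g opprD addrA lerBlDr -{1}[_^-1]mul1r -mulrDl ler_pdivlMr// nat1r.
  exact: ltW.
apply: (@measurable_fun_cvg _ cara R `[a, b] (fun k t => X t (y (g k t)))).
- move=> k.
  pose E m := `[a, b]%classic `&` [set` `[a + m%:R / k.+1%:R, a + m.+1%:R / k.+1%:R[ ].
  have EU : `[a, b]%classic = \bigcup_m E m.
    apply/seteqP; split=> [t tab|t [m _ []//]]; exists (Num.truncn ((t - a) * k.+1%:R)) => //.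
    split => //; move: tab; rewrite /= !in_itv /= => /andP[at_ tb].
    rewrite -lerBrDl -ltrBlDl ler_pdivrMr// ltr_pdivlMr// truncn_le ?mulr_ge0 ?subr_ge0//=.
    exact: truncnS_gt.
  rewrite EU; apply/measurable_fun_bigcup => m.
    by apply: measurableI; exact: measurable_itv_cara.
  (* A nonempty cell has its left end in [[a, b]], where [y] is known to take values in [S]. *)
  have [->|/set0P[t0 [t0ab t0m]]] := eqVneq (E m) set0; first exact: measurable_fun_set0.
  apply: (@eq_measurable_fun _ _ _ _ _ (fun t : cara => X t (y (a + m%:R / k.+1%:R)) : measurableTypeR R)).
    move=> t; rewrite inE => -[] /=; rewrite !in_itv /= => /andP[at_ tb] /andP[tm tm1].
    congr (X _ (y (a + _%:R / _))); apply/esym/eqP; rewrite truncn_eq ?mulr_ge0 ?subr_ge0//.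
    by rewrite -ler_pdivrMr// -ltr_pdivlMr// lerBrDl ltrBlDl tm tm1.
  have sub : E m `<=` `[a, b] by exact: subIsetl.
  apply: (measurable_funS (measurable_itv_cara _) sub).
  apply: mX; apply: yS; move: t0ab t0m; rewrite /= !in_itv /= => /andP[at_ tb] /andP[tm _].
  by rewrite lerDl divr_ge0//= (le_trans tm).
- move=> t /=; rewrite in_itv /= => tab; have /andP[at_ tb] := tab.
  apply/cvgrPdist_le => e e0.
  have [d d0 D] := cX _ _ tab (yS _ tab) _ e0.
  have C1 : 0 < `|C| + 1 by rewrite ltr_wpDl.
  have dC : 0 < d / (`|C| + 1) by rewrite divr_gt0.
  near=> k.
  have gab : a <= g k t <= b by rewrite gge (le_trans (gle _ _ at_)).
  rewrite distrC; apply: D; first exact: yS.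
  apply: le_lt_trans (yC _ _ tab gab) _.
  apply: (@le_lt_trans _ _ ((`|C| + 1) * k.+1%:R^-1)).
    apply: (@le_trans _ _ ((`|C| + 1) * `|g k t - t|)).
      by rewrite ler_wpM2r// (le_trans (ler_norm C))// lerDl.
    rewrite ler_wpM2l ?(ltW C1)// distrC ger0_norm ?subr_ge0 ?gle//.
    exact: glt.
  rewrite mulrC -ltr_pdivlMr//.
  near: k; exact: (near_infty_natSinv_lt (PosNum dC)).
Unshelve. all: by end_near.
Qed.

(** Density is expressed by the measure missing from a small ball, rather than by a quotient, so
    that the losses from finitely many sets can be added. *)
Lemma density_points (E : set R) : measurable (E : set cara) ->
  exists2 B : set R, measurable (B : set (measurableTypeR R)) /\ B `<=` E &
  {ae mu, forall t, E t -> forall e : R, 0 < e -> exists2 d : R, 0 < d &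
    forall r : R, 0 < r -> r < d -> (mu (ball t r `\` B) <= (e * r)%:E)%E}.
Proof.
move=> mE; have [B [N [mB mN N0 BE EBN]]] := measurable_caraP mE.
exists B => //.
have nN : {ae mu, forall t, ~ N t} by exists N; split => // x /= /contrapT.
apply: ae_impl2 nN (lebesgue_density mB) => t Nt H Et e e0.
have Bt : B t by have [] := EBN _ Et.
rewrite indicE mem_set// in H.
(* A ball of radius [r] has measure [2 * r], so a relative loss of [e / 2] is an absolute loss of
   [e * r]. *)
have /fine_cvgP[[d1 /= d10 Hfin] /cvgrPdist_le/(_ (e / 2))] := H.
rewrite divr_gt0// => /(_ isT)[d2 /= d20 H2].
exists (Num.min d1 d2); first by rewrite lt_min d10.
move=> r r0; rewrite lt_min => /andP[rd1 rd2].
have mb : measurable (ball t r : set (measurableTypeR R)) by exact: measurable_ball.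
have mub : mu (ball t r) = (2 * r)%:E by rewrite lebesgue_measure_ball ?(ltW r0)// mulr_natl.
have fB : mu (B `&` ball t r) \is a fin_num.
  rewrite ge0_fin_numE ?measure_ge0//; apply: (@le_lt_trans _ _ (mu (ball t r))).
    by apply: le_measure; rewrite ?inE; [exact: measurableI|exact: mb|exact: subIsetr].
  by rewrite mub ltry.
have := H2 r; rewrite /= sub0r normrN gtr0_norm// => /(_ rd2 r0).
rewrite mub inver gt_eqF ?mulr_gt0// -[X in fine (X * _)](fineK fB) -EFinM /= => H3.
have fD : mu (ball t r `\` B) \is a fin_num.
  rewrite ge0_fin_numE ?measure_ge0//; apply: (@le_lt_trans _ _ (mu (ball t r))).
    by apply: le_measure; rewrite ?inE; [exact: measurableD|exact: mb|exact: subDsetl].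
  by rewrite mub ltry.
have : mu (ball t r) = (mu (ball t r `\` B) + mu (ball t r `&` B))%E by exact: measureDI.
rewrite mub setIC -(fineK fB) -(fineK fD) -EFinD lee_fin => -[E2].
have {H3} := le_trans (ler_norm _) H3.
have r2 : 0 < 2 * r by rewrite mulr_gt0.
rewrite lerBlDl -lerBlDr ler_pdivlMr// mulrBl mul1r {1}E2.
by rewrite [e / 2 * _]mulrA divfK// => H3; lra.
Qed.

Lemma uniform_radius (I : finType) (P : I -> R -> Prop) :
  (forall i, exists2 d : R, 0 < d & forall r, 0 < r -> r < d -> P i r) ->
  exists2 d : R, 0 < d & forall r, 0 < r -> r < d -> forall i, P i r.
Proof.
move=> H; have [d d0 D] : exists2 d : R, 0 < d & forall r, 0 < r -> r < d ->
    forall i, i \in enum I -> P i r.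
  elim: (enum I) => [|i s [d d0 D]]; first by exists 1.
  have [d' d'0 D'] := H i; exists (Num.min d d'); first by rewrite lt_min d0.
  move=> r r0; rewrite lt_min => /andP[rd rd'] j; rewrite inE => /orP[/eqP ->|].
    exact: D'.
  exact: D.
by exists d => // r r0 rd i; apply: D => //; rewrite mem_enum.
Qed.

(** [completed_lebesgue_measure] is an outer measure, hence monotone on all sets. The preimages
    occurring in [regular_point] need this, as [u] is assumed measurable only on [[0, T]]. *)
Lemma cmu_mono (A B : set R) : A `<=` B -> (cmu A <= cmu B)%E.
Proof.
move=> AB.
exact: (@le_outer_measure _ _ (@wlength R idfun)^*%mu A B AB).
Qed.

Lemma cmu_ge0 (A : set R) : (0 <= cmu A)%E.
Proof. 
exact: outer_measure_ge0.
Qed.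

(** Every neighbourhood of [u t] contains a box with rational sides around [u t]. There are
    countably many conditions of the form [p < u_i < q], and almost every time satisfying one of
    them is a density point of it; outside one null set this holds for all of them. *)
Lemma regular_point_ae (d : nat) (T : R) (u : R -> 'rV[R]_d) : admissible_control T u ->
  {ae mu, forall t, 0 < t < T -> regular_point T u t}.
Proof.
move=> [mu_ _].
pose E (k : 'I_d * (rat * rat)) := `[0, T]%classic `&`
  (fun s => u s ord0 k.1) @^-1` `]ratr k.2.1, ratr k.2.2[%classic.
have mE k : measurable (E k : set cara).
  apply: mu_; first exact: measurable_itv_cara.
  exact: measurable_itv.
have /all_sig[B HB] k : {B : set R | (measurable (B : set (measurableTypeR R)) /\ B `<=` E k) /\
  {ae mu, forall t, E k t -> forall e : R, 0 < e -> exists2 d : R, 0 < d &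
    forall r : R, 0 < r -> r < d -> (mu (ball t r `\` B) <= (e * r)%:E)%E}}.
  by apply: cid; have [B ? ?] := density_points (mE k); exists B.
have /ae_all : forall k, {ae mu, forall t, E k t -> forall e : R, 0 < e -> exists2 d : R, 0 < d &
    forall r : R, 0 < r -> r < d -> (mu (ball t r `\` B k) <= (e * r)%:E)%E}.
  by move=> k; have [] := HB k.
apply: ae_impl => t Ht t0T; split=> // O oO Out e e0.
have [t0 tT] := andP t0T.
have /nbhs_ballP[eps eps0 epsO] : nbhs (u t) O by exact: open_nbhs_nbhs.
have /all_sig[pq Hpq] i : {pq : rat * rat |
    [/\ u t ord0 i - eps < ratr pq.1, ratr pq.1 < u t ord0 i,
       u t ord0 i < ratr pq.2 & ratr pq.2 < u t ord0 i + eps]}.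
  apply: cid.
  have [|p] := @rat_in_itvoo R (u t ord0 i - eps) (u t ord0 i); first by rewrite ltrBlDr ltrDl.
  have [|q] := @rat_in_itvoo R (u t ord0 i) (u t ord0 i + eps); first by rewrite ltrDl.
  by rewrite !in_itv /= => /andP[q1 q2] /andP[p1 p2]; exists (p, q).
(* Each of the [d] coordinates loses at most [e' * r], for a total strictly below [e * r], also when
   [d = 0]. *)
pose e' := e / d.+1%:R.
have e'0 : 0 < e' by rewrite divr_gt0.
have [delta delta0 Hdelta] : exists2 delta : R, 0 < delta & forall r, 0 < r -> r < delta ->
    forall i, (mu (ball t r `\` B (i, pq i)) <= (e' * r)%:E)%E.
  apply: uniform_radius => i; apply: Ht => //.
  have [p1 p2 q1 q2] := Hpq i.
  by split; rewrite /= in_itv /=; [rewrite !ltW|rewrite p2 q1].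
exists delta => // a b /andP[at_ tb] bad.
pose r := b - a.
have r0 : 0 < r by rewrite subr_gt0 (lt_trans at_).
(* The coordinates are imposed one after the other, so that each costs one more loss of measure. An
   interval of length [r] around [t] lies in the ball of radius [r] about [t]. *)
pose G (s : seq 'I_d) := [set x | a < x < b /\ forall i, i \in s -> B (i, pq i) x].
have mG s : measurable (G s : set (measurableTypeR R)).
  elim: s => [|i s IH].
    rewrite (_ : G [::] = `]a, b[%classic); first exact: measurable_itv.
    by apply/seteqP; split => x; rewrite /G /= in_itv /=; [case|split].
  rewrite (_ : G (i :: s) = G s `&` B (i, pq i)); last first.
    apply/seteqP; split => x.
      by move=> [xab H]; split; [split => // j js|]; apply: H; rewrite inE ?js ?orbT ?eqxx.
    move=> [[xab H] Bx]; split => // j; rewrite inE => /orP[/eqP ->//|]; exact: H.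
  by apply: measurableI => //; have [[]] := HB (i, pq i).
have muG s : ((r - (size s)%:R * (e' * r))%:E <= mu (G s))%E.
  elim: s => [|i s IH].
    rewrite mul0r subr0 (_ : G [::] = `]a, b[%classic).
      by rewrite lebesgue_measure_itv /= lte_fin (lt_trans at_ tb) EFinB.
    by apply/seteqP; split => x; rewrite /G /= in_itv /=; [case|split].
  have -> : r - (size (i :: s))%:R * (e' * r) = r - (size s)%:R * (e' * r) - e' * r.
    by rewrite /= -natr1; lra.
  have mBi : measurable (B (i, pq i) : set (measurableTypeR R)) by have [[]] := HB (i, pq i).
  rewrite EFinB leeBlDr//; apply: le_trans IH _.
  have -> : mu (G s) = (mu (G s `\` B (i, pq i)) + mu (G s `&` B (i, pq i)))%E.
    exact: measureDI.
  rewrite addeC; apply: leeD.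
    apply: le_measure; rewrite ?inE; [exact: measurableI|exact: mG|].
    move=> x [[xab H] Bx]; split => // j; rewrite inE => /orP[/eqP ->//|]; exact: H.
  apply: le_trans (Hdelta r r0 bad i); apply: le_measure; rewrite ?inE.
  - exact: measurableD.
  - by apply: measurableD => //; exact: measurable_ball.
  - move=> x [[/andP[ax xb] _] nB]; split => //.
    by rewrite /ball /= ltr_norml /r; apply/andP; split; lra.
have Vr : completed_lebesgue_measure (`]a, b[%classic : set R) = r%:E.
  by apply: (@cmu_bnd R false true); rewrite ltW// (lt_trans at_).
rewrite Vr /=.
set A := u @^-1` O `&` `]a, b[%classic.
have GA : G (enum 'I_d) `<=` A.
  move=> x [xab H]; split; last by rewrite /= in_itv.
  apply: epsO; split => // i j; rewrite [i]ord1 /ball /=.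
  have [[_ /(_ x) BE] _] := HB (j, pq j).
  have [|_] := BE; first by apply: H; rewrite mem_enum.
  rewrite /= in_itv /= => /andP[h1 h2]; have [p1 p2 q1 q2] := Hpq j.
  by rewrite ltr_norml; apply/andP; split; lra.
have A1 : ((r - d%:R * (e' * r))%:E <= cmu A)%E.
  have := muG (enum 'I_d); rewrite size_enum_ord => /le_trans; apply.
  by apply: (@cmu_mono (G (enum 'I_d))); exact: GA.
have A2 : (cmu A <= r%:E)%E.
  by rewrite -Vr; apply: cmu_mono; exact: subIsetr.
have Afin : cmu A \is a fin_num.
  by rewrite ge0_fin_numE ?(le_lt_trans A2) ?ltry//; exact: cmu_ge0.
have [x Ax] : exists x, cmu A = x%:E by exists (fine (cmu A)); rewrite fineK.
have {A1} : r - d%:R * (e' * r) <= x by rewrite -lee_fin -Ax.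
have {A2} xr : x <= r by rewrite -lee_fin -Ax.
rewrite (_ : fine _ = x); last by rewrite -[RHS]/(fine x%:E) -Ax.
move=> rx; rewrite -[1](divff (lt0r_neq0 r0)) -mulrBl normrM normfV (gtr0_norm r0).
rewrite ltr_pdivrMr// ler0_norm ?subr_le0//.
have : d%:R * e' < e.
  by rewrite /e' mulrA ltr_pdivrMr// mulrC ltr_pM2l// ltr_nat.
rewrite -(ltr_pM2r r0); lra.
Qed.

End LebesgueFacts.

Lemma der_cst {R : realType} {V : normedModType R} (v : V) (t : R) : der (fun=> v) t 0.
Proof.
move=> e e0; exists 1 => // s _.
by rewrite scaler0 !subrr normr0 mulr_ge0// ltW.
Qed.

Lemma derZ {R : realType} {V : normedModType R} (r : R) (f : R -> V) (t : R) v :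
  der f t v -> der (fun s => r *: f s) t (r *: v).
Proof. by move=> /is_derive_der fv; apply/is_derive_der; exact: is_deriveZ. Qed.

(** * Lipschitz curves and a Gronwall estimate *)

Section LipschitzCurves.
Context {R : realType} {V : normedModType R}.
Notation mu := (@lebesgue_measure R).

Definition lip_on (a b : R) (H : R -> V) := exists C : R,
  forall s t, a <= s <= b -> a <= t <= b -> `|H t - H s| <= C * `|t - s|.

Lemma lipschitz_ordered a b C (H : R -> V) :
  (forall s t, a <= s -> s <= t -> t <= b -> `|H t - H s| <= C * (t - s)) ->
  forall s t, a <= s <= b -> a <= t <= b -> `|H t - H s| <= C * `|t - s|.
Proof.
move=> HC s t; wlog st : s t / s <= t.
  move=> W sab tab; have [st|/ltW ts] := leP s t; first exact: W.
  by rewrite distrC [`|t - s|]distrC; exact: W.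
by move=> /andP[as_ _] /andP[_ tb]; rewrite [`|t - s|]ger0_norm ?subr_ge0//; exact: HC.
Qed.

Lemma lip_on_gt0 a b H : lip_on a b H -> exists2 C : R, 0 < C &
  forall s t, a <= s <= b -> a <= t <= b -> `|H t - H s| <= C * `|t - s|.
Proof.
move=> [C HC]; exists (`|C| + 1); first by rewrite ltr_wpDl.
move=> s t sab tab; apply: le_trans (HC _ _ sab tab) _.
by rewrite ler_wpM2r// (le_trans (ler_norm _))// lerDl.
Qed.

Lemma lip_onD a b H G : lip_on a b H -> lip_on a b G -> lip_on a b (fun t => H t + G t).
Proof.
move=> [C HC] [D HD]; exists (C + D) => s t sab tab.
rewrite opprD addrACA mulrDl; apply: le_trans (ler_normD _ _) _.
by apply: lerD; [exact: HC|exact: HD].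
Qed.

Lemma lip_onZ a b r H : lip_on a b H -> lip_on a b (fun t => r *: H t).
Proof.
move=> [C HC]; exists (`|r| * C) => s t sab tab.
by rewrite -scalerBr normrZ -mulrA ler_wpM2l// HC.
Qed.

Lemma lip_onB a b H G : lip_on a b H -> lip_on a b G -> lip_on a b (fun t => H t - G t).
Proof.
move=> HC /(lip_onZ (-1)) HD; have := lip_onD HC HD.
by move=> [C D]; exists C => s t sab tab; have := D _ _ sab tab; rewrite !scaleN1r.
Qed.

Lemma lip_on_cst a b v : lip_on a b (fun=> v).
Proof. by exists 0 => s t _ _; rewrite subrr normr0 mul0r. Qed.

Lemma lip_on_bounded a b H : lip_on a b H -> exists2 M : R, 0 <= M & forall t, a <= t <= b -> `|H t| <= M.
Proof.
have [ba|ab] := ltP b a.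
  by move=> _; exists 0 => // t /andP[/le_trans h /h]; rewrite leNgt ba.
move=> /lip_on_gt0[C C0 HC]; exists (`|H a| + C * (b - a)).
  by rewrite addr_ge0// mulr_ge0 ?subr_ge0// ltW.
move=> t /andP[at_ tb]; rewrite -[H t](subrK (H a)) addrC.
apply: le_trans (ler_normD _ _) _; rewrite lerD2l.
apply: le_trans (HC _ _ _ _) _; rewrite ?lexx ?at_//.
by rewrite ger0_norm ?subr_ge0// ler_wpM2l ?(ltW C0)// lerD2r.
Qed.

Lemma lip_on_abs_continuous a b (I : set R) H : (forall t, I t -> a <= t <= b) ->
  lip_on a b H -> abs_continuous_on I H.
Proof.
move=> Iab /lip_on_gt0[C C0 HC] e e0; exists (e / C); first by rewrite divr_gt0.
move=> k x y xy _ sxy; apply: (@le_lt_trans _ _ (\sum_(i < k) C * (y i - x i))).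
  apply: ler_sum => i _; have [Ix Iy xyi] := xy i.
  by apply: le_trans (HC _ _ (Iab _ Ix) (Iab _ Iy)) _; rewrite ger0_norm// subr_ge0.
by rewrite -mulr_sumr mulrC -ltr_pdivlMr.
Qed.

Lemma ae_lip (a b K : R) (H : R -> V) : 0 <= K -> lip_on a b H ->
  {ae mu, forall t, a < t < b -> exists2 v, der H t v & `|v| <= K} ->
  forall s t, a <= s <= b -> a <= t <= b -> `|H t - H s| <= K * `|t - s|.
Proof.
move=> K0 lH Hae; apply: lipschitz_ordered => s t as_ st tb.
apply: ae_derivative_bound => //.
  apply: (@lip_on_abs_continuous a b) => // x /andP[sx xt].
  by rewrite (le_trans as_ sx) (le_trans xt tb).
apply: ae_impl Hae => x Hx /andP[sx xt]; apply: Hx.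
by rewrite (le_lt_trans as_ sx) (lt_le_trans xt tb).
Qed.

(** With [L * (b - a) <= 2^-1] the supremum [M] of [|w|] satisfies [M <= |w tau| + eps + M / 2],
    which gives the factor 2 without exponentials. The forcing term enters only through the
    oscillation of its primitive [P]: dominated convergence makes that small, while the forcing term
    itself is small only pointwise. *)
Lemma gronwall (a b L eps : R) (w P : R -> V) : a <= b -> 0 <= L -> L * (b - a) <= 2^-1 ->
  lip_on a b w -> lip_on a b P ->
  (forall s t, a <= s <= b -> a <= t <= b -> `|P t - P s| <= eps) ->
  {ae mu, forall t, a < t < b -> exists2 v, der (fun t => w t - P t) t v & `|v| <= L * `|w t|} ->
  forall t tau, a <= t <= b -> a <= tau <= b -> `|w t| <= 2 * (`|w tau| + eps).
Proof.
move=> ab L0 Lab lw lP Peps Hae t tau tab tauab.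
pose E := [set `|w s| | s in [set s | a <= s <= b]].
have [M0 M00 HM0] := lip_on_bounded lw.
have hsE : has_sup E.
  split; first by exists (`|w a|), a => //=; rewrite lexx.
  by exists M0 => _ [s sab <-]; exact: HM0.
have wM s : a <= s <= b -> `|w s| <= sup E.
  by move=> sab; apply: ub_le_sup; [exact: hsE.2|exists s].
have M_ge0 : 0 <= sup E by apply: le_trans (wM t tab).
have step s : a <= s <= b -> `|w s| <= `|w tau| + eps + 2^-1 * sup E.
  move=> sab.
  have lip : `|(w s - P s) - (w tau - P tau)| <= (L * sup E) * `|s - tau|.
    apply: (@ae_lip a b _ (fun s => w s - P s)) => //; first by rewrite mulr_ge0.
      exact: lip_onB.
    apply: ae_impl Hae => x Hx xab; have [v dv vL] := Hx xab; exists v => //.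
    by apply: le_trans vL _; rewrite ler_wpM2l// wM//; case/andP: xab => ? ?; rewrite !ltW.
  have sb : `|s - tau| <= b - a.
    move: sab tauab => /andP[? ?] /andP[? ?].
    by rewrite ler_norml; apply/andP; split; lra.
  have -> : w s = (w tau + (P s - P tau)) + ((w s - P s) - (w tau - P tau)) by zmod.
  apply: le_trans (ler_normD _ _) _; apply: lerD.
    by apply: le_trans (ler_normD _ _) _; rewrite lerD2l Peps.
  apply: le_trans lip _; rewrite mulrAC ler_wpM2r//.
  by apply: le_trans Lab; rewrite ler_wpM2l.
have : sup E <= `|w tau| + eps + 2^-1 * sup E.
  by apply: ge_sup; [exact: hsE.1|move=> _ [s sab <-]; exact: step].
by move: (wM t tab); lra.
Qed.

End LipschitzCurves.

(** * Caratheodory equations in a normed space *)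

Section VectorPrimitive.
Context {R : realType} {V : normedModType R} (B : coordinates V).
Notation mu := (@lebesgue_measure R).

Definition vector_measurable (I : set R) (h : R -> V) :=
  forall i, lebesgue_measurable_fun I (fun t => coef B i (h t)).

Section at_interval.
Variables (a b K : R) (h : R -> V).
Hypotheses (ab : a <= b) (mh : vector_measurable `[a, b] h)
  (hK : forall t, a <= t <= b -> `|h t| <= K).

Definition vector_primitive t := \sum_i primitive (fun t => coef B i (h t)) a t *: cvec B i.

Let hiK i t : a <= t <= b -> `|coef B i (h t)| <= K.
Proof. by move=> /hK; apply: le_trans; exact: coef_bound. Qed.

Let K0 : 0 <= K.
Proof. by apply: le_trans (hK (t := a) _) => //; rewrite lexx. Qed.

Lemma vector_primitive_lip_on : lip_on a b vector_primitive.
Proof.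
pose p i := primitive (fun t => coef B i (h t)) a.
have pL i s t : a <= s <= b -> a <= t <= b -> `|p i t - p i s| <= K * `|t - s|.
  exact: (@lipschitz_ordered _ R^o a b K (p i) (primitive_lipschitz (mh i) (@hiK i))).
exists (K * cbound B) => s t sab tab; rewrite -sumrB mulrAC mulr_sumr.
apply: le_trans (ler_norm_sum _ _ _) _; apply: ler_sum => i _.
by rewrite -scalerBl normrZ ler_wpM2r// pL.
Qed.

Lemma vector_primitive_der : {ae mu, forall t, a < t < b -> der vector_primitive t (h t)}.
Proof.
have : {ae mu, forall t, forall i, a < t < b ->
    der (primitive (fun t => coef B i (h t)) a : R -> R^o) t (coef B i (h t))}.
  by apply: ae_all => i; exact: (primitive_der (mh i) (@hiK i)).
apply: ae_impl => t Ht tab; rewrite [h t](coefK B).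
by apply: der_sum => i; apply: der_scale; exact: Ht.
Qed.

Lemma vector_primitive_le s t : a <= s <= b -> a <= t <= b ->
  `|vector_primitive t - vector_primitive s| <=
  \sum_i (\int[completed_lebesgue_measure]_(x in `[a, b]) `|coef B i (h x)|) * `|cvec B i|.
Proof.
wlog st : s t / s <= t.
  move=> W sab tab; have [st|ts] := leP s t; first exact: W.
  by rewrite distrC; apply: W => //; exact: ltW.
move=> /andP[as_ sb] /andP[at_ tb]; rewrite -sumrB.
apply: le_trans (ler_norm_sum _ _ _) _; apply: ler_sum => i _.
rewrite -scalerBl normrZ ler_wpM2r//.
rewrite (primitive_sub (mh i) (@hiK i))//.
have sub : `]s, t] `<=` `[a, b].
  by move=> x /=; rewrite !in_itv /= => /andP[/ltW sx xt]; rewrite (le_trans as_)//= (le_trans xt).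
have i1 := integrable_sub (mh i) (@hiK i) sub ab.
have i2 := integrable_sub (mh i) (@hiK i) (@subset_refl _ `[a, b]) ab.
apply: le_trans (le_normr_Rintegral _ i1) _; first exact: measurable_itv_cara.
rewrite /Rintegral; apply: fine_le.
- apply: integrable_fin_num; first exact: measurable_itv_cara.
  exact: integrable_norm i1.
- apply: integrable_fin_num; first exact: measurable_itv_cara.
  exact: integrable_norm i2.
- apply: ge0_subset_integral; [exact: measurable_itv_cara|exact: measurable_itv_cara| |by move=> x _; rewrite lee_fin|exact: sub].
  by case/integrableP: (integrable_norm i2).
Qed.

End at_interval.

(** The increments of a primitive are bounded by the integral of the norm over all of [[a, b]], so
    pointwise convergence of bounded integrands becomes smallness uniform in [s] and [t]. *)
Lemma vector_dominated (a b K : R) (h : nat -> R -> V) : a <= b ->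
  (forall n, vector_measurable `[a, b] (h n)) ->
  (forall n t, a <= t <= b -> `|h n t| <= K) ->
  (forall t, a <= t <= b -> h ^~ t @ \oo --> (0 : V)) ->
  forall e, 0 < e -> exists n, forall s t, a <= s <= b -> a <= t <= b ->
  `|vector_primitive a (h n) t - vector_primitive a (h n) s| <= e.
Proof.
move=> ab mh hK h0 e e0.
have c1 : 0 < cbound B + 1 by rewrite ltr_wpDl// cbound_ge0.
have e1 : 0 < e / (cbound B + 1) by rewrite divr_gt0.
have : \forall n \near \oo, forall i,
    \int[completed_lebesgue_measure]_(x in `[a, b]) `|coef B i (h n x)| <= e / (cbound B + 1).
  apply: filter_forall => i.
  have /cvgrPdist_le/(_ _ e1) : (fun n => \int[completed_lebesgue_measure]_(x in `[a, b])
      `|coef B i (h n x)|) @ \oo --> (0 : R).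
    apply: (@dominated_primitive R a b _ K) => //.
    - by move=> n; exact: mh.
    - by move=> n t tab; apply: le_trans (hK n _ tab); exact: coef_bound.
    - move=> t tab; apply/cvgrPdist_le => d d0.
      have /cvgrPdist_le/(_ _ d0) := h0 t tab.
      apply: filterS => n; rewrite !sub0r !normrN => /(le_trans _); apply.
      exact: coef_bound.
  apply: filterS => n; rewrite sub0r normrN => /(le_trans _); apply.
  exact: ler_norm.
move=> [n _ Hn]; exists n => s t sab tab.
apply: le_trans (vector_primitive_le ab (mh n) (hK n) sab tab) _.
apply: (@le_trans _ _ (\sum_i e / (cbound B + 1) * `|cvec B i|)).
  by apply: ler_sum => i _; rewrite ler_wpM2r//; exact: (Hn n (leqnn n)).
rewrite -mulr_sumr -/(cbound B) mulrAC ler_pdivrMr// ler_wpM2l ?(ltW e0)//.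
by rewrite lerDl.
Qed.

End VectorPrimitive.

(** * Existence and uniqueness for Caratheodory equations *)

Section Picard.
Context {R : realType} {V : normedModType R} (B : coordinates V).
Notation mu := (@lebesgue_measure R).
Variables (X : R -> V -> V) (a b L C : R) (S : set V).
Hypotheses (ab : a <= b) (L0 : 0 <= L) (C0 : 0 <= C) (Lab : L * (b - a) <= 2^-1)
  (XC : forall t x, a <= t <= b -> S x -> `|X t x| <= C)
  (XL : forall t x y, a <= t <= b -> S x -> S y -> `|X t y - X t x| <= L * `|y - x|)
  (Xm : forall x, S x -> vector_measurable B `[a, b] (X ^~ x)).

Definition solution (y : R -> V) := [/\ lip_on a b y, forall t, a <= t <= b -> S (y t)
  & {ae mu, forall t, a < t < b -> der y t (X t (y t))}].

Lemma superposition_measurable y : lip_on a b y -> (forall t, a <= t <= b -> S (y t)) ->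
  vector_measurable B `[a, b] (fun t => X t (y t)).
Proof.
move=> [D HD] yS i.
apply: (@measurable_superposition R V (fun t x => coef B i (X t x)) S y a b D) => //.
  by move=> x Sx; exact: Xm.
move=> t x tab Sx e e0; exists (e / (L + 1)); first by rewrite divr_gt0// ltr_wpDl.
move=> z Sz zx; rewrite -coefBr; apply: le_trans (coef_bound _ _) _.
apply: le_trans (XL tab Sx Sz) _.
apply: (@le_trans _ _ ((L + 1) * `|z - x|)); first by rewrite ler_wpM2r// lerDl.
by rewrite mulrC -ler_pdivlMr ?ltr_wpDl// ltW.
Qed.

Lemma solution_stability y z t tau : solution y -> solution z ->
  a <= t <= b -> a <= tau <= b -> `|y t - z t| <= 2 * `|y tau - z tau|.
Proof.
move=> [yl yS yd] [zl zS zd] tab tauab.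
have := @gronwall R V a b L 0 (fun t => y t - z t) (fun=> 0) ab L0 Lab.
move=> /(_ (lip_onB yl zl) (lip_on_cst _ _ _)) H.
rewrite -[`|y tau - z tau|]addr0; apply: H => //.
  by move=> *; rewrite subrr normr0.
apply: ae_impl2 yd zd => s ys zs sab; have sab' : a <= s <= b by case/andP: sab => ? ?; rewrite !ltW.
exists (X s (y s) - X s (z s)).
  apply: der_eq (derB (ys sab) (zs sab)).
  by exists 1 => // r _; rewrite subr0.
by apply: XL => //; [exact: zS|exact: yS].
Qed.

Lemma solution_uniq y z tau : solution y -> solution z -> a <= tau <= b ->
  y tau = z tau -> forall t, a <= t <= b -> y t = z t.
Proof.
move=> sy sz tauab E t tab; apply/eqP; rewrite -subr_eq0 -normr_le0.
by have := solution_stability sy sz tab tauab; rewrite E subrr normr0 mulr0.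
Qed.

Variables (tau : R) (x0 : V).
Hypotheses (tauab : a <= tau <= b) (x0S : forall x, `|x - x0| <= C * (b - a) -> S x).

Let good (y : R -> V) := y tau = x0 /\
  forall s t, a <= s <= b -> a <= t <= b -> `|y t - y s| <= C * `|t - s|.

Let goodS y t : good y -> a <= t <= b -> S (y t).
Proof.
move=> [ytau yC] tab; apply: x0S; rewrite -ytau.
apply: le_trans (yC _ _ tauab tab) _; rewrite ler_wpM2l//.
move: tab tauab => /andP[? ?] /andP[? ?].
by rewrite ler_norml; apply/andP; split; lra.
Qed.

Let next y : good y -> exists2 z, good z & {ae mu, forall t, a < t < b -> der z t (X t (y t))}.
Proof.
move=> gy; have yS t := goodS (t := t) gy.
have yl : lip_on a b y by exists C; exact: gy.2.
have mX := superposition_measurable yl yS.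
have hK t : a <= t <= b -> `|X t (y t)| <= C by move=> tab; apply: XC => //; exact: yS.
pose H := vector_primitive B a (fun t => X t (y t)).
have Hd := vector_primitive_der mX hK.
have Hl := vector_primitive_lip_on mX hK.
exists (fun t => x0 + (H t - H tau)); last first.
  apply: ae_impl Hd => t Ht tab; have := derD (@der_cst _ _ (x0 - H tau) t) (Ht tab).
  rewrite add0r; apply: der_eq; exists 1 => // s _.
  by rewrite -/(H s); zmod.
split; first by rewrite subrr addr0.
move=> s t sab tab; have -> : x0 + (H t - H tau) - (x0 + (H s - H tau)) = H t - H s by zmod.
apply: (@ae_lip _ _ a b) => //; apply: ae_impl Hd => r Hr rab.
exists (X r (y r)); first exact: Hr.
by apply: hK; case/andP: rab => ? ?; rewrite !ltW.
Qed.

(** The iterates stay among the [C]-Lipschitz curves through [x0] at time [tau], which remain in [S]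
    by [x0S]. Integrating the field halves the distance of two such curves, because
    [L * (b - a) <= 2^-1]. *)
Lemma picard : exists y, [/\ y tau = x0, solution y &
  forall s t, a <= s <= b -> a <= t <= b -> `|y t - y s| <= C * `|t - s|].
Proof.
pose G := {y : R -> V | good y}.
have g0 : good (fun=> x0) by split => // s t _ _; rewrite subrr normr0 mulr_ge0.
have /choice[nx Hnx] : forall y : G, exists z : G, {ae mu, forall t, a < t < b -> der (sval z) t (X t (sval y t))}.
  by move=> [y gy] /=; have [z gz Hz] := next gy; exists (exist _ z gz).
pose y (k : nat) : R -> V := sval (iter k nx (exist _ _ g0)).
have yg k : good (y k) by rewrite /y; case: (iter k nx _).
have yd k : {ae mu, forall t, a < t < b -> der (y k.+1) t (X t (y k t))} by exact: Hnx.
pose M := C * (b - a).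
have M0 : 0 <= M by rewrite mulr_ge0 ?subr_ge0.
have contr f g f' g' D : good f -> good g -> good f' -> good g' -> 0 <= D ->
    {ae mu, forall t, a < t < b -> der f' t (X t (f t))} ->
    {ae mu, forall t, a < t < b -> der g' t (X t (g t))} ->
    (forall t, a <= t <= b -> `|f t - g t| <= D) ->
    forall t, a <= t <= b -> `|f' t - g' t| <= 2^-1 * D.
  move=> gf gg gf' gg' D0 df dg fg t tab.
  have : `|(f' t - g' t) - (f' tau - g' tau)| <= (L * D) * `|t - tau|.
    apply: (@ae_lip _ _ a b _ (fun t => f' t - g' t)) => //; first by rewrite mulr_ge0.
      by apply: lip_onB; exists C; [exact: gf'.2|exact: gg'.2].
    apply: ae_impl2 df dg => s fs gs sab; have sab' : a <= s <= b by case/andP: sab => ? ?; rewrite !ltW.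
    exists (X s (f s) - X s (g s)); first exact: derB (fs sab) (gs sab).
    apply: le_trans (XL sab' (goodS gg sab') (goodS gf sab')) _.
    by rewrite ler_wpM2l// fg.
  rewrite gf'.1 gg'.1 subrr subr0 => /le_trans; apply.
  rewrite mulrAC ler_wpM2r//; apply: le_trans Lab; rewrite ler_wpM2l//.
  move: tab tauab => /andP[? ?] /andP[? ?].
  by rewrite ler_norml; apply/andP; split; lra.
have ystep k t : a <= t <= b -> `|y k.+1 t - y k t| <= M / 2 ^+ k.
  elim: k t => [|k IH] t tab.
    rewrite expr0 divr1; have [y1 yC] := yg 1%N.
    rewrite (_ : y 0%N t = y 1%N tau); last by rewrite y1.
    apply: le_trans (yC _ _ tauab tab) _; rewrite ler_wpM2l//.
    move: tab tauab => /andP[? ?] /andP[? ?].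
    by rewrite ler_norml; apply/andP; split; lra.
  rewrite exprS invfM mulrCA; apply: (contr (y k.+1) (y k)) => //.
  by rewrite divr_ge0// exprn_ge0.
(* Telescoped form of the geometric series with terms [M / 2 ^+ k]. *)
have ydist k m t : a <= t <= b -> (k <= m)%N -> `|y m t - y k t| <= 2 * M / 2 ^+ k - 2 * M / 2 ^+ m.
  move=> tab; elim: m => [|m IH]; first by rewrite leqn0 => /eqP ->; rewrite !subrr normr0.
  rewrite leq_eqVlt => /predU1P[->|]; first by rewrite !subrr normr0.
  rewrite ltnS => /IH {}IH.
  have -> : y m.+1 t - y k t = (y m.+1 t - y m t) + (y m t - y k t) by zmod.
  apply: le_trans (ler_normD _ _) _; apply: le_trans (lerD (ystep m t tab) IH) _.
  have -> : 2 * M / 2 ^+ m.+1 = M / 2 ^+ m by rewrite exprS invfM mulrACA divff// mul1r.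
  by lra.
pose eps k := 2 * M / 2 ^+ k.
have eps0 k : 0 <= eps k by rewrite /eps divr_ge0 ?exprn_ge0// mulr_ge0.
have /choice[c Hc] : forall ti : R * 'I_(cdim B), exists c, a <= ti.1 <= b ->
    forall k, `|coef B ti.2 (y k ti.1) - c| <= eps k.
  move=> [t i] /=; have [tab|_] := boolP (a <= t <= b); last by exists 0.
  pose z k := coef B i (y k t).
  have zd k m : (k <= m)%N -> `|z m - z k| <= eps k - eps m.
    by move=> km; rewrite -coefBr; apply: le_trans (coef_bound _ _) (ydist _ _ _ tab km).
  (* The limit of each coordinate is the supremum of the lower bounds [z k - eps k], each of which
     lies below every [z j + eps j]. *)
  pose E := [set z k - eps k | k in [set: nat]].
  have zz j k : z j - eps j <= z k + eps k.
    have [jk|/ltnW kj] := leqP j k.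
      have := zd _ _ jk; have := eps0 k; rewrite ler_norml => ? /andP[? ?]; lra.
    have := zd _ _ kj; have := eps0 j; rewrite ler_norml => ? /andP[? ?]; lra.
  have Eub k : ubound E (z k + eps k) by move=> _ [j _ <-].
  have E0 : E !=set0 by exists (z 0%N - eps 0%N), 0%N.
  exists (sup E) => _ k; rewrite ler_norml; apply/andP; split.
    have : sup E <= z k + eps k by apply: ge_sup.
    by rewrite /z; lra.
  have : z k - eps k <= sup E.
    by apply: ub_le_sup; [exists (z k + eps k)|exists k].
  by rewrite /z; lra.
pose Y t := \sum_i c (t, i) *: cvec B i.
have Yy k t : a <= t <= b -> `|y k t - Y t| <= eps k * cbound B.
  move=> tab; rewrite [y k t](coefK B) /Y -sumrB mulr_sumr.
  apply: le_trans (ler_norm_sum _ _ _) _; apply: ler_sum => i _.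
  by rewrite -scalerBl normrZ ler_wpM2r//; exact: (Hc (t, i) tab k).
have eps_small e : 0 < e -> exists k, eps k * cbound B <= e.
  move=> e0; pose D := 2 * M * cbound B; pose n := (Num.truncn (D / e)).+1.
  have Dn : D / e <= 2 ^+ n.
    apply: le_trans (ltW (truncnS_gt _)) _.
    by rewrite -natrX ler_nat ltnW// ltn_expl.
  exists n; have -> : eps n * cbound B = D / 2 ^+ n by rewrite /eps mulrAC.
  by rewrite ler_pdivrMr ?exprn_gt0// mulrC -ler_pdivrMr.
have limle (D : R) (A : R) : (forall k, A <= D + 2 * (eps k * cbound B)) -> A <= D.
  move=> H; apply/ler_addgt0Pr => e e0; have [k Hk] := eps_small (e / 2) (divr_gt0 e0 (ltr0n _ 2)).
  by apply: le_trans (H k) _; lra.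
have cb0 := cbound_ge0 B.
have Yg : good Y.
  split.
    apply/eqP; rewrite -subr_eq0 -normr_le0; apply: limle => k.
    have := Yy k _ tauab; rewrite (yg k).1 distrC => /le_trans; apply.
    by have := mulr_ge0 (eps0 k) cb0; lra.
  move=> s t sab tab; apply: limle => k.
  have -> : Y t - Y s = (y k t - y k s) - (y k t - Y t) + (y k s - Y s) by zmod.
  apply: le_trans (ler_normD _ _) _; have := Yy k _ sab; have := Yy k _ tab.
  have := ler_normB (y k t - y k s) (y k t - Y t); have := (yg k).2 _ _ sab tab; lra.
(* One more iteration from the limit gives [z] with derivative [X t (Y t)]; since [z] and [Y]
   coincide on [[a, b]], [z] solves the equation. *)
have [z zg zd] := next Yg.
have zY t : a <= t <= b -> z t = Y t.
  move=> tab; apply/eqP; rewrite -subr_eq0 -normr_le0; apply: limle => k.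
  have h1 := contr _ _ _ _ _ Yg (yg k) zg (yg k.+1) (mulr_ge0 (eps0 k) cb0) zd (yd k).
  have {}h1 : `|z t - y k.+1 t| <= 2^-1 * (eps k * cbound B).
    by apply: h1 => // s sab; rewrite distrC Yy.
  have e1 : eps k.+1 * cbound B <= eps k * cbound B.
    rewrite ler_wpM2r// /eps exprS invfM mulrCA.
    by have := eps0 k; rewrite /eps; lra.
  have -> : z t - Y t = (z t - y k.+1 t) + (y k.+1 t - Y t) by zmod.
  apply: le_trans (ler_normD _ _) _; have := Yy k.+1 _ tab.
  by have := mulr_ge0 (eps0 k) cb0; lra.
exists z; split; first exact: zg.1.
  split; first by exists C; exact: zg.2.
    by move=> t tab; exact: (goodS zg tab).
  apply: ae_impl zd => t zt tab; rewrite zY; first exact: zt.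
  by case/andP: tab => ? ?; rewrite !ltW.
exact: zg.2.
Qed.

End Picard.

(** * The resolvent of a linear equation *)

Section Linearization.
Context {R : realType} {V : normedModType R} (B : coordinates V).
Notation mu := (@lebesgue_measure R).
Variables (A : R -> V -> V) (a b L : R).
Hypotheses (ab : a <= b) (L0 : 0 <= L) (Lab : L * (b - a) <= 2^-1)
  (Alin : forall t r v w, a <= t <= b -> A t (r *: v + w) = r *: A t v + A t w)
  (AL : forall t v, a <= t <= b -> `|A t v| <= L * `|v|)
  (Am : forall v, vector_measurable B `[a, b] (A ^~ v)).

Let AB t v w : a <= t <= b -> A t (w - v) = A t w - A t v.
Proof. by move=> tab; rewrite addrC -scaleN1r Alin// scaleN1r addrC. Qed.

Let ALip t x y : a <= t <= b -> [set: V] x -> [set: V] y -> `|A t y - A t x| <= L * `|y - x|.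
Proof. by move=> tab _ _; rewrite -AB// AL. Qed.

Let linear_picard tau v : a <= tau <= b -> exists2 y, y tau = v & solution A a b [set: V] y.
Proof.
(* A linear field is bounded only on bounded sets. On the ball of radius [2 * |v|] its size is at
   most [2 * L * |v|], so a solution from [v] moves by at most [|v|] and stays inside. *)
move=> tauab; pose S := [set x : V | `|x| <= 2 * `|v|].
have [|||||y [yv [yl _ yd] _]] := @picard R V B A a b L (2 * L * `|v|) S ab L0 _ Lab _ _ _ tau v tauab.
- by rewrite mulr_ge0// mulr_ge0.
- move=> t x tab Sx; apply: le_trans (AL _ tab) _.
  by rewrite [2 * L]mulrC -mulrA ler_wpM2l.
- by move=> t x y tab _ _; exact: ALip.
- by move=> x _; exact: Am.
- move=> x xv; rewrite /S /= -[x](subrK v); apply: le_trans (ler_normD _ _) _.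
  have -> : 2 * `|v| = `|v| + `|v| by rewrite mulr_natl mulr2n.
  rewrite lerD2r; apply: le_trans xv _.
  have : L * (b - a) * `|v| <= 2^-1 * `|v| by rewrite ler_wpM2r.
  lra.
- by exists y.
Qed.

(** Linearity and the composition law are instances of uniqueness: combinations of solutions are
    solutions, and two solutions that agree at one time agree. The bound is stability against the
    zero solution. *)
Lemma fundamental_solution : exists Lam : R -> R -> V -> V,
  [/\ forall tau v, a <= tau <= b -> solution A a b [set: V] (fun t => Lam t tau v) /\ Lam tau tau v = v,
      forall t tau v, a <= t <= b -> a <= tau <= b -> `|Lam t tau v| <= 2 * `|v|,
      forall t tau v, a <= t <= b -> a <= tau <= b -> `|Lam t tau v - v| <= 2 * L * `|v| * `|t - tau|,
      forall t tau r v w, a <= t <= b -> a <= tau <= b ->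
        Lam t tau (r *: v + w) = r *: Lam t tau v + Lam t tau w &
      forall t s tau v, a <= t <= b -> a <= s <= b -> a <= tau <= b ->
        Lam t s (Lam s tau v) = Lam t tau v].
Proof.
have uniq := solution_uniq ab L0 Lab ALip.
have stab := solution_stability ab L0 Lab ALip.
have : forall tv : R * V, exists y, a <= tv.1 <= b -> y tv.1 = tv.2 /\ solution A a b [set: V] y.
  move=> [tau v] /=; have [tauab|_] := boolP (a <= tau <= b); last by exists (fun=> 0).
  by have [y yv ys] := linear_picard v tauab; exists y.
move=> /choice[Y HY]; exists (fun t tau v => Y (tau, v) t).
have Yi tau v : a <= tau <= b -> Y (tau, v) tau = v by move=> /(HY (tau, v))[].
have Ys tau v : a <= tau <= b -> solution A a b [set: V] (Y (tau, v)) by move=> /(HY (tau, v))[].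
have A0 t : a <= t <= b -> A t 0 = 0.
  by move=> tab; have := @AB t 0 0 tab; rewrite !subrr.
have lin r y z : solution A a b [set: V] y -> solution A a b [set: V] z ->
    solution A a b [set: V] (fun t => r *: y t + z t).
  move=> [yl _ yd] [zl _ zd]; split=> //; first by apply: lip_onD => //; exact: lip_onZ.
  apply: ae_impl2 yd zd => t yt zt tab; have tab' : a <= t <= b by case/andP: tab => ? ?; rewrite !ltW.
  rewrite Alin//; apply: derD; last exact: zt.
  by apply: derZ; exact: yt.
have s0 : solution A a b [set: V] (fun=> 0).
  split=> //; first exact: lip_on_cst.
  apply: aeW => t tab; rewrite A0; first exact: der_cst.
  by case/andP: tab => ? ?; rewrite !ltW.
have Yb t tau v : a <= t <= b -> a <= tau <= b -> `|Y (tau, v) t| <= 2 * `|v|.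
  move=> tab tauab; have := stab _ _ t tau (Ys tau v tauab) s0 tab tauab.
  by rewrite !subr0 Yi.
split=> //.
- by move=> tau v tauab; split; [exact: Ys|exact: Yi].
- move=> t tau v tab tauab; rewrite -[v in _ - v](Yi tau v tauab).
  have [yl _ yd] := Ys tau v tauab.
  apply: (@ae_lip _ _ a b) => //; first by rewrite mulr_ge0// mulr_ge0.
  apply: ae_impl yd => s ys sab; exists (A s (Y (tau, v) s)); first exact: ys.
  have sab' : a <= s <= b by case/andP: sab => ? ?; rewrite !ltW.
  by apply: le_trans (AL _ sab') _; rewrite [2 * L]mulrC -mulrA ler_wpM2l// Yb.
- move=> t tau r v w tab tauab.
  apply: (uniq _ _ tau (Ys _ _ tauab) (lin r _ _ (Ys _ v tauab) (Ys _ w tauab)) tauab) => //.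
  by rewrite !Yi.
- move=> t s tau v tab sab tauab.
  by apply: (uniq _ _ s (Ys _ _ sab) (Ys _ _ tauab) sab) => //; rewrite Yi.
Qed.

End Linearization.

(** * Differentiability with respect to the initial value *)

Section Differentiability.
Context {R : realType} {V : normedModType R} (B : coordinates V).
Notation mu := (@lebesgue_measure R).
Variables (X : R -> V -> V) (a b L C : R) (S : set V).
Hypotheses (ab : a <= b) (L0 : 0 <= L) (Lab : L * (b - a) <= 2^-1)
  (XL : forall t x y, a <= t <= b -> S x -> S y -> `|X t y - X t x| <= L * `|y - x|)
  (Xm : forall x, S x -> vector_measurable B `[a, b] (X ^~ x))
  (Xd : forall t x, a <= t <= b -> S x -> differentiable (X t) x)
  (XdL : forall t x v, a <= t <= b -> S x -> `|'d (X t) x v| <= L * `|v|)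
  (Xdc : forall t x v, a <= t <= b -> S x -> {for x, continuous (fun y => 'd (X t) y v)})
  (Xdm : forall x v, S x -> vector_measurable B `[a, b] (fun t => 'd (X t) x v)).
Variable xi : R -> V.
Hypothesis xiS : solution X a b S xi.

Definition linearized (t : R) (v : V) : V := 'd (X t) (xi t) v.

Lemma linearized_measurable v : vector_measurable B `[a, b] (linearized ^~ v).
Proof.
have [[D HD] xS _] := xiS; move=> i.
apply: (@measurable_superposition R V (fun t x => coef B i ('d (X t) x v)) S xi a b D) => //.
  by move=> x Sx; exact: Xdm.
move=> t x tab Sx e e0; have /continuousE/(_ _ e0)[d d0 H] := @Xdc t x v tab Sx.
exists d => // z Sz zx; rewrite -coefBr; apply: le_trans (coef_bound _ _) _; exact: H.
Qed.

Lemma lip_measurable (y : R -> V) : lip_on a b y -> vector_measurable B `[a, b] y.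
Proof.
move=> [D HD] i.
apply: (@measurable_superposition R V (fun t x => coef B i x) setT y a b D) => //.
  by move=> x _; exact: measurable_cst.
move=> t x tab Sx e e0; exists e => // z _ /ltW zx; rewrite -coefBr.
by apply: le_trans (coef_bound _ _) _.
Qed.

(** Expanding [y t] in coordinates reduces the claim to the linearized field on the fixed basis
    vectors. *)
Lemma linearized_lip_measurable (y : R -> V) : lip_on a b y ->
  vector_measurable B `[a, b] (fun t => linearized t (y t)).
Proof.
move=> /lip_measurable my i.
rewrite (_ : (fun t => _) = (fun t => \sum_j coef B j (y t) * coef B i (linearized t (cvec B j)))).
  apply: measurable_sum => j; apply: measurable_funM; first exact: my.
  exact: linearized_measurable.
apply/funext => t; rewrite [in LHS](coefK B (y t)) /linearized linear_sum coef_sum.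
by apply: eq_bigr => j _; rewrite linearZ_LR coefZ.
Qed.

Variable Lam : R -> R -> V -> V.
Hypothesis LamS : forall tau v, a <= tau <= b ->
  solution linearized a b [set: V] (fun t => Lam t tau v) /\ Lam tau tau v = v.

(** By contradiction, along a sequence of solutions whose initial deviation tends to 0, so that
    dominated convergence applies. The normalized error [w] satisfies the linearized equation with a
    forcing term [rho], the first-order remainder of the field: it is bounded and tends to 0
    pointwise, hence its primitive has small oscillation, and [gronwall] bounds [w]. *)
Lemma flow_differentiable t tau : a <= t <= b -> a <= tau <= b ->
  forall e, 0 < e -> exists2 d : R, 0 < d & forall y, solution X a b S y ->
    `|y tau - xi tau| < d ->
    `|y t - xi t - Lam t tau (y tau - xi tau)| <= e * `|y tau - xi tau|.
Proof.
move=> tab tauab e e0; apply: contrapT => /forall2NP H.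
have /choice[y Hy] : forall n : nat, exists y, [/\ solution X a b S y,
    `|y tau - xi tau| < n.+1%:R^-1 &
    e * `|y tau - xi tau| < `|y t - xi t - Lam t tau (y tau - xi tau)|].
  move=> n; have [h|] := H (n.+1%:R^-1); first by exfalso; apply: h; rewrite invr_gt0.
  move=> /existsNP[y /not_implyP[sy /not_implyP[yd /negP]]].
  by rewrite -ltNge => ye; exists y.
have [xl xS xd] := xiS.
pose h n := y n tau - xi tau.
pose eta n := `|h n|.
(* A zero deviation would make both curves coincide by uniqueness, and the strict inequality
   defining the sequence would fail. *)
have eta0 n : 0 < eta n.
  rewrite normr_gt0; apply/eqP => h0; have [ys _ ] := Hy n.
  rewrite -/(h n) h0 normr0 mulr0.
  have -> : y n t = xi t by apply: (solution_uniq ab L0 Lab XL ys xiS tauab) => //; apply/eqP; rewrite -subr_eq0 -/(h n) h0.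
  have [[ll _ ld] _] := LamS 0 tauab.
  suff -> : Lam t tau 0 = 0 by rewrite subrr subr0 normr0 ltxx.
  have LB s x z : a <= s <= b -> [set: V] x -> [set: V] z -> `|linearized s z - linearized s x| <= L * `|z - x|.
    move=> sab _ _; rewrite /linearized -(linearB ('d (X s) (xi s))).
    by apply: XdL => //; exact: xS.
  have s0 : solution linearized a b [set: V] (fun=> 0).
    split=> //; first exact: lip_on_cst.
    by apply: aeW => s sab; rewrite /linearized linear0; exact: der_cst.
  apply: (solution_uniq ab L0 Lab LB (LamS 0 tauab).1 s0 tauab) => //.
  exact: (LamS 0 tauab).2.
pose delta n s := y n s - xi s.
have dl n : lip_on a b (delta n) by apply: lip_onB => //; have [[]] := Hy n.
have deta n s : a <= s <= b -> `|delta n s| <= 2 * eta n.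
  by move=> sab; have [ys _ _] := Hy n; exact: (solution_stability ab L0 Lab XL ys xiS sab tauab).
have nZ n (v : V) : `|(eta n)^-1 *: v| = `|v| / eta n.
  by rewrite normrZ ger0_norm ?invr_ge0 ?ltW// mulrC.
pose rho n s := (eta n)^-1 *: (X s (y n s) - X s (xi s) - linearized s (delta n s)).
have mrho n : vector_measurable B `[a, b] (rho n).
  move=> i; have [[yl yS _] _ _] := Hy n.
  rewrite (_ : (fun s => _) = (fun s => (eta n)^-1 * (coef B i (X s (y n s)) - coef B i (X s (xi s))
     - coef B i (linearized s (delta n s))))); last by apply/funext => s; rewrite coefZ !coefBr.
  apply: measurable_funM; first exact: measurable_cst.
  apply: measurable_funB; last exact: linearized_lip_measurable.
  by apply: measurable_funB; exact: (superposition_measurable L0 XL Xm).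
(* The field difference and the linear term each contribute [L * |delta n s|], and
   [|delta n s| <= 2 * eta n]. *)
have rhoK n s : a <= s <= b -> `|rho n s| <= 4 * L.
  move=> sab; have [[_ yS _] _ _] := Hy n.
  rewrite /rho nZ ler_pdivrMr//.
  apply: le_trans (ler_normB _ _) _.
  have h1 := XL sab (xS _ sab) (yS _ sab).
  have h2 : `|linearized s (delta n s)| <= L * `|delta n s| by apply: XdL => //; exact: xS.
  have h3 : L * `|delta n s| <= L * (2 * eta n) by rewrite ler_wpM2l// deta.
  move: h1; rewrite -/(delta n s); lra.
have rho0 s : a <= s <= b -> rho ^~ s @ \oo --> (0 : V).
  move=> sab; apply/cvgrPdist_le => d d0.
  have [d1 d10 D1] := differentiable_frechet (Xd sab (xS _ sab)) (divr_gt0 d0 (ltr0n _ 2)).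
  have d20 : 0 < d1 / 2 by rewrite divr_gt0.
  near=> n; rewrite sub0r normrN /rho nZ ler_pdivrMr//.
  have etan : eta n < d1 / 2.
    have [_ hn _] := Hy n; apply: lt_trans hn _.
    near: n; exact: (near_infty_natSinv_lt (PosNum d20)).
  have dn := deta n s sab.
  have {}D1 := D1 (y n s); apply: le_trans (D1 _) _.
    by apply: le_lt_trans dn _; lra.
  apply: (@le_trans _ _ (d / 2 * (2 * eta n))).
    by rewrite ler_wpM2l// divr_ge0// ltW.
  by rewrite mulrA divfK.
(* The factor 2 of [gronwall] turns [e / 4] into [e / 2], which contradicts an error above [e]. *)
have e20 : 0 < e / 4 by rewrite divr_gt0.
have [n Hn] := vector_dominated ab mrho rhoK rho0 e20.
have [ys yd yt] := Hy n.
pose P := vector_primitive B a (rho n).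
have Pd := vector_primitive_der (mrho n) (rhoK n).
have Pl := vector_primitive_lip_on (mrho n) (rhoK n).
pose w s := (eta n)^-1 *: (delta n s - Lam s tau (h n)).
have [[ll _ ld] li] := LamS (h n) tauab.
have wl : lip_on a b w by apply: lip_onZ; exact: lip_onB.
have := @gronwall R V a b L (e / 4) w P ab L0 Lab wl Pl Hn.
move=> /(_ _ t tau tab tauab).
have -> : w tau = 0 by rewrite /w li /delta subrr scaler0.
rewrite normr0 add0r => W.
have {}W : `|w t| <= 2 * (e / 4).
  apply: W; have [_ _ yd'] := ys.
  apply: ae_impl2 Pd (ae_impl2 (fun s P Q => conj P Q) yd' (ae_impl2 (fun s P Q => conj P Q) xd ld)).
  move=> s Ps [yds [xds lds]] sab; have sab' : a <= s <= b by case/andP: sab => ? ?; rewrite !ltW.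
  exists (linearized s (w s)); last by apply: XdL => //; exact: xS.
  have D := derB (derZ (eta n)^-1 (derB (derB (yds sab) (xds sab)) (lds sab))) (Ps sab).
  move: D; congr der; rewrite /rho -scalerBr.
  rewrite /linearized /w (linearZ_LR ('d (X s) (xi s))).
  congr (_ *: _); rewrite /delta !(linearB ('d (X s) (xi s))); zmod.
move: W; rewrite /w nZ ler_pdivrMr// => W.
move: yt; rewrite -/(h n) -/(eta n) ltNge => /negP; apply.
apply: le_trans W _; have := eta0 n; nra.
Unshelve. all: by end_near.
Qed.

End Differentiability.

Lemma mul_div2_lt (R : realType) (K d : R) : 0 < K -> 0 < d -> K * (d / (2 * K)) < d.
Proof.
by move=> K0 d0; rewrite mulrA ltr_pdivrMr ?mulr_gt0//; have := mulr_gt0 K0 d0; lra.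
Qed.

(** * Integral curves and flows on a manifold *)

Definition c1_at {R : realType} {V W : normedModType R} (h : V -> W) (x : V) := differentiable h x /\
  forall v, {for x, continuous (fun y => 'd h y v)}.

Section C1Maps.
Context {R : realType} {V W : normedModType R}.

Lemma nbhs_ex (x : V) (P : V -> Prop) : (\forall y \near x, P y) ->
  exists2 d : R, 0 < d & forall y, `|y - x| < d -> P y.
Proof. by move/nbhs_normE. Qed.

Lemma ball_convex (x u w : V) (d r : R) : `|u - x| < d -> `|w - x| < d -> 0 <= r <= 1 ->
  `|u + r *: (w - u) - x| < d.
Proof.
move=> ud wd /andP[r0 r1].
have -> : u + r *: (w - u) - x = (1 - r) *: (u - x) + r *: (w - x) by zmod.
apply: le_lt_trans (ler_normD _ _) _; rewrite !normrZ (ger0_norm r0) ger0_norm ?subr_ge0//.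
have h1 : (1 - r) * `|u - x| <= (1 - r) * Num.max `|u - x| `|w - x|.
  by rewrite ler_wpM2l ?subr_ge0// le_max lexx.
have h2 : r * `|w - x| <= r * Num.max `|u - x| `|w - x|.
  by rewrite ler_wpM2l// le_max lexx orbT.
have h3 : Num.max `|u - x| `|w - x| < d by rewrite gt_max ud wd.
lra.
Qed.

Lemma c1_bounded (B : coordinates V) (h : V -> W) x : (\forall y \near x, differentiable h y) -> c1_at h x ->
  exists2 K : R, 0 <= K & exists2 d : R, 0 < d & forall y, `|y - x| < d ->
    [/\ differentiable h y, `|h y| <= K & forall v, `|'d h y v| <= K * `|v|].
Proof.
move=> /nbhs_ex[d1 d10 D1] [hd hc].
have [d2 d20 D2] := (continuousE _ _).1 (differentiable_continuous hd) 1 ltr01.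
have [d3 d30 D3] : exists2 d : R, 0 < d & forall r, 0 < r -> r < d -> forall i y, `|y - x| < r ->
    `|'d h y (cvec B i)| <= `|'d h x (cvec B i)| + 1.
  apply: uniform_radius => i; have [r r0 Hr] := (continuousE _ _).1 (hc (cvec B i)) 1 ltr01.
  exists r => // s s0 sr y ys; rewrite -['d h y _](subrK ('d h x (cvec B i))).
  by apply: le_trans (ler_normD _ _) _; rewrite addrC lerD2l; apply: Hr; exact: lt_trans sr.
pose K1 := \sum_i (`|'d h x (cvec B i)| + 1).
have K10 : 0 <= K1 by apply: sumr_ge0 => i _; rewrite addr_ge0.
exists (K1 + (`|h x| + 1)); first by rewrite addr_ge0// addr_ge0.
exists (Num.min (Num.min d1 d2) (d3 / 2)); first by rewrite !lt_min d10 d20 divr_gt0.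
move=> y; rewrite !lt_min => /andP[/andP[y1 y2] y3]; split; first exact: D1.
  apply: ler_wpDl => //; rewrite -[h y](subrK (h x)) addrC.
  by apply: le_trans (ler_normD _ _) _; rewrite lerD2l; exact: D2.
move=> v; apply: (@le_trans _ _ (K1 * `|v|)); last by rewrite ler_wpM2r// lerDl addr_ge0.
rewrite {1}(coefK B v) linear_sum; apply: le_trans (ler_norm_sum _ _ _) _.
rewrite /K1 mulr_suml; apply: ler_sum => i _; rewrite linearZ_LR normrZ mulrC.
apply: ler_pM => //; last exact: coef_bound.
by apply: (D3 (d3 / 2)) => //; [rewrite divr_gt0|lra].
Qed.

Lemma c1_lipschitz (B : coordinates V) (BW : coordinates W) (f : V -> W) (x : V) :
  (\forall y \near x, differentiable f y) ->
  (forall v, {for x, continuous (fun y => 'd f y v)}) ->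
  exists2 K : R, 0 <= K & exists2 d : R, 0 < d & forall y z,
    `|y - x| < d -> `|z - x| < d -> `|f z - f y| <= K * `|z - y|.
Proof.
move=> fd fc; have [K K0 [d d0 D]] := c1_bounded B fd (conj (nbhs_singleton fd) fc).
exists (K * cbound BW); first by rewrite mulr_ge0// cbound_ge0.
exists d => // y z yd zd.
apply: (@lipschitz_segment R V B W BW f [set y | `|y - x| < d] K) => //; first by move=> u w r; exact: ball_convex.
by move=> w /D[].
Qed.

End C1Maps.

Lemma diff_near_eq (R : realType) (V W : normedModType R) (B : coordinates V) (f g : V -> W) x :
  differentiable f x -> (\forall y \near x, f y = g y) ->
  differentiable g x /\ forall v, 'd g x v = 'd f x v.
Proof.
move=> /differentiable_frechet fx /nbhs_ex[d d0 D].
by apply: (frechet_diff B); apply: frechet_eq fx; exists d.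
Qed.

Lemma diff_near_id (R : realType) (V : normedModType R) (B : coordinates V) (f : V -> V) x :
  (\forall y \near x, f y = y) -> forall v, 'd f x v = v.
Proof.
move=> /nbhs_ex[d d0 D] v; have [|_ ->//] := @frechet_diff R V B V f x idfun.
move=> e e0; exists d => // y /D ->; rewrite (D x) ?subrr ?normr0//.
by rewrite mulr_ge0// ltW.
Qed.

(** * Charts, transition maps and flow boxes *)

Section Manifold.
Context {R : realType} {V : normedModType R} {M : topologicalType}.
Variables (B : coordinates V) (A : atlas V M).
Notation mu := (@lebesgue_measure R).

(** First-order form of a manifold, satisfied by [Q] and by its product with the cost axis, so that
    one flow theory serves both. *)
Record c1_manifold : Prop := C1Manifold {
  c1_hausdorff : hausdorff_space M ;
  c1_dom_open : forall p, open (dom A p) ;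
  c1_dom_mem : forall p, dom A p p ;
  c1_image_open : forall p, open (chart A p @` dom A p) ;
  c1_chartK : forall p x, dom A p x -> inv_chart A p (chart A p x) = x ;
  c1_chart_cts : forall p x, dom A p x -> {for x, continuous (chart A p)} ;
  c1_inv_cts : forall p x, dom A p x ->
    {for chart A p x, continuous (inv_chart A p)} ;
  c1_transition : forall p p' x, dom A p x -> dom A p' x ->
    differentiable (chart A p' \o inv_chart A p) (chart A p x) /\
    forall v, {for chart A p x, continuous (fun y => 'd (chart A p' \o inv_chart A p) y v)} }.

Hypothesis hM : c1_manifold.

Definition transition p p' : V -> V := chart A p' \o inv_chart A p.

Lemma dom_nbhs p x : dom A p x -> nbhs x (dom A p).
Proof. by move=> px; apply: open_nbhs_nbhs; split => //; exact: c1_dom_open. Qed.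

Lemma chart_image_nbhs p x : dom A p x -> nbhs (chart A p x) (chart A p @` dom A p).
Proof. by move=> px; apply: open_nbhs_nbhs; split; [exact: c1_image_open|exists x]. Qed.

Lemma chart_image_inv p y : (chart A p @` dom A p) y ->
  dom A p (inv_chart A p y) /\ chart A p (inv_chart A p y) = y.
Proof. by move=> [x px <-]; rewrite c1_chartK. Qed.

Lemma near_inv_chart p x (P : M -> Prop) : dom A p x -> (\forall z \near x, P z) ->
  \forall y \near chart A p x, P (inv_chart A p y).
Proof. by move=> px xP; apply: (c1_inv_cts hM px); rewrite c1_chartK. Qed.

Lemma near_chart p x (P : V -> Prop) : dom A p x -> (\forall y \near chart A p x, P y) ->
  \forall z \near x, P (chart A p z).
Proof. by move=> px xP; exact: (c1_chart_cts hM px). Qed.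

Lemma near_dom p x : dom A p x -> \forall y \near chart A p x,
  dom A p (inv_chart A p y) /\ chart A p (inv_chart A p y) = y.
Proof. by move=> /chart_image_nbhs; apply: filterS => y /chart_image_inv. Qed.

Lemma near_dom2 p p' x : dom A p x -> dom A p' x -> \forall y \near chart A p x,
  [/\ dom A p (inv_chart A p y), chart A p (inv_chart A p y) = y & dom A p' (inv_chart A p y)].
Proof.
move=> px p'x; have := near_inv_chart px (dom_nbhs p'x).
by move: (near_dom px); apply: filterS2 => y [].
Qed.

Lemma transition_lipschitz p p' x : dom A p x -> dom A p' x ->
  exists2 K : R, 0 <= K & exists2 d : R, 0 < d & forall y z,
    `|y - chart A p x| < d -> `|z - chart A p x| < d ->
    `|transition p p' z - transition p p' y| <= K * `|z - y|.
Proof.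
move=> px p'x; apply: (c1_lipschitz B B).
  apply: filterS (near_dom2 px p'x) => y [yp yE yp'].
  by rewrite -yE; have [] := c1_transition hM yp yp'.
by have [] := c1_transition hM px p'x.
Qed.

Lemma transition_chain p p' p'' x v : dom A p x -> dom A p' x -> dom A p'' x ->
  'd (transition p' p'') (chart A p' x) ('d (transition p p') (chart A p x) v) =
  'd (transition p p'') (chart A p x) v.
Proof.
move=> px p'x p''x; have [d1 _] := c1_transition hM px p'x.
have [d2 _] := c1_transition hM p'x p''x.
have E : transition p p' (chart A p x) = chart A p' x by rewrite /transition /= c1_chartK.
have := diff_comp (f := transition p p') (g := transition p' p'') d1.
rewrite E => /(_ d2) /(congr1 (fun h : V -> V => h v)) /= <-.
apply/esym; apply: (diff_near_eq B _ _).2; first by apply: differentiable_comp; rewrite -?/(transition p p') ?E.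
apply: filterS (near_dom2 px p'x) => y [yp yE yp'].
by rewrite /transition /= c1_chartK.
Qed.

Lemma transition_id p x v : dom A p x -> 'd (transition p p) (chart A p x) v = v.
Proof.
move=> px; apply: (diff_near_id B); apply: filterS (near_dom px) => y [_ yE].
by rewrite /transition /=.
Qed.

Lemma coord_changeE x p v : coord_change A x p v = 'd (transition x p) (chart A x x) v.
Proof. by []. Qed.

Lemma coord_changeK x p v : dom A p x ->
  'd (transition p x) (chart A p x) (coord_change A x p v) = v.
Proof.
move=> px; have xx := c1_dom_mem hM x.
by rewrite coord_changeE (transition_chain v xx px xx) transition_id.
Qed.

Lemma coord_changeVK x p v : dom A p x ->
  coord_change A x p ('d (transition p x) (chart A p x) v) = v.
Proof.
move=> px; have xx := c1_dom_mem hM x.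
by rewrite coord_changeE (transition_chain v px xx px) transition_id.
Qed.

Lemma local_repE (Y : M -> V) p x : dom A p x ->
  local_rep A Y p (chart A p x) = coord_change A x p (Y x).
Proof. by move=> px; rewrite /local_rep c1_chartK. Qed.

Lemma der_transition (c : R -> M) t v p p' :
  (exists2 d : R, 0 < d & forall s, `|s - t| < d -> dom A p (c s)) -> dom A p' (c t) ->
  der (chart A p \o c) t v ->
  der (chart A p' \o c) t ('d (transition p p') (chart A p (c t)) v).
Proof.
move=> [d d0 D] p't dv; have pt : dom A p (c t) by apply: D; rewrite subrr normr0.
have [dT _] := c1_transition hM pt p't.
have [K K0 HK] := linear_bound B ('d (transition p p') (chart A p (c t))).
have := der_frechet K0 HK dv (differentiable_frechet dT).
apply: der_eq; exists d => // s sd /=; rewrite c1_chartK//; exact: D.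
Qed.

Section IntegralCurves.
Variables (T : R) (O : set (R * M)) (X : R -> M -> V).

(** The conditions of [caratheodory] with measurability read in the coordinate system [B], which
    also gives them a meaning on the model space of the extended atlas. *)
Definition caratheodory_field :=
  forall t0 p, 0 <= t0 <= T -> O (t0, p) ->
  exists e C : R, 0 < e /\
    let I := [set t | 0 <= t <= T /\ `|t - t0| < e] in
    let N := ball (chart A p p) e in
    let Xp t := local_rep A (X t) p in
    [/\ N `<=` chart A p @` dom A p,
        forall t x, I t -> N x -> O (t, inv_chart A p x),
        forall t x, I t -> N x ->
          [/\ `|Xp t x| <= C,
              differentiable (Xp t) x,
              forall v, `|'d (Xp t) x v| <= C * `|v| &
              forall v, {for x, continuous (fun y => 'd (Xp t) y v)}] &
        forall x, N x -> vector_measurable B I (fun t => Xp t x) /\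
          forall v, vector_measurable B I (fun t => 'd (Xp t) x v)].

Hypothesis hX : caratheodory_field.

(** A cylinder around [(t0, p)] in the chart of [p]. [fb_Lr] is the smallness asked for by [picard]
    and [gronwall]; [fb_Cr] keeps a solution within [rho / 4] of its starting point during the time
    window. *)
Record flow_box (t0 : R) (p : M) (r rho C L : R) : Prop := FlowBox {
  fb_r : 0 < r ; fb_rho : 0 < rho ; fb_C : 0 <= C ; fb_L : 0 <= L ;
  fb_Lr : L * (2 * r) <= 2^-1 ;
  fb_Cr : C * (2 * r) <= rho / 4 ;
  fb_image : forall x, `|x - chart A p p| < rho -> (chart A p @` dom A p) x ;
  fb_O : forall t x, 0 <= t <= T -> `|t - t0| < r -> `|x - chart A p p| < rho ->
    O (t, inv_chart A p x) ;
  fb_bound : forall t x, 0 <= t <= T -> `|t - t0| < r -> `|x - chart A p p| < rho ->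
    `|local_rep A (X t) p x| <= C ;
  fb_diff : forall t x, 0 <= t <= T -> `|t - t0| < r -> `|x - chart A p p| < rho ->
    differentiable (local_rep A (X t) p) x ;
  fb_diff_bound : forall t x v, 0 <= t <= T -> `|t - t0| < r -> `|x - chart A p p| < rho ->
    `|'d (local_rep A (X t) p) x v| <= L * `|v| ;
  fb_diff_cts : forall t x v, 0 <= t <= T -> `|t - t0| < r -> `|x - chart A p p| < rho ->
    {for x, continuous (fun y => 'd (local_rep A (X t) p) y v)} ;
  fb_lip : forall t x y, 0 <= t <= T -> `|t - t0| < r ->
    `|x - chart A p p| < rho -> `|y - chart A p p| < rho ->
    `|local_rep A (X t) p y - local_rep A (X t) p x| <= L * `|y - x| ;
  fb_meas : forall a b x, 0 <= a -> t0 - r < a -> b <= T -> b < t0 + r ->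
    `|x - chart A p p| < rho -> vector_measurable B `[a, b] (fun t => local_rep A (X t) p x) ;
  fb_diff_meas : forall a b x v, 0 <= a -> t0 - r < a -> b <= T -> b < t0 + r ->
    `|x - chart A p p| < rho -> vector_measurable B `[a, b] (fun t => 'd (local_rep A (X t) p) x v) }.

Lemma flow_box_exists t0 p : 0 <= t0 <= T -> O (t0, p) -> exists r rho C L, flow_box t0 p r rho C L.
Proof.
move=> t0T Op; have [e [C [e0 [eN eO eX em]]]] := hX t0T Op.
(* [L] has to dominate both the derivative bound [C'] and the Lipschitz constant [C' * cbound B]
   given by [lipschitz_segment]. *)
pose C' : R := `|C|; pose L : R := C' * (cbound B + 1).
have cb := cbound_ge0 B.
have C'0 : 0 <= C' by exact: normr_ge0.
have L0 : 0 <= L by rewrite mulr_ge0// addr_ge0.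
(* Time intervals in the box have length below [2 * r], whence the factors 4 and 8; the [+ 1] cover
   [L = 0] and [C' = 0]. *)
pose r := Num.min e (Num.min (4 * (L + 1))^-1 (e / (8 * (C' + 1)))).
have L1 : 0 < 4 * (L + 1) by rewrite mulr_gt0// ltr_wpDl.
have C1 : 0 < 8 * (C' + 1) by rewrite mulr_gt0// ltr_wpDl.
have r0 : 0 < r by rewrite !lt_min e0 invr_gt0 L1 divr_gt0.
have re : r <= e by rewrite /r ge_min lexx.
have rL : r <= (4 * (L + 1))^-1 by rewrite /r !ge_min lexx orbT.
have rC : r <= e / (8 * (C' + 1)) by rewrite /r !ge_min lexx !orbT.
have nb x : `|x - chart A p p| < e -> ball (chart A p p) e x.
  by rewrite -ball_normE /= distrC.
have nI t : `|t - t0| < r -> `|t - t0| < e by move=> /lt_le_trans; exact.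
have bd t x v : 0 <= t <= T -> `|t - t0| < r -> `|x - chart A p p| < e ->
    `|'d (local_rep A (X t) p) x v| <= C' * `|v|.
  move=> tT tr xp; have [_ _ H _] := eX t x (conj tT (nI _ tr)) (nb _ xp).
  by apply: le_trans (H v) _; rewrite ler_wpM2r// ler_norm.
have mm (a b : R) : 0 <= a -> t0 - r < a -> b <= T -> b < t0 + r ->
   `[a, b]%classic `<=` [set t | 0 <= t <= T /\ `|t - t0| < e].
  move=> a0 ar bT br t /=; rewrite in_itv /= => /andP[at_ tb]; split.
    by rewrite (le_trans a0)//= (le_trans tb).
  by apply: nI; rewrite ltr_norml; apply/andP; split; lra.
have mI : measurable ([set t | 0 <= t <= T /\ `|t - t0| < e] :
    set (caratheodory_type (@wlength R idfun)^*%mu)).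
  rewrite (_ : [set t | _] = `[0, T] `&` `]t0 - e, t0 + e[).
    by apply: measurableI; exact: measurable_itv_cara.
  by apply/seteqP; split=> t /=; rewrite !in_itv /= ltr_distl.
exists r, e, C', L; split => //.
- apply: (@le_trans _ _ (L * (2 * (4 * (L + 1))^-1))).
    by rewrite ler_wpM2l// ler_wpM2l.
  by rewrite mulrA ler_pdivrMr//; lra.
- apply: (@le_trans _ _ (C' * (2 * (e / (8 * (C' + 1)))))).
    by rewrite ler_wpM2l// ler_wpM2l.
  by rewrite !mulrA ler_pdivrMr//; have := mulr_ge0 C'0 (ltW e0); lra.
- by move=> x xp; exact: eN (nb _ xp).
- by move=> t x tT tr xp; exact: eO (conj tT (nI _ tr)) (nb _ xp).
- move=> t x tT tr xp; have [H _ _ _] := eX t x (conj tT (nI _ tr)) (nb _ xp).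
  by apply: le_trans H _; exact: ler_norm.
- by move=> t x tT tr xp; have [] := eX t x (conj tT (nI _ tr)) (nb _ xp).
- move=> t x v tT tr xp; apply: le_trans (bd _ _ v tT tr xp) _.
  by rewrite ler_wpM2r// /L ler_peMr// lerDr.
- by move=> t x v tT tr xp; have [] := eX t x (conj tT (nI _ tr)) (nb _ xp).
- move=> t x y tT tr xp yp.
  apply: (@le_trans _ _ (C' * cbound B * `|y - x|)); last first.
    by rewrite ler_wpM2r// /L ler_wpM2l// lerDl.
  apply: (@lipschitz_segment R V B V B _ [set y | `|y - chart A p p| < e] C') => //.
    by move=> u w s /=; exact: ball_convex.
  move=> w /= wp; split; last by move=> v; exact: bd.
  by have [] := eX t w (conj tT (nI _ tr)) (nb _ wp).
- move=> a b x a0 ar bT br xp i; have [H _] := em _ (nb _ xp).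
  exact: (measurable_funS mI (mm _ _ a0 ar bT br) (H i)).
- move=> a b x v a0 ar bT br xp i; have [_ H] := em _ (nb _ xp).
  exact: (measurable_funS mI (mm _ _ a0 ar bT br) (H v i)).
Qed.

(** The curve is read in one fixed chart over the whole interval, where the theory in normed spaces
    applies, whereas [integral_curve] uses the moving chart centred at [c t]. *)
Definition chart_solution (p : M) (a b : R) (c : R -> M) :=
  [/\ forall t, a <= t <= b -> dom A p (c t) /\ O (t, c t),
      lip_on a b (chart A p \o c) &
      {ae mu, forall t, a < t < b ->
        der (chart A p \o c) t (local_rep A (X t) p (chart A p (c t)))}].

Lemma chart_solution_near p a b c t : chart_solution p a b c -> a <= t <= b ->
  forall P : M -> Prop, (\forall x \near c t, P x) ->
  exists2 e : R, 0 < e & forall s, a <= s <= b -> `|s - t| <= e -> P (c s).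
Proof.
move=> [cd cl _] tab P cP; have [dt _] := cd _ tab.
have /nbhs_ex[d d0 D] := near_inv_chart dt cP.
have [K K0 HK] := lip_on_gt0 cl.
exists (d / (2 * K)); first by rewrite divr_gt0// mulr_gt0.
move=> s sab sd; rewrite -(c1_chartK hM (cd _ sab).1); apply: D.
apply: le_lt_trans (HK _ _ tab sab) _.
apply: (@le_lt_trans _ _ (K * (d / (2 * K)))); first by rewrite ler_wpM2l// ltW.
exact: mul_div2_lt.
Qed.

(** The transition from the fixed chart to the one centred at [c t] is Lipschitz near that point,
    which keeps absolute continuity, and its derivative carries the velocity along. *)
Lemma chart_solution_integral_curve p a b c : chart_solution p a b c ->
  integral_curve A O X a b c.
Proof.
move=> cs; have [cd cl cder] := cs; split.
- by move=> t /cd[].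
- move=> t tab; have [dt _] := cd _ tab.
  have ctt := c1_dom_mem hM (c t).
  have [e1 e10 E1] := chart_solution_near cs tab (dom_nbhs ctt).
  have [K K0 [d d0 HK]] := transition_lipschitz dt ctt.
  have [D D0 HD] := lip_on_gt0 cl.
  pose e := Num.min e1 (d / (2 * D)).
  have e0 : 0 < e by rewrite lt_min e10 divr_gt0// mulr_gt0.
  have ee1 : e <= e1 by rewrite /e ge_min lexx.
  have ed : e <= d / (2 * D) by rewrite /e ge_min lexx orbT.
  exists e => //=; split.
    by move=> s [sab se]; apply: E1 => //; exact: le_trans ee1.
  have near s : a <= s <= b -> `|s - t| <= e -> `|chart A p (c s) - chart A p (c t)| < d.
    move=> sab se; apply: le_lt_trans (HD _ _ tab sab) _.
    apply: (@le_lt_trans _ _ (D * (d / (2 * D)))); first by rewrite ler_wpM2l ?(ltW D0)// (le_trans se).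
    exact: mul_div2_lt.
  have tE s : a <= s <= b -> chart A (c t) (c s) = transition p (c t) (chart A p (c s)).
    by move=> sab; rewrite /transition /= c1_chartK//; exact: (cd _ sab).1.
  move=> eps eps0; exists (eps / (K * D + 1)); first by rewrite divr_gt0// ltr_wpDl// mulr_ge0// ltW.
  move=> k x y xy _ sxy; apply: (@le_lt_trans _ _ (\sum_(i < k) (K * D + 1) * (y i - x i))).
    apply: ler_sum => i _; have [[xab xe] [yab ye] xyi] := xy i.
    rewrite /= !tE//; apply: le_trans (HK _ _ (near _ xab xe) (near _ yab ye)) _.
    apply: (@le_trans _ _ (K * (D * (y i - x i)))).
      rewrite ler_wpM2l//; have := HD _ _ xab yab.
      by rewrite ger0_norm ?subr_ge0.
    by rewrite mulrA ler_wpM2r ?subr_ge0// lerDl.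
  by rewrite -mulr_sumr mulrC -ltr_pdivlMr// ltr_wpDl// mulr_ge0// ltW.
- apply: ae_closed_interval; apply: ae_impl cder => t ct tab'.
  have /andP[/ltW at_ /ltW tb] := tab'.
  have [dt _] := cd t (introT andP (conj at_ tb)).
  apply/is_derive_der; have {}ct := ct tab'.
  have H := der_transition _ (c1_dom_mem hM (c t)) ct.
  rewrite -[X t (c t)](coord_changeK (X t (c t)) dt) -local_repE//; apply: H.
  by have [d d0 H] := near_interior tab'; exists d => // s /H /cd[].
Qed.

End IntegralCurves.

End Manifold.

(** * Uniqueness and concatenation of integral curves *)

Section IntegralCurveTheory.
Context {R : realType} {V : normedModType R} {M : topologicalType}.
Variables (B : coordinates V) (A : atlas V M).
Notation mu := (@lebesgue_measure R).
Hypothesis hM : c1_manifold A.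
Variables (T : R) (O : set (R * M)) (X : R -> M -> V).
Hypothesis hX : caratheodory_field B A T O X.

Lemma abs_continuous_onS (I J : set R) (h : R -> V) : J `<=` I ->
  abs_continuous_on I h -> abs_continuous_on J h.
Proof.
move=> JI hI e e0; have [d d0 D] := hI e e0; exists d => // k a b ab.
by apply: D => i; have [/JI ? /JI ? ?] := ab i.
Qed.

Lemma abs_continuous_on_close (I : set R) (h : R -> V) e : abs_continuous_on I h -> 0 < e ->
  exists2 d : R, 0 < d & forall s t, I s -> I t -> `|s - t| < d -> `|h s - h t| < e.
Proof.
move=> hI e0; have [d d0 D] := hI e e0; exists d => // s t; wlog st : s t / s <= t.
  move=> W Is It sd; have [st|ts] := leP s t; first exact: W.
  by rewrite distrC; apply: W => //; [exact: ltW|rewrite distrC].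
move=> Is It sd; have := D 1%N (fun=> s) (fun=> t).
rewrite !big_ord1 distrC; apply=> //; first by move=> i j; rewrite !ord1 eqxx.
by move: sd; rewrite distrC ger0_norm ?subr_ge0.
Qed.

Lemma integral_curve_dom a b c t : integral_curve A O X a b c -> a <= t <= b -> O (t, c t).
Proof. by move=> [cO _ _]; exact: cO. Qed.

Lemma integral_curve_restrict a b a' b' c : a <= a' -> b' <= b ->
  integral_curve A O X a b c -> integral_curve A O X a' b' c.
Proof.
move=> aa bb [cO cac cv].
have sub t : a' <= t <= b' -> a <= t <= b by move=> /andP[? ?]; rewrite (le_trans aa)//= (le_trans _ bb).
split; first by move=> t /sub; exact: cO.
- move=> t /sub tab; have [e e0 /= [ed eac]] := cac _ tab; exists e => //=; split.
    by move=> s [/sub sab se]; exact: ed.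
  by apply: abs_continuous_onS eac => s /= [/sub sab se].
- by apply: ae_impl cv => t ct /sub; exact: ct.
Qed.

Lemma integral_curve_near a b c t : integral_curve A O X a b c -> a <= t <= b ->
  forall P : M -> Prop, (\forall x \near c t, P x) ->
  exists2 e : R, 0 < e & forall s, a <= s <= b -> `|s - t| < e -> P (c s).
Proof.
move=> [_ cac _] tab P cP; have [e e0 /= [ed eac]] := cac _ tab.
have [d d0 D] := nbhs_ex (near_inv_chart hM (c1_dom_mem hM (c t)) cP).
have [d' d'0 D'] := abs_continuous_on_close eac d0.
exists (Num.min e d'); first by rewrite lt_min e0.
move=> s sab; rewrite lt_min => /andP[/ltW se sd].
rewrite -(c1_chartK hM (ed s (conj sab se))); apply: D; apply: D' => //=.
by split=> //; rewrite subrr normr0 ltW.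
Qed.

(** In a flow box the velocity is bounded by [C], so the absolutely continuous chart expression is
    in fact [C]-Lipschitz. *)
Lemma local_chart_solution a b c t0 r rho C L eps : integral_curve A O X a b c ->
  0 <= a -> b <= T -> a <= t0 <= b -> flow_box B A T O X t0 (c t0) r rho C L -> 0 < eps ->
  exists2 e : R, 0 < e & forall a' b', a <= a' -> a' <= b' -> b' <= b -> t0 - e < a' -> b' < t0 + e ->
    chart_solution A O X (c t0) a' b' c /\
    forall t, a' <= t <= b' -> `|chart A (c t0) (c t) - chart A (c t0) (c t0)| < eps.
Proof.
move=> [cO cac cv] a0 bT t0ab bx eps0; set p := c t0.
have [e1 e10 /= [ed eac]] := cac _ t0ab.
have [d d0 D] := abs_continuous_on_close eac eps0.
have [d' d'0 D'] := abs_continuous_on_close eac (fb_rho bx).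
pose e := Num.min (Num.min e1 r) (Num.min d d').
have e0 : 0 < e by rewrite !lt_min e10 (fb_r bx) d0.
exists e => // a' b' aa ab' bb e1a e1b.
have near t : a' <= t <= b' -> [/\ a <= t <= b, `|t - t0| <= e1, `|t - t0| < r, `|t - t0| < d & `|t - t0| < d'].
  move=> /andP[at_ tb]; have : `|t - t0| < e by rewrite ltr_norml; apply/andP; split; lra.
  rewrite !lt_min => /andP[/andP[/ltW ? ?] /andP[? ?]].
  by split=> //; rewrite (le_trans aa)//= (le_trans tb).
have I0 : a <= t0 <= b /\ `|t0 - t0| <= e1 by split=> //; rewrite subrr normr0 ltW.
have xr t : a' <= t <= b' -> `|chart A p (c t) - chart A p p| < rho.
  by move=> /near[h1 h2 h3 h4 h5]; exact: (D' _ _ (conj h1 h2) I0 h5).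
have dm t : a' <= t <= b' -> dom A p (c t).
  by move=> /near[h1 h2 _ _ _]; exact: ed.
have hder : {ae mu, forall t, a' < t < b' ->
    der (chart A p \o c) t (local_rep A (X t) p (chart A p (c t)))}.
  apply: ae_impl cv => t ct /andP[at_ tb].
  have tab' : a' <= t <= b' by rewrite !ltW.
  have [tab _ _ _ _] := near _ tab'.
  have /is_derive_der dct := ct tab.
  rewrite (local_repE hM _ (dm _ tab')) coord_changeE.
  apply: der_transition dct => //; last exact: dm.
  have [et et0 /= [etd _]] := cac _ tab.
  have [dt dt0 Dt] := near_interior (introT andP (conj at_ tb)).
  exists (Num.min et dt); first by rewrite lt_min et0.
  move=> s; rewrite lt_min => /andP[/ltW se /Dt/near[sab _ _ _ _]].
  exact: etd.
split; last by move=> t /near[h1 h2 _ h4 _]; exact: (D _ _ (conj h1 h2) I0 h4).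
split=> //; first by move=> t tab; split; [exact: dm|apply: cO; have [] := near _ tab].
exists C; apply: lipschitz_ordered => s t as_ st tb.
apply: ae_derivative_bound => //; first exact: fb_C bx.
  apply: abs_continuous_onS eac => z /= /andP[sz zt].
  by have [|h1 h2 _ _ _] := near z; first by rewrite (le_trans as_)//= (le_trans zt).
apply: ae_impl hder => z hz /andP[sz zt].
have zab : a' < z < b' by rewrite (le_lt_trans as_)//= (lt_le_trans zt).
have zab' : a' <= z <= b' by case/andP: zab => ? ?; rewrite !ltW.
exists (local_rep A (X z) p (chart A p (c z))); first exact: hz.
have [/andP[h1 h2] _ h3 _ _] := near _ zab'.
apply: (fb_bound bx) => //; last exact: xr.
by rewrite (le_trans a0)//= (le_trans h2).
Qed.

Lemma chart_solution_solution p a b c S : chart_solution A O X p a b c ->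
  (forall t, a <= t <= b -> S (chart A p (c t))) ->
  solution (fun t => local_rep A (X t) p) a b S (chart A p \o c).
Proof. by move=> [cd cl cv] cS; split. Qed.

(** The additive property is that agreement at one time of an interval implies agreement on all of
    it. Around a time where the curves differ, Hausdorff separation rules out agreement nearby;
    around a time where they agree, both are solutions in one flow box. *)
Lemma integral_curve_uniq a b c c' tau : 0 <= a -> b <= T ->
  integral_curve A O X a b c -> integral_curve A O X a b c' ->
  a <= tau <= b -> c tau = c' tau -> forall t, a <= t <= b -> c t = c' t.
Proof.
move=> a0 bT cs c's tauab E.
have ab : a <= b by case/andP: tauab => /le_trans h /h.
suff : (exists2 s, a <= s <= b & c s = c' s) -> forall t, a <= t <= b -> c t = c' t.
  by apply; exists tau.
apply: (@cousin R (fun x y => (exists2 s, x <= s <= y & c s = c' s) ->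
   forall t, x <= t <= y -> c t = c' t)) => //.
- move=> x y z _ xy yz _ Hxy Hyz [s /andP[xs sz] cE] t /andP[xt tz].
  have Ey : c y = c' y.
    have [sy|ys] := leP s y.
      by apply: Hxy; [exists s; rewrite ?xs|rewrite xy lexx].
    by apply: Hyz; [exists s; rewrite ?(ltW ys)|rewrite lexx yz].
  have [ty|yt] := leP t y.
    by apply: Hxy; [exists y; rewrite ?xy ?lexx|rewrite xt].
  by apply: Hyz; [exists y; rewrite ?yz ?lexx|rewrite ltW].
- move=> t0 t0ab; have [E0|N0] := pselect (c t0 = c' t0); last first.
    have [[U1 U2] /= [U1c U2c'] [oU1 oU2 U12]] : exists2 UV : set M * set M,
        c t0 \in UV.1 /\ c' t0 \in UV.2 & [/\ open UV.1, open UV.2 & UV.1 `&` UV.2 == set0].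
      by have := c1_hausdorff hM; rewrite open_hausdorff; apply; apply/eqP.
    have [e1 e10 H1] := integral_curve_near cs t0ab (open_nbhs_nbhs (conj oU1 (set_mem U1c))).
    have [e2 e20 H2] := integral_curve_near c's t0ab (open_nbhs_nbhs (conj oU2 (set_mem U2c'))).
    exists (Num.min e1 e2); first by rewrite lt_min e10.
    move=> x y ax xt ty yb; rewrite lt_min => /andP[h1 h2] [s /andP[xs sy] Es].
    exfalso; have sab : a <= s <= b by rewrite (le_trans ax)//= (le_trans sy).
    have h3 : (U1 `&` U2) (c s).
      split; first by apply: H1 => //; rewrite ltr_norml; apply/andP; split; lra.
      by rewrite Es; apply: H2 => //; rewrite ltr_norml; apply/andP; split; lra.
    by rewrite (eqP U12) in h3.
  have t0T : 0 <= t0 <= T by case/andP: t0ab => h1 h2; rewrite (le_trans a0)//= (le_trans h2).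
  have [r [rho [C [L bx]]]] := flow_box_exists hX t0T (integral_curve_dom cs t0ab).
  have bx' := bx; rewrite E0 in bx'.
  have [e1 e10 H1] := local_chart_solution cs a0 bT t0ab bx (fb_rho bx).
  have [e2 e20 H2] := local_chart_solution c's a0 bT t0ab bx' (fb_rho bx).
  exists (Num.min (Num.min e1 e2) r); first by rewrite !lt_min e10 e20 (fb_r bx).
  move=> x y ax xt ty yb; rewrite !lt_min => /andP[/andP[h1 h2] hr] [s xsy Es] t xty.
  have xy : x <= y by exact: le_trans ty.
  have [||s1 S1] := H1 x y ax xy yb; [lra|lra|].
  have [||s2 S2] := H2 x y ax xy yb; [lra|lra|].
  rewrite -E0 in s2 S2.
  pose S := [set x | `|x - chart A (c t0) (c t0)| < rho].
  have sol1 := chart_solution_solution (S := S) s1 S1.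
  have sol2 := chart_solution_solution (S := S) s2 S2.
  have Lb : L * (y - x) <= 2^-1.
    by apply: le_trans (fb_Lr bx); rewrite ler_wpM2l ?(fb_L bx)//; lra.
  have XL w u v : x <= w <= y -> `|u - chart A (c t0) (c t0)| < rho -> `|v - chart A (c t0) (c t0)| < rho ->
     `|local_rep A (X w) (c t0) v - local_rep A (X w) (c t0) u| <= L * `|v - u|.
    move=> /andP[xw wy]; apply: (fb_lip bx).
      by case/andP: t0T => ? ?; apply/andP; split; lra.
    by rewrite ltr_norml; apply/andP; split; lra.
  have := solution_uniq xy (fb_L bx) Lb XL sol1 sol2 xsy _ xty.
  rewrite /= Es => /(_ erefl) Et.
  have [p1 _] := (let: And3 h _ _ := s1 in h) t xty.
  have [p2 _] := (let: And3 h _ _ := s2 in h) t xty.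
  by rewrite -[LHS](c1_chartK hM p1) -[RHS](c1_chartK hM p2); congr (inv_chart _ _ _).
Qed.

Lemma lip_on_glue (a b c : R) (f g : R -> V) : f b = g b -> lip_on a b f -> lip_on b c g ->
  lip_on a c (fun t => if t <= b then f t else g t).
Proof.
move=> E /lip_on_gt0[C C0 HC] /lip_on_gt0[D D0 HD]; exists (C + D).
apply: lipschitz_ordered => s t as_ st tc.
have at_ := le_trans as_ st; have sc := le_trans st tc.
have CD (x : R) : 0 <= x -> C * x <= (C + D) * x /\ D * x <= (C + D) * x.
  by move=> x0; split; rewrite ler_wpM2r// ?lerDl ?lerDr ltW.
have ts0 : 0 <= t - s by rewrite subr_ge0.
have [tb|bt] := leP t b.
  rewrite (le_trans st tb); apply: le_trans (HC _ _ _ _) _.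
  - by rewrite as_ (le_trans st).
  - by rewrite at_.
  - by rewrite ger0_norm//; exact: (CD _ ts0).1.
have [sb|bs] := leP s b.
  have -> : g t - f s = (g t - g b) + (f b - f s) by rewrite E; zmod.
  apply: le_trans (ler_normD _ _) _.
  have h1 : `|g t - g b| <= D * (t - b).
    apply: le_trans (HD _ _ _ _) _; rewrite ?lexx ?(ltW bt) ?(le_trans (ltW bt))//.
    by rewrite ger0_norm// subr_ge0 ltW.
  have h2 : `|f b - f s| <= C * (b - s).
    apply: le_trans (HC _ _ _ _) _; rewrite ?lexx ?as_ ?(le_trans as_)//.
    by rewrite ger0_norm// subr_ge0.
  have h3 := (CD (t - b) _).2; have h4 := (CD (b - s) _).1.
  have {}h3 : D * (t - b) <= (C + D) * (t - b) by apply: h3; lra.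
  have {}h4 : C * (b - s) <= (C + D) * (b - s) by apply: h4; lra.
  lra.
apply: le_trans (HD _ _ _ _) _; rewrite ?(ltW bs) ?(ltW bt) ?sc ?tc//.
by rewrite ger0_norm//; exact: (CD _ ts0).2.
Qed.

Lemma integral_curve_glue (a b d : R) (c1 c2 : R -> M) : 0 <= a -> d <= T -> a <= b -> b <= d ->
  integral_curve A O X a b c1 -> integral_curve A O X b d c2 -> c1 b = c2 b ->
  integral_curve A O X a d (fun t => if t <= b then c1 t else c2 t).
Proof.
move=> a0 dT ab bd i1 i2 E; pose c t := if t <= b then c1 t else c2 t.
have cl s : s <= b -> c s = c1 s by rewrite /c => ->.
have cr s : b <= s -> c s = c2 s.
  move=> bs; rewrite /c; have [sb|//] := leP s b.
  by have -> : s = b by apply/eqP; rewrite eq_le sb.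
have [c1O c1ac c1v] := i1; have [c2O c2ac c2v] := i2.
rewrite -/c; split.
- move=> t /andP[at_ td]; have [tb|/ltW bt] := leP t b.
    by rewrite cl//; apply: c1O; rewrite at_.
  by rewrite cr//; apply: c2O; rewrite bt.
- move=> t /andP[at_ td]; have [tb|bt|tb] := ltgtP t b.
  + have [e e0 /= [ed eac]] := c1ac t (introT andP (conj at_ (ltW tb))).
    exists (Num.min e ((b - t) / 2)) => /=; first by rewrite lt_min e0 divr_gt0// subr_gt0.
    have sub s : (a <= s <= d) /\ `|s - t| <= Num.min e ((b - t) / 2) ->
        (a <= s <= b /\ `|s - t| <= e) /\ s <= b.
      rewrite le_min => -[/andP[as_ sd] /andP[-> /ler_normlP[_ h]]].
      have sb : s <= b by lra.
      by rewrite as_ sb.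
    rewrite cl ?ltW//; split; first by move=> s /sub[h sb]; rewrite cl//; exact: ed.
    move=> eps eps0; have [dl dl0 D] := eac eps eps0; exists dl => // k x y xy xyd xys.
    rewrite (eq_bigr (fun i => `|(chart A (c1 t) \o c1) (y i) - (chart A (c1 t) \o c1) (x i)|)); last first.
      by move=> i _; have [/sub[_ h1] /sub[_ h2] _] := xy i; rewrite /= !cl.
    by apply: D => // i; have [/sub[h1 _] /sub[h2 _] h3] := xy i.
  + have [e e0 /= [ed eac]] := c2ac t (introT andP (conj (ltW bt) td)).
    exists (Num.min e ((t - b) / 2)) => /=; first by rewrite lt_min e0 divr_gt0// subr_gt0.
    have sub s : (a <= s <= d) /\ `|s - t| <= Num.min e ((t - b) / 2) ->
        (b <= s <= d /\ `|s - t| <= e) /\ b <= s.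
      rewrite le_min => -[/andP[as_ sd] /andP[-> /ler_normlP[h _]]].
      have sb : b <= s by lra.
      by rewrite sd sb.
    rewrite cr ?ltW//; split; first by move=> s /sub[h sb]; rewrite cr//; exact: ed.
    move=> eps eps0; have [dl dl0 D] := eac eps eps0; exists dl => // k x y xy xyd xys.
    rewrite (eq_bigr (fun i => `|(chart A (c2 t) \o c2) (y i) - (chart A (c2 t) \o c2) (x i)|)); last first.
      by move=> i _; have [/sub[_ h1] /sub[_ h2] _] := xy i; rewrite /= !cr.
    by apply: D => // i; have [/sub[h1 _] /sub[h2 _] h3] := xy i.
  (* At the joint neither piece alone gives absolute continuity on both sides. In the chart centred
     at [c b] both are Lipschitz, and so is the glued curve. *)
  + rewrite {t at_ td}tb; have bab : a <= b <= b by rewrite ab lexx.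
    have bbd : b <= b <= d by rewrite bd lexx.
    have bT : 0 <= b <= T by rewrite (le_trans a0)//= (le_trans bd).
    have [r [rho [C [L bx]]]] := flow_box_exists hX bT (c1O _ bab).
    have bx' := bx; rewrite E in bx'.
    have [e1 e10 H1] := local_chart_solution i1 a0 (le_trans bd dT) bab bx ltr01.
    have [e2 e20 H2] := local_chart_solution i2 (le_trans a0 ab) dT bbd bx' ltr01.
    pose e := Num.min e1 e2; have e0 : 0 < e by rewrite lt_min e10.
    have ee1 : e <= e1 by rewrite /e ge_min lexx.
    have ee2 : e <= e2 by rewrite /e ge_min lexx orbT.
    pose a' := Num.max a (b - e / 2); pose d' := Num.min d (b + e / 2).
    have a'b : a' <= b by rewrite /a' ge_max ab lerBlDr lerDl divr_ge0// ltW.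
    have bd' : b <= d' by rewrite /d' le_min bd lerDl divr_ge0// ltW.
    have aa' : a <= a' by rewrite /a' le_max lexx.
    have d'd : d' <= d by rewrite /d' ge_min lexx.
    have a'e : b - e / 2 <= a' by rewrite /a' le_max lexx orbT.
    have d'e : d' <= b + e / 2 by rewrite /d' ge_min lexx orbT.
    have [||[cd1 cl1 _] _] := H1 a' b aa' a'b (lexx _); [lra|lra|].
    have [||[cd2 cl2 _] _] := H2 b d' (lexx _) bd' d'd; [lra|lra|].
    rewrite -E in cd2 cl2.
    have sub s : (a <= s <= d) /\ `|s - b| <= e / 2 -> a' <= s <= d'.
      move=> [/andP[as_ sd] /ler_normlP[h1 h2]]; rewrite /a' /d' ge_max le_min as_ sd /=.
      by apply/andP; split; lra.
    exists (e / 2) => /=; first by rewrite divr_gt0.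
    rewrite cl//; split.
      move=> s /sub/andP[as_ sd]; have [sb|/ltW bs] := leP s b.
        by rewrite cl//; apply: (cd1 _ _).1; rewrite as_.
      by rewrite cr//; apply: (cd2 _ _).1; rewrite bs.
    apply: (@lip_on_abs_continuous _ _ a' d'); first exact: sub.
    have EE : (chart A (c1 b) \o c1) b = (chart A (c1 b) \o c2) b by rewrite /= E.
    have [K HK] := lip_on_glue EE cl1 cl2; exists K => s t sab tab.
    by have := HK _ _ sab tab; rewrite /c /=; do 2 case: ifP.
- have b_null : {ae mu, forall t, ~ [set b] t}.
    exists [set b]; split; last by move=> x /= /contrapT.
      exact: measurable_set1.
    exact: lebesgue_measure_set1.
  apply: ae_impl2 b_null (ae_impl2 (fun s P Q => conj P Q) c1v c2v) => t tb [h1 h2] /andP[at_ td].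
  have [tb'|bt|//] := ltgtP t b.
    have /is_derive_der := h1 (introT andP (conj at_ (ltW tb'))).
    rewrite -(cl t (ltW tb')) => h; apply/is_derive_der; apply: der_eq h.
    exists (b - t); first by rewrite subr_gt0.
    by move=> s /ltr_normlP[_ hs] /=; have sb : s <= b by [lra]; rewrite (cl _ sb).
  have /is_derive_der := h2 (introT andP (conj (ltW bt) td)).
  rewrite -(cr t (ltW bt)) => h; apply/is_derive_der; apply: der_eq h.
  exists (t - b); first by rewrite subr_gt0.
  by move=> s /ltr_normlP[hs _] /=; have sb : b <= s by [lra]; rewrite (cr _ sb).
Qed.

End IntegralCurveTheory.

(** * The flow near the reference curve *)

Section FlowAlongCurve.
Context {R : realType} {V : normedModType R} {M : topologicalType}.
Variables (B : coordinates V) (A : atlas V M).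
Notation mu := (@lebesgue_measure R).
Hypothesis hM : c1_manifold A.
Variables (T : R) (O : set (R * M)) (X : R -> M -> V).
Hypothesis hX : caratheodory_field B A T O X.
Hypothesis T0 : 0 <= T.
Variable q : R -> M.
Hypothesis hq : integral_curve A O X 0 T q.

(** A flow box restricted to an interval during which [q] stays within [rho / 4] of the centre. A
    solution starting within [rho / 4] of [q] moves by at most [rho / 4] more, so it stays within
    [3 * rho / 4] and hence in the box. *)
Record adapted (p : M) (a b rho C L : R) : Prop := Adapted {
  ad_a : 0 <= a ; ad_ab : a <= b ; ad_b : b <= T ;
  ad_rho : 0 < rho ; ad_C : 0 <= C ; ad_L : 0 <= L ;
  ad_Lab : L * (b - a) <= 2^-1 ;
  ad_Cab : C * (b - a) <= rho / 4 ;
  ad_image : forall x, `|x - chart A p p| < rho -> (chart A p @` dom A p) x ;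
  ad_O : forall t x, a <= t <= b -> `|x - chart A p p| < rho -> O (t, inv_chart A p x) ;
  ad_bound : forall t x, a <= t <= b -> `|x - chart A p p| < rho ->
    `|local_rep A (X t) p x| <= C ;
  ad_lip : forall t x y, a <= t <= b -> `|x - chart A p p| < rho -> `|y - chart A p p| < rho ->
    `|local_rep A (X t) p y - local_rep A (X t) p x| <= L * `|y - x| ;
  ad_diff : forall t x, a <= t <= b -> `|x - chart A p p| < rho ->
    differentiable (local_rep A (X t) p) x ;
  ad_diff_bound : forall t x v, a <= t <= b -> `|x - chart A p p| < rho ->
    `|'d (local_rep A (X t) p) x v| <= L * `|v| ;
  ad_diff_cts : forall t x v, a <= t <= b -> `|x - chart A p p| < rho ->
    {for x, continuous (fun y => 'd (local_rep A (X t) p) y v)} ;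
  ad_meas : forall x, `|x - chart A p p| < rho ->
    vector_measurable B `[a, b] (fun t => local_rep A (X t) p x) ;
  ad_diff_meas : forall x v, `|x - chart A p p| < rho ->
    vector_measurable B `[a, b] (fun t => 'd (local_rep A (X t) p) x v) ;
  ad_q : chart_solution A O X p a b q ;
  ad_qnear : forall t, a <= t <= b -> `|chart A p (q t) - chart A p p| < rho / 4 }.

Lemma adapted_exists t0 : 0 <= t0 <= T -> exists rho C L, exists2 e : R, 0 < e &
  forall a b, 0 <= a -> a <= t0 -> t0 <= b -> b <= T -> b - a < e -> adapted (q t0) a b rho C L.
Proof.
move=> t0T; have [r [rho [C [L bx]]]] := flow_box_exists hX t0T (integral_curve_dom hq t0T).
have rho4 : 0 < rho / 4 by rewrite divr_gt0// (fb_rho bx).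
have [e e0 E] := local_chart_solution hM hq (lexx _) (lexx _) t0T bx rho4.
have r0 := fb_r bx.
exists rho, C, L; exists (Num.min e r); first by rewrite lt_min e0.
move=> a b a0 at0 tb bT; rewrite lt_min => /andP[abe abr].
have ab : a <= b by exact: le_trans tb.
have [||cs cn] := E a b a0 ab bT; [lra|lra|].
have nr t : a <= t <= b -> 0 <= t <= T /\ `|t - t0| < r.
  move=> /andP[at_ tb']; split; first by apply/andP; split; lra.
  by rewrite ltr_norml; apply/andP; split; lra.
have [ar br] : t0 - r < a /\ b < t0 + r by split; lra.
split => //.
- exact: fb_rho bx.
- exact: fb_C bx.
- exact: fb_L bx.
- by apply: le_trans (fb_Lr bx); rewrite ler_wpM2l ?(fb_L bx)//; lra.
- by apply: le_trans (fb_Cr bx); rewrite ler_wpM2l ?(fb_C bx)//; lra.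
- exact: fb_image bx.
- by move=> t x /nr[h1 h2]; exact: (fb_O bx).
- by move=> t x /nr[h1 h2]; exact: (fb_bound bx).
- by move=> t x y /nr[h1 h2]; exact: (fb_lip bx).
- by move=> t x /nr[h1 h2]; exact: (fb_diff bx).
- by move=> t x v /nr[h1 h2]; exact: (fb_diff_bound bx).
- by move=> t x v /nr[h1 h2]; exact: (fb_diff_cts bx).
- by move=> x; exact: (fb_meas bx).
- by move=> x v; exact: (fb_diff_meas bx).
Qed.

Section adapted_interval.
Variables (p : M) (a b rho C L : R).
Hypothesis ad : adapted p a b rho C L.
Let S := [set x | `|x - chart A p p| < rho].
Let Xp t := local_rep A (X t) p.
Let xi := chart A p \o q.

Lemma adapted_reference : solution Xp a b S xi.
Proof.
apply: chart_solution_solution (ad_q ad) _ => t /(ad_qnear ad) h.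
by apply: lt_le_trans h _; have := ad_rho ad; lra.
Qed.

Lemma adapted_dom t : a <= t <= b -> dom A p (q t).
Proof. by have [H _ _] := ad_q ad; move=> /H[]. Qed.

Lemma adapted_solution tau x : a <= tau <= b -> `|x - xi tau| < rho / 4 ->
  exists2 y, y tau = x & solution Xp a b S y.
Proof.
move=> tab xx; have [||||y [yt ys _]] := @picard R V B Xp a b L C S (ad_ab ad) (ad_L ad) (ad_C ad) (ad_Lab ad) _ _ _ tau x tab; last by exists y.
- exact: ad_bound ad.
- exact: ad_lip ad.
- exact: ad_meas ad.
- move=> y yx; have := ad_qnear ad tab; have := ad_Cab ad; rewrite /S /= => h1 h2.
  have -> : y - chart A p p = (y - x) + (x - xi tau) + (xi tau - chart A p p) by zmod.
  apply: le_lt_trans (ler_normD _ _) _; have := ler_normD (y - x) (x - xi tau).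
  rewrite -[chart A p (q tau)]/(xi tau) in h2; have := ad_rho ad; lra.
Qed.

Lemma solution_chart_solution y : solution Xp a b S y ->
  chart_solution A O X p a b (inv_chart A p \o y) /\
  forall t, a <= t <= b -> chart A p (inv_chart A p (y t)) = y t.
Proof.
move=> [yl yS yd].
have im t : a <= t <= b -> dom A p (inv_chart A p (y t)) /\ chart A p (inv_chart A p (y t)) = y t.
  by move=> /yS h; apply: (chart_image_inv hM); exact: (ad_image ad).
split; last by move=> t /im[].
split.
- by move=> t tab; split; [exact: (im _ tab).1|apply: (ad_O ad) => //; exact: yS].
- have [K HK] := yl; exists K => s t sab tab.
  by rewrite /= (im _ sab).2 (im _ tab).2; exact: HK.
- apply: ae_impl yd => t yt tab; have /andP[at_ tb] := tab.
  rewrite /= (im t _).2; last by rewrite !ltW.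
  by apply: der_eq_interior tab _ (yt tab) => s sab; rewrite /= (im s sab).2.
Qed.

Lemma adapted_curve tau x : a <= tau <= b -> `|x - xi tau| < rho / 4 ->
  exists c, [/\ integral_curve A O X a b c, c tau = inv_chart A p x,
    solution Xp a b S (chart A p \o c) & forall t, a <= t <= b -> dom A p (c t)].
Proof.
move=> tab xx; have [y yt ys] := adapted_solution tab xx.
have [cs cE] := solution_chart_solution ys.
exists (inv_chart A p \o y); split.
- exact: (chart_solution_integral_curve B hM cs).
- by rewrite /= yt.
- apply: chart_solution_solution cs _ => t tab'; rewrite /= cE//.
  by have [_ yS _] := ys; exact: yS.
- by move=> t tab'; have [h _ _] := cs; have [] := h _ tab'.
Qed.

End adapted_interval.

Let nbhs_setT (x : M) : nbhs x setT.
Proof. exact: filterT. Qed.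

(** Continuous dependence with arbitrary initial time [sigma] and observation time [s], in either
    order. It includes existence on the whole interval, which lets it be concatenated. *)
Definition nearby_curves (a b : R) := forall sigma s (U : set M), a <= sigma <= b -> a <= s <= b ->
  nbhs (q s) U -> \forall x \near q sigma, exists c, [/\ integral_curve A O X a b c, c sigma = x & U (c s)].

Lemma adapted_nearby p a b rho C L : adapted p a b rho C L -> nearby_curves a b.
Proof.
move=> ad sigma s U sab s'ab sU.
have [d d0 D] := nbhs_ex (near_inv_chart hM (adapted_dom ad s'ab) sU).
have rho4 : 0 < rho / 4 by rewrite divr_gt0// (ad_rho ad).
have m0 : 0 < Num.min (rho / 4) (d / 2) by rewrite lt_min rho4 divr_gt0.
have : \forall x \near q sigma, `|chart A p x - chart A p (q sigma)| < Num.min (rho / 4) (d / 2).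
  apply: (near_chart hM (adapted_dom ad sab) (P := fun y => `|y - chart A p (q sigma)| < _)).
  by apply/nbhs_normE; exists (Num.min (rho / 4) (d / 2)).
move: (dom_nbhs hM (adapted_dom ad sab)); apply: filterS2 => x px.
rewrite lt_min => /andP[x1 x2].
have [c [ci cs csol cd]] := adapted_curve ad sab x1.
rewrite (c1_chartK hM px) in cs.
exists c; split => //.
have st := solution_stability (ad_ab ad) (ad_L ad) (ad_Lab ad) (ad_lip ad) csol (adapted_reference ad) s'ab sab.
rewrite -(c1_chartK hM (cd _ s'ab)); apply: D.
by apply: le_lt_trans st _; rewrite /= cs; lra.
Qed.

(** The two requirements produce two curves through the same point at time [sigma]; uniqueness
    identifies them. *)
Lemma nearby_curves_and a b sigma s s' (U U' : set M) : 0 <= a -> b <= T -> nearby_curves a b ->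
  a <= sigma <= b -> a <= s <= b -> a <= s' <= b -> nbhs (q s) U -> nbhs (q s') U' ->
  \forall x \near q sigma, exists c, [/\ integral_curve A O X a b c, c sigma = x, U (c s) & U' (c s')].
Proof.
move=> a0 bT H sab s1 s2 U1 U2; have := H _ _ _ sab s1 U1; have := H _ _ _ sab s2 U2.
apply: filterS2 => x [c [ci cs cU]] [c' [c'i c's c'U]].
exists c'; split => //; have <- // : c s' = c' s'.
by apply: (integral_curve_uniq hM hX a0 bT ci c'i sab) => //; rewrite cs.
Qed.

Lemma glue_curves a b d (c1 c2 : R -> M) : 0 <= a -> d <= T -> a <= b -> b <= d ->
  integral_curve A O X a b c1 -> integral_curve A O X b d c2 -> c1 b = c2 b ->
  exists c, [/\ integral_curve A O X a d c, forall t, t <= b -> c t = c1 t & forall t, b <= t -> c t = c2 t].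
Proof.
move=> a0 dT ab bd i1 i2 E; exists (fun t => if t <= b then c1 t else c2 t); split.
- exact: (integral_curve_glue hM hX).
- by move=> t ->.
- move=> t bt; have [tb|//] := leP t b.
  by have -> : t = b by apply/eqP; rewrite eq_le tb.
Qed.

Lemma nearby_curves_add a b d : 0 <= a -> d <= T -> a <= b -> b <= d ->
  nearby_curves a b -> nearby_curves b d -> nearby_curves a d.
Proof.
move=> a0 dT ab bd H1 H2 sigma s U /andP[as1 sd1] /andP[as2 sd2] sU.
have bT := le_trans bd dT; have b0 := le_trans a0 ab.
have bab : a <= b <= b by rewrite ab lexx.
have bbd : b <= b <= d by rewrite bd lexx.
have glue := glue_curves a0 dT ab bd.
have [sb|bs] := leP sigma b; have [s'b|bs'] := leP s b.
- have sab : a <= sigma <= b by rewrite as1.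
  have s'ab : a <= s <= b by rewrite as2.
  (* Both times lie in the left half. The right half is used with the void requirement [setT], only
     to prolong the curve up to [d]. *)
  have W := H2 b b setT bbd bbd (nbhs_setT _).
  apply: filterS (nearby_curves_and a0 bT H1 sab s'ab bab sU W) => x [c1 [i1 c1s c1U [c2 [i2 E _]]]].
  by have [c [ci cl cr]] := glue _ _ i1 i2 (esym E); exists c; rewrite !cl.
- have sab : a <= sigma <= b by rewrite as1.
  have s'ab : b <= s <= d by rewrite sd2 ltW.
  have W := H2 b s U bbd s'ab sU.
  apply: filterS (H1 sigma b _ sab bab W) => x [c1 [i1 c1s [c2 [i2 E c2U]]]].
  have [c [ci cl cr]] := glue _ _ i1 i2 (esym E); exists c; split=> //; first by rewrite cl.
  by rewrite cr// ltW.
- have sab : b <= sigma <= d by rewrite sd1 ltW.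
  have s'ab : a <= s <= b by rewrite as2.
  have W := H1 b s U bab s'ab sU.
  apply: filterS (H2 sigma b _ sab bbd W) => x [c2 [i2 c2s [c1 [i1 E c1U]]]].
  have [c [ci cl cr]] := glue _ _ i1 i2 E; exists c; split=> //; last by rewrite cl.
  by rewrite cr// ltW.
- have sab : b <= sigma <= d by rewrite sd1 ltW.
  have s'ab : b <= s <= d by rewrite sd2 ltW.
  have W := H1 b b setT bab bab (nbhs_setT _).
  apply: filterS (nearby_curves_and b0 dT H2 sab s'ab bbd sU W) => x [c2 [i2 c2s c2U [c1 [i1 E _]]]].
  have [c [ci cl cr]] := glue _ _ i1 i2 E; exists c.
  by split=> //; rewrite cr// ltW.
Qed.

Lemma nearby_curves_total : nearby_curves 0 T.
Proof.
apply: cousin => //; first by move=> x y z x0 xy yz zT; exact: nearby_curves_add.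
move=> t tT; have [rho [C [L [e e0 E]]]] := adapted_exists tT.
by exists e => // x y x0 xt ty yT xye; exact: adapted_nearby (E _ _ x0 xt ty yT xye).
Qed.

Notation F := (flow A O X).

(** Uniqueness identifies the curve chosen by [xget], which lives between the two times, with the
    restriction of [c]. *)
Lemma flow_eq a b c t tau : 0 <= a -> b <= T -> integral_curve A O X a b c ->
  a <= t <= b -> a <= tau <= b -> F t tau (c tau) = c t.
Proof.
move=> a0 bT ci tab tauab; rewrite /flow.
have mn : a <= Num.min t tau by rewrite le_min; case/andP: tab => -> _; case/andP: tauab.
have mx : Num.max t tau <= b by rewrite ge_max; case/andP: tab => _ ->; case/andP: tauab.
have ci' := integral_curve_restrict mn mx ci.
case: xgetP => [y -> [c' [c'i c'tau c't]]|/(_ (c t))[]]; last by exists c.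
rewrite -c't; apply: (integral_curve_uniq hM hX _ _ c'i ci' _ c'tau).
- exact: le_trans mn.
- exact: le_trans bT.
- by rewrite ge_min le_max lexx !orbT.
- by rewrite ge_min le_max lexx.
Qed.

Lemma flow_reference t tau : 0 <= t <= T -> 0 <= tau <= T -> F t tau (q tau) = q t.
Proof. exact: flow_eq (lexx _) (lexx _) hq. Qed.

Lemma near_flow_curve tau : 0 <= tau <= T -> \forall x \near q tau, exists c,
  [/\ integral_curve A O X 0 T c, c tau = x & forall t, 0 <= t <= T -> F t tau x = c t].
Proof.
move=> tT; have := nearby_curves_total tT tT (nbhs_setT _).
apply: filterS => x [c [ci cx _]]; exists c; split=> // t t0T.
by rewrite -cx; exact: flow_eq ci t0T tT.
Qed.

Lemma flow_continuous t tau (U : set M) : 0 <= t <= T -> 0 <= tau <= T -> nbhs (q t) U ->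
  \forall x \near q tau, U (F t tau x).
Proof.
move=> tT sT tU; apply: filterS (nearby_curves_total sT tT tU) => x [c [ci <- cU]].
by rewrite (flow_eq _ _ ci tT sT).
Qed.

Lemma flow_comp t s tau : 0 <= t <= T -> 0 <= s <= T -> 0 <= tau <= T ->
  \forall x \near q tau, F t s (F s tau x) = F t tau x.
Proof.
move=> tT sT tauT; apply: filterS (near_flow_curve tauT) => x [c [ci cx cF]].
by rewrite (cF t)// (cF s)// (flow_eq _ _ ci tT sT).
Qed.

Section adapted_flow.
Variables (p : M) (a b rho C L : R).
Hypothesis ad : adapted p a b rho C L.
Let S := [set x | `|x - chart A p p| < rho].
Let Xp t := local_rep A (X t) p.
Let xi := chart A p \o q.
Variable Lam : R -> R -> V -> V.
Hypothesis LamS : forall tau v, a <= tau <= b ->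
  solution (linearized Xp xi) a b [set: V] (fun t => Lam t tau v) /\ Lam tau tau v = v.

Lemma flow_frechet t tau : a <= t <= b -> a <= tau <= b ->
  frechet (chart A p \o F t tau \o inv_chart A p) (xi tau) (Lam t tau).
Proof.
move=> tab sab e e0.
have [d d0 D] := @flow_differentiable R V B Xp a b L S (ad_ab ad) (ad_L ad) (ad_Lab ad)
  (ad_lip ad) (ad_meas ad) (ad_diff ad) (ad_diff_bound ad) (ad_diff_cts ad) (ad_diff_meas ad)
  xi (adapted_reference ad) Lam LamS t tau tab sab e e0.
have rho4 : 0 < rho / 4 by rewrite divr_gt0// (ad_rho ad).
exists (Num.min d (rho / 4)); first by rewrite lt_min d0.
move=> x; rewrite lt_min => /andP[xd xr].
have [c [ci cs csol cd]] := adapted_curve ad sab xr.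
have pim : dom A p (inv_chart A p x) /\ chart A p (inv_chart A p x) = x.
  apply: (chart_image_inv hM); apply: (ad_image ad).
  have -> : x - chart A p p = (x - xi tau) + (xi tau - chart A p p) by zmod.
  apply: le_lt_trans (ler_normD _ _) _; have := ad_qnear ad sab.
  by rewrite -[chart A p (q tau)]/(xi tau); lra.
have cE : chart A p (c tau) = x by rewrite cs pim.2.
have := D _ csol; rewrite /= cE => /(_ xd).
rewrite -cs (flow_eq (ad_a ad) (ad_b ad) ci tab sab).
have := c1_chartK hM (adapted_dom ad sab); rewrite /xi /= => ->.
by rewrite flow_reference//; apply/andP; split; have := ad_a ad; have := ad_b ad; lra.
Qed.

End adapted_flow.

End FlowAlongCurve.

(** * Tangent maps of a flow along a reference curve *)

Section TangentMaps.
Context {R : realType} {V : normedModType R} {M : topologicalType}.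
Variables (B : coordinates V) (A : atlas V M).
Hypothesis hM : c1_manifold A.

(** Continuity is required separately: in the chart at [F x] the composite is meaningful only while
    [F] stays in the domain of that chart. *)
Definition differentiable_at (F : M -> M) (x : M) :=
  {for x, continuous F} /\
  differentiable (chart A (F x) \o F \o inv_chart A x) (chart A x x).

Lemma tangent_map_linear F x a v w :
  tangent_map A F x (a *: v + w) = a *: tangent_map A F x v + tangent_map A F x w.
Proof. by rewrite /tangent_map linearP. Qed.

(** Near [x] the expression in the centred charts is [h] conjugated by transition maps, so the
    tangent map can be computed in any two charts. *)
Lemma tangent_map_chart F x p p' : {for x, continuous F} -> dom A p x -> dom A p' (F x) ->
  differentiable (chart A p' \o F \o inv_chart A p) (chart A p x) ->
  differentiable_at F x /\ forall v, coord_change A (F x) p' (tangent_map A F x v) =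
    'd (chart A p' \o F \o inv_chart A p) (chart A p x) (coord_change A x p v).
Proof.
move=> Fc px p'F dh; set h := chart A p' \o F \o inv_chart A p in dh *.
have xx := c1_dom_mem hM x; have FF := c1_dom_mem hM (F x).
have [d1 _] := c1_transition hM xx px.
have [d2 _] := c1_transition hM p'F FF.
have E1 : transition A x p (chart A x x) = chart A p x by rewrite /transition /= c1_chartK.
have E2 : h (chart A p x) = chart A p' (F x) by rewrite /h /= c1_chartK.
have d3 : differentiable (h \o transition A x p) (chart A x x).
  by apply: differentiable_comp => //; rewrite E1.
have d4 : differentiable (transition A p' (F x) \o (h \o transition A x p)) (chart A x x).
  by apply: differentiable_comp => //; rewrite /= E1 E2.
have near_eq : \forall y \near chart A x x,
    (transition A p' (F x) \o (h \o transition A x p)) y = (chart A (F x) \o F \o inv_chart A x) y.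
  have n1 := near_inv_chart hM xx (Fc _ (dom_nbhs hM p'F)).
  apply: filterS2 n1 (near_dom2 hM xx px) => y Fy [yx yE yp].
  by rewrite /transition /h /= c1_chartK// c1_chartK.
have [d5 E5] := diff_near_eq B d4 near_eq.
split; first by split.
have E3 : (h \o transition A x p) (chart A x x) = chart A p' (F x) by rewrite /= E1 E2.
have d2' : differentiable (transition A p' (F x)) ((h \o transition A x p) (chart A x x)) by rewrite E3.
have dh' : differentiable h (transition A x p (chart A x x)) by rewrite E1.
have E1' : (chart A p \o inv_chart A x) (chart A x x) = chart A p x := E1.
move=> v; rewrite /tangent_map E5 (diff_comp d3 d2') (diff_comp d1 dh') E3 E1'.
have H := coord_changeVK B hM ('d h (chart A p x) (coord_change A x p v)) p'F.
exact: H.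
Qed.

Lemma tangent_map_eq F G x : (\forall y \near x, F y = G y) -> differentiable_at F x ->
  differentiable_at G x /\ forall v, tangent_map A G x v = tangent_map A F x v.
Proof.
move=> FG [Fc Fd]; have Ex : F x = G x := nbhs_singleton FG.
have [d2 E] : differentiable (chart A (G x) \o G \o inv_chart A x) (chart A x x) /\
    forall v, 'd (chart A (G x) \o G \o inv_chart A x) (chart A x x) v =
    'd (chart A (F x) \o F \o inv_chart A x) (chart A x x) v.
  apply: (diff_near_eq B) => //; have := near_inv_chart hM (c1_dom_mem hM x) FG.
  by apply: filterS => y /= ->; rewrite Ex.
split; last by move=> v; rewrite /tangent_map E.
split=> // U; rewrite -Ex => /Fc FU; have {}FU : \forall y \near x, U (F y) := FU.
by apply: filterS2 FG FU => y ->.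
Qed.

Lemma tangent_map_comp F G x : differentiable_at F x -> differentiable_at G (F x) ->
  differentiable_at (G \o F) x /\
  forall v, tangent_map A (G \o F) x v = tangent_map A G (F x) (tangent_map A F x v).
Proof.
move=> [Fc Fd] [Gc Gd].
have xx := c1_dom_mem hM x; have FF := c1_dom_mem hM (F x).
set g := chart A (G (F x)) \o G \o inv_chart A (F x) in Gd.
set f := chart A (F x) \o F \o inv_chart A x in Fd.
have E1 : f (chart A x x) = chart A (F x) (F x) by rewrite /f /= c1_chartK.
have d1 : differentiable (g \o f) (chart A x x) by apply: differentiable_comp; rewrite ?E1.
have near_eq : \forall y \near chart A x x,
    (g \o f) y = (chart A (G (F x)) \o (G \o F) \o inv_chart A x) y.
  have := near_inv_chart hM xx (Fc _ (dom_nbhs hM FF)).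
  by apply: filterS => y Fy; rewrite /g /f /= c1_chartK.
have [d2 E2] := diff_near_eq B d1 near_eq.
split; first by split=> //; exact: continuous_comp.
by move=> v; rewrite /tangent_map E2 (diff_comp Fd) ?E1//= E1.
Qed.

End TangentMaps.

(** * The derivative of the flow along the curve *)

Section FlowDerivative.
Context {R : realType} {V : normedModType R} {M : topologicalType}.
Variables (B : coordinates V) (A : atlas V M).
Notation mu := (@lebesgue_measure R).
Hypothesis hM : c1_manifold A.
Variables (T : R) (O : set (R * M)) (X : R -> M -> V).
Hypothesis hX : caratheodory_field B A T O X.
Hypothesis T0 : 0 <= T.
Variable q : R -> M.
Hypothesis hq : integral_curve A O X 0 T q.

Notation F := (flow A O X).
Notation DF t tau := (tangent_map A (flow A O X t tau) (q tau)).

Lemma adapted_sub p a b rho C L t : adapted B A T O X q p a b rho C L -> a <= t <= b -> 0 <= t <= T.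
Proof. by move=> ad /andP[at_ tb]; rewrite (le_trans (ad_a ad))//= (le_trans tb (ad_b ad)). Qed.

Lemma adapted_fundamental p a b rho C L : adapted B A T O X q p a b rho C L ->
  exists Lam : R -> R -> V -> V,
  [/\ forall tau v, a <= tau <= b -> solution
        (linearized (fun t => local_rep A (X t) p) (chart A p \o q)) a b [set: V] (fun t => Lam t tau v)
        /\ Lam tau tau v = v,
      forall t tau v, a <= t <= b -> a <= tau <= b -> `|Lam t tau v| <= 2 * `|v|,
      forall t tau v, a <= t <= b -> a <= tau <= b -> `|Lam t tau v - v| <= 2 * L * `|v| * `|t - tau|,
      forall t tau r v w, a <= t <= b -> a <= tau <= b ->
        Lam t tau (r *: v + w) = r *: Lam t tau v + Lam t tau w &
      forall t s tau v, a <= t <= b -> a <= s <= b -> a <= tau <= b ->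
        Lam t s (Lam s tau v) = Lam t tau v].
Proof.
move=> ad; have [xil xiS xid] := adapted_reference ad.
apply: (@fundamental_solution R V B _ a b L (ad_ab ad) (ad_L ad) (ad_Lab ad)).
- by move=> t r v w tab; rewrite /linearized linearP.
- by move=> t v tab; apply: (ad_diff_bound ad) => //; exact: xiS.
- exact: (linearized_measurable (ad_diff_cts ad) (ad_diff_meas ad) (adapted_reference ad)).
Qed.

Lemma adapted_tangent p a b rho C L Lam t tau : adapted B A T O X q p a b rho C L ->
  (forall tau v, a <= tau <= b -> solution
        (linearized (fun t => local_rep A (X t) p) (chart A p \o q)) a b [set: V] (fun t => Lam t tau v)
        /\ Lam tau tau v = v) ->
  (forall t tau r v w, a <= t <= b -> a <= tau <= b ->
        Lam t tau (r *: v + w) = r *: Lam t tau v + Lam t tau w) ->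
  a <= t <= b -> a <= tau <= b -> differentiable_at A (F t tau) (q tau) /\
  forall v, coord_change A (q t) p (DF t tau v) = Lam t tau (coord_change A (q tau) p v).
Proof.
move=> ad LamS Laml tab sab.
have tT := adapted_sub ad tab; have sT := adapted_sub ad sab.
have [l lE] := mk_linear (fun r v w => Laml t tau r v w tab sab).
have fr : frechet (chart A p \o F t tau \o inv_chart A p) (chart A p (q tau)) l.
  move=> e e0; have [d d0 D] := flow_frechet hM hX hq ad LamS tab sab e0.
  by exists d => // y yd; rewrite lE; exact: D.
have [dF dE] := frechet_diff B fr.
have E := flow_reference hM hX hq tT sT.
have Fc : {for q tau, continuous (F t tau)}.
  by move=> U; rewrite E => tU; exact: (flow_continuous hM hX T0 hq tT sT tU).
have pt := adapted_dom ad tab.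
have [|h1 h2] := tangent_map_chart B hM Fc (adapted_dom ad sab) _ dF; first by rewrite E.
by split=> // v; have := h2 v; rewrite E dE lE.
Qed.

(** The composition law of the flow is known only near [q tau], which suffices for derivatives:
    differentiability over adjacent intervals composes at their common end [y], for times in either
    order. *)
Lemma flow_tangent_exists t tau : 0 <= t <= T -> 0 <= tau <= T ->
  differentiable_at A (F t tau) (q tau).
Proof.
move: t tau; apply: (@cousin R (fun x y => forall t tau, x <= t <= y -> x <= tau <= y ->
  differentiable_at A (F t tau) (q tau))) => //.
- move=> x y z x0 xy yz zT H1 H2.
  have yT : 0 <= y <= T by rewrite (le_trans x0)//= (le_trans yz).
  have comp t tau : 0 <= t <= T -> 0 <= tau <= T -> differentiable_at A (F t y) (q y) ->
      differentiable_at A (F y tau) (q tau) -> differentiable_at A (F t tau) (q tau).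
    move=> tT sT d1 d2; have E := flow_reference hM hX hq yT sT.
    have [|d3 _] := tangent_map_comp B hM d2 (G := F t y); first by rewrite E.
    by have [] := tangent_map_eq B hM (flow_comp hM hX T0 hq tT yT sT) d3.
  move=> t tau /andP[xt tz] /andP[xs sz].
  have tT : 0 <= t <= T by rewrite (le_trans x0)//= (le_trans tz).
  have sT : 0 <= tau <= T by rewrite (le_trans x0)//= (le_trans sz).
  have [ty|/ltW yt] := leP t y; have [sy|/ltW ys] := leP tau y.
  + by apply: H1; rewrite ?xt ?xs.
  + by apply: comp => //; [apply: H1|apply: H2]; rewrite ?xt ?xy ?lexx ?ys.
  + by apply: comp => //; [apply: H2|apply: H1]; rewrite ?lexx ?yz ?yt ?xs ?xy.
  + by apply: H2; rewrite ?yt ?ys.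
- move=> t0 t0T; have [rho [C [L [e e0 E]]]] := adapted_exists hM hX hq t0T.
  exists e => // x y x0 xt ty yT xye; have ad := E _ _ x0 xt ty yT xye.
  have [Lam [h1 _ _ h2 _]] := adapted_fundamental ad => t tau tab sab.
  by have [] := adapted_tangent ad h1 h2 tab sab.
Qed.

Lemma flow_tangent_comp t s tau v : 0 <= t <= T -> 0 <= s <= T -> 0 <= tau <= T ->
  DF t s (DF s tau v) = DF t tau v.
Proof.
move=> tT sT tauT; have E := flow_reference hM hX hq sT tauT.
have d1 := flow_tangent_exists sT tauT; have d2 := flow_tangent_exists tT sT.
have [|d3 E3] := tangent_map_comp B hM d1 (G := F t s); first by rewrite E.
have [_ E4] := tangent_map_eq B hM (flow_comp hM hX T0 hq tT sT tauT) d3.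
by rewrite E4 E3 E.
Qed.

Lemma flow_tangent_id t v : 0 <= t <= T -> DF t t v = v.
Proof.
move=> tT; have [rho [C [L [e e0 E]]]] := adapted_exists hM hX hq tT.
have tt : t <= t <= t by rewrite lexx.
have /andP[t0 t1] := tT; have ad : adapted B A T O X q (q t) t t rho C L by apply: E; rewrite ?subrr.
have [Lam [h1 _ _ h2 _]] := adapted_fundamental ad.
have [_ /(_ v)] := adapted_tangent ad h1 h2 tt tt.
rewrite (h1 t _ tt).2 => /(congr1 ('d (transition A (q t) (q t)) (chart A (q t) (q t)))).
by rewrite !(coord_changeK B hM)//; exact: c1_dom_mem.
Qed.

Lemma flow_tangent_linear t tau a v w : DF t tau (a *: v + w) = a *: DF t tau v + DF t tau w.
Proof. exact: tangent_map_linear. Qed.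

Lemma flow_tangent_continuous (Y : M -> V) t0 : 0 <= t0 <= T ->
  {for chart A (q t0) (q t0), continuous (local_rep A Y (q t0))} ->
  forall e, 0 < e -> exists2 d : R, 0 < d & forall s, 0 <= s <= T -> `|s - t0| < d ->
    `|DF t0 s (Y (q s)) - Y (q t0)| <= e.
Proof.
move=> t0T Yc e e0; have [rho [C [L [d1 d10 E]]]] := adapted_exists hM hX hq t0T.
set p := q t0 in Yc *; set Yp := local_rep A Y p in Yc.
pose K := `|Yp (chart A p p)| + 1.
have [d2 d20 D2] := (continuousE _ _).1 Yc (Num.min 1 (e / 2)) (ltac:(by rewrite lt_min ltr01 divr_gt0)).
have [d3 d30 D3] := integral_curve_near hM hq t0T (near_chart hM (c1_dom_mem hM p)
  ((nbhs_normE _ (fun x => `|x - chart A p p| < d2)).2 (ex_intro2 _ _ d2 d20 (fun _ h => h)))).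
(* In the chart the resolvent moves a vector of norm at most [K] by at most [2 * L * K * |s - t0|];
   the [+ 1] makes [k] positive. *)
pose k := 2 * `|L| * K + 1.
have k0 : 0 < k by rewrite ltr_wpDl// mulr_ge0// ?mulr_ge0// addr_ge0.
exists (Num.min (d1 / 2) (Num.min d3 (e / 2 / k))); first by rewrite !lt_min d30 !divr_gt0.
move=> s sT; rewrite !lt_min => /and3P[s1 s2 s3].
pose a := Num.min s t0; pose b := Num.max s t0.
have sab : a <= s <= b by rewrite /a /b ge_min le_max lexx.
have tab : a <= t0 <= b by rewrite /a /b ge_min le_max lexx !orbT.
have ad : adapted B A T O X q p a b rho C L.
  have [/andP[s4 s5] /andP[s6 s7]] := (sT, t0T); have [/andP[s8 s9]] := tab.
  apply: E => //; first by rewrite /a le_min s4.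
    by rewrite /b ge_max s5.
  have : b - a = `|s - t0|.
    rewrite /a /b; have [st|ts] := leP s t0.
      by rewrite ler0_norm ?subr_le0// opprB.
    by rewrite gtr0_norm ?subr_gt0.
  by lra.
have [Lam [h1 _ h3 h2 _]] := adapted_fundamental ad.
have [_ H] := adapted_tangent ad h1 h2 tab sab.
(* In the chart centred at [p] a tangent vector at [p] is its own coordinate vector. *)
have cid v : coord_change A p p v = v.
  by have := coord_changeK B hM v (c1_dom_mem hM p); rewrite (transition_id B hM)//; exact: c1_dom_mem.
have {}H v : DF t0 s v = Lam t0 s (coord_change A (q s) p v) by rewrite -H -/p cid.
have pY : Yp (chart A p p) = Y p by rewrite /Yp (local_repE hM) ?cid//; exact: c1_dom_mem.
have Ys : coord_change A (q s) p (Y (q s)) = Yp (chart A p (q s)).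
  by rewrite /Yp (local_repE hM)//; exact: (adapted_dom ad sab).
rewrite H Ys -pY.
have sd : `|chart A p (q s) - chart A p p| < d2 by apply: D3.
have := D2 _ sd; rewrite le_min => /andP[y1 y2].
have yK : `|Yp (chart A p (q s))| <= K.
  rewrite -[Yp _](subrK (Yp (chart A p p))); apply: le_trans (ler_normD _ _) _.
  by rewrite /K addrC lerD2l.
have h4 := h3 t0 s (Yp (chart A p (q s))) tab sab.
have -> : Lam t0 s (Yp (chart A p (q s))) - Yp (chart A p p) =
  (Lam t0 s (Yp (chart A p (q s))) - Yp (chart A p (q s))) + (Yp (chart A p (q s)) - Yp (chart A p p)) by zmod.
apply: le_trans (ler_normD _ _) _.
suff : `|Lam t0 s (Yp (chart A p (q s))) - Yp (chart A p (q s))| <= e / 2 by lra.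
apply: le_trans h4 _; rewrite distrC.
apply: (@le_trans _ _ (k * `|s - t0|)); last by rewrite mulrC -ler_pdivlMr// ltW.
rewrite ler_wpM2r// /k; apply: ler_wpDr => //.
apply: ler_pM => //; first by rewrite mulr_ge0// (ad_L ad).
by rewrite ler_wpM2l// ler_norm.
Qed.

End FlowDerivative.

Lemma der_linear (R : realType) (V W : normedModType R) (B : coordinates V)
  (l : {linear V -> W}) (f : R -> V) t v : der f t v -> der (l \o f) t (l v).
Proof.
move=> fv; have [K K0 HK] := linear_bound B l.
apply: (der_frechet K0 HK fv) => e e0; exists 1 => // y _.
by rewrite -!linearB subrr linear0 normr0 mulr_ge0// ltW.
Qed.

Lemma der_line (R : realType) (V W : normedModType R) (B : coordinates V) (h : V -> W) (x z : V) : differentiable h x ->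
  der (fun r : R => h (x + r *: z)) 0 ('d h x z).
Proof.
move=> hd; have [K K0 HK] := linear_bound B ('d h x).
apply: (der_frechet (c := fun r => x + r *: z) (f := h) K0 HK); last first.
  by rewrite scale0r addr0; exact: differentiable_frechet.
move=> e e0; exists 1 => // s _; rewrite !subr0 scale0r addr0 [x + _]addrC addrK subrr normr0.
by rewrite mulr_ge0// ltW.
Qed.

(** One null set has to serve all [w], as it is later applied to a [w] depending on [t]. The
    finitely many solutions from basis vectors at time [a] share a null set, and each [Lam s t w] is
    a combination of them with coefficients constant in [s]. *)
Lemma fundamental_solution_der (R : realType) (V : normedModType R) (B : coordinates V)
  (Z : R -> V -> V) (a b : R) (Lam : R -> R -> V -> V) : a <= b ->
  (forall t r v w, a <= t <= b -> Z t (r *: v + w) = r *: Z t v + Z t w) ->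
  (forall tau v, a <= tau <= b -> solution Z a b [set: V] (fun t => Lam t tau v) /\ Lam tau tau v = v) ->
  (forall t tau r v w, a <= t <= b -> a <= tau <= b ->
     Lam t tau (r *: v + w) = r *: Lam t tau v + Lam t tau w) ->
  (forall t s tau v, a <= t <= b -> a <= s <= b -> a <= tau <= b ->
     Lam t s (Lam s tau v) = Lam t tau v) ->
  {ae (@lebesgue_measure R), forall t, a < t < b -> forall w, der (fun s => Lam s t w) t (Z t w)}.
Proof.
move=> ab Zlin LamS Lamlin Lamc; have aab : a <= a <= b by rewrite lexx.
have sumE (f : V -> V) (c : 'I_(cdim B) -> R) :
    (forall r v w, f (r *: v + w) = r *: f v + f w) ->
    f (\sum_i c i *: cvec B i) = \sum_i c i *: f (cvec B i).
  by move=> /mk_linear[l lE]; rewrite -lE linear_sum; apply: eq_bigr => i _; rewrite linearZ_LR lE.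
have H i : {ae (@lebesgue_measure R), forall t, a < t < b ->
    der (fun s => Lam s a (cvec B i)) t (Z t (Lam t a (cvec B i)))}.
  by have [[_ _ h] _] := LamS a (cvec B i) aab.
apply: ae_impl (ae_all H) => t Ht tab w; have /andP[at_ tb] := tab.
have tab' : a <= t <= b by rewrite !ltW.
pose c i := coef B i (Lam a t w).
have E s : a <= s <= b -> Lam s t w = \sum_i c i *: Lam s a (cvec B i).
  move=> sab; rewrite -(Lamc s a t)// [Lam a t w](coefK B) sumE// => *; exact: Lamlin.
have -> : Z t w = \sum_i c i *: Z t (Lam t a (cvec B i)).
  rewrite -{1}[w](LamS t w tab').2 E//.
  have [l lE] := mk_linear (fun r v w => Zlin t r v w tab').
  by rewrite -lE linear_sum; apply: eq_bigr => i _; rewrite linearZ_LR lE.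
apply: der_eq_interior tab _ (der_sum (fun i => derZ (c i) (Ht i tab))) => s sab.
by rewrite E.
Qed.

(** * Comparison of two flows along one curve *)

Section TwoFlows.
Context {R : realType} {V : normedModType R} {M : topologicalType}.
Variables (B : coordinates V) (A : atlas V M).
Notation mu := (@lebesgue_measure R).
Hypothesis hM : c1_manifold A.
Variables (T : R) (O1 O2 : set (R * M)) (X1 X2 : R -> M -> V).
Hypotheses (hX1 : caratheodory_field B A T O1 X1) (hX2 : caratheodory_field B A T O2 X2).
Hypothesis T0 : 0 <= T.
Variable q : R -> M.
Hypotheses (hq1 : integral_curve A O1 X1 0 T q) (hq2 : integral_curve A O2 X2 0 T q).
Notation DF1 t tau := (tangent_map A (flow A O1 X1 t tau) (q tau)).
Notation DF2 t tau := (tangent_map A (flow A O2 X2 t tau) (q tau)).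
Variables (l : {linear V -> R^o}) (r tau : R) (v : V).
Hypotheses (rT : 0 <= r <= T) (tauT : 0 <= tau <= T).
Hypothesis same_derivative : {ae mu, forall t, 0 < t < T -> forall p w, dom A p (q t) ->
  differentiable (local_rep A (X1 t) p) (chart A p (q t)) ->
  differentiable (local_rep A (X2 t) p) (chart A p (q t)) ->
  l (DF1 r t ('d (transition A p (q t)) (chart A p (q t))
    ('d (local_rep A (X2 t) p) (chart A p (q t)) w - 'd (local_rep A (X1 t) p) (chart A p (q t)) w))) = 0}.

Let phi s := l (DF1 r s (DF2 s tau v)) : R^o.

(** In one chart the increment of [phi] from [t] to [s] is a linear form applied to
    [Lam1 t s (g s)], where [g] compares the second linearized solution with the first one started
    from the same vector at [t]. Thus [phi] is differentiated using forward derivatives of both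
    resolvents only, and the result is the difference of the two linearized fields, which the
    hypothesis kills. *)
Lemma two_flows_local p a b rho1 C1 L1 rho2 C2 L2 :
  adapted B A T O1 X1 q p a b rho1 C1 L1 -> adapted B A T O2 X2 q p a b rho2 C2 L2 ->
  phi a = phi b.
Proof.
move=> ad1 ad2; have ab := ad_ab ad1.
have aab : a <= a <= b by rewrite lexx.
have abT t : a <= t <= b -> 0 <= t <= T by exact: (adapted_sub ad1).
have [Lam1 [S1 Bd1 Lip1 Lin1 Co1]] := adapted_fundamental ad1.
have [Lam2 [S2 Bd2 Lip2 Lin2 Co2]] := adapted_fundamental ad2.
have Tg1 t s (tab : a <= t <= b) (sab : a <= s <= b) := (adapted_tangent hM hX1 T0 hq1 ad1 S1 Lin1 tab sab).2.
have Tg2 t s (tab : a <= t <= b) (sab : a <= s <= b) := (adapted_tangent hM hX2 T0 hq2 ad2 S2 Lin2 tab sab).2.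
have pq t : a <= t <= b -> dom A p (q t) by exact: (adapted_dom ad1).
pose back t := 'd (transition A p (q t)) (chart A p (q t)).
pose w2 s := Lam2 s a (coord_change A (q a) p (DF2 a tau v)).
have w2E s : a <= s <= b -> coord_change A (q s) p (DF2 s tau v) = w2 s.
  by move=> sab; rewrite -(flow_tangent_comp hM hX2 T0 hq2 v (abT s sab) (abT a aab) tauT) Tg2.
have [ell ellE] : {ell : {linear V -> R^o} | forall u, ell u = l (DF1 r a (back a u))}.
  by apply: mk_linear => k u w; rewrite linearP flow_tangent_linear linearP.
have ellLam s z : a <= s <= b -> ell (Lam1 a s z) = l (DF1 r s (back s z)).
  move=> sab; rewrite ellE -[z in LHS](coord_changeVK B hM z (pq s sab)) -Tg1//.
  by rewrite /back (coord_changeK B hM _ (pq a aab)) (flow_tangent_comp hM hX1 T0 hq1 _ rT (abT a aab) (abT s sab)).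
have phiE s : a <= s <= b -> phi s = ell (Lam1 a s (w2 s)).
  move=> sab; rewrite ellLam// -w2E// /back (coord_changeK B hM _ (pq s sab))//.
have Lam1B s t u w : a <= s <= b -> a <= t <= b -> Lam1 s t (u - w) = Lam1 s t u - Lam1 s t w.
  by move=> sab tab; have := Lin1 s t (-1) w u sab tab; rewrite !scaleN1r addrC => ->; rewrite addrC.
have phiB s t : a <= s <= b -> a <= t <= b ->
    phi t - phi s = ell (Lam1 a t (w2 t - Lam1 t s (w2 s))).
  by move=> sab tab; rewrite !phiE// Lam1B// linearB Co1.
have [k k0 HK] := linear_bound B ell.
have [[w2l _ w2d] _] := S2 a (coord_change A (q a) p (DF2 a tau v)) aab.
have phil : lip_on a b phi.
  have [K1 K10 HK1] := lip_on_gt0 w2l; have [M1 M10 HM1] := lip_on_bounded w2l.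
  exists (k * (2 * (K1 + 2 * L1 * M1))) => s t sab tab.
  rewrite phiB// -!mulrA; apply: le_trans (HK _) _; rewrite ler_wpM2l//.
  apply: le_trans (Bd1 _ _ _ aab tab) _; rewrite ler_wpM2l//.
  have -> : w2 t - Lam1 t s (w2 s) = (w2 t - w2 s) - (Lam1 t s (w2 s) - w2 s) by zmod.
  apply: le_trans (ler_normB _ _) _; rewrite mulrDl lerD//; first exact: HK1.
  apply: le_trans (Lip1 _ _ _ tab sab) _; rewrite -!mulrA.
  rewrite ler_wpM2l// ler_wpM2l ?(ad_L ad1)// ler_wpM2r//; exact: HM1.
have phid : {ae mu, forall t, a < t < b -> exists2 z, der phi t z & `|z| <= 0}.
  have F1 := fundamental_solution_der B ab (fun t k u w (_ : a <= t <= b) => linearP _ k u w) S1 Lin1 Co1.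
  apply: ae_impl2 same_derivative (ae_impl2 (fun s P Q => conj P Q) F1 w2d) => t ht [d1 d2] tab.
  have /andP[at_ tb] := tab; have tab' : a <= t <= b by rewrite !ltW.
  have {}d1 := d1 tab (w2 t); have {}d2 := d2 tab.
  exists 0; last by rewrite normr0.
  pose g s := w2 s - Lam1 s t (w2 t).
  have gd := derB d2 d1; rewrite -/(w2 t) in gd.
  set z := (X in der _ _ X) in gd.
  have g0 : g t = 0 by rewrite /g (S1 t _ tab').2 subrr.
  (* As [g t = 0] and [Lam1 t s] differs from the identity by a multiple of [|s - t|], the resolvent
     factor changes [g s] only to second order. *)
  have hd : der (fun s => Lam1 t s (g s)) t z.
    move=> e e0; have [d3 d30 D3] := gd (e / 2) (ltac:(by rewrite divr_gt0)).
    have [d4 d40 D4] := gd 1 ltr01.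
    pose K2 := 2 * L1 * (1 + `|z|) + 1.
    have L10 := ad_L ad1.
    have K20 : 0 < K2 by rewrite ltr_wpDl// mulr_ge0// ?mulr_ge0// addr_ge0.
    have [d5 d50 D5] := near_interior tab.
    exists (Num.min (Num.min d3 d4) (Num.min (e / 2 / K2) d5)).
      by rewrite !lt_min d30 d40 d50 !divr_gt0.
    move=> s; rewrite !lt_min => /and3P[/andP[s3 s4] s5 /D5 sab].
    have gs : `|g s| <= (1 + `|z|) * `|s - t|.
      have := D4 _ s4; rewrite -/(g s) -/(g t) g0 subr0 => h.
      rewrite -[g s](subrK ((s - t) *: z)) mulrDl; apply: le_trans (ler_normD _ _) _.
      by rewrite lerD// normrZ mulrC.
    have := D3 _ s3; rewrite -/(g s) -/(g t) g0 subr0 => h.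
    have Lt : Lam1 t t 0 = 0 by rewrite (S1 t _ tab').2.
    rewrite Lt subr0.
    apply: (@le_trans _ _ (`|Lam1 t s (g s) - g s| + `|g s - (s - t) *: z|)).
      by apply: le_trans (ler_normD _ _); rewrite addrA subrK.
    suff : `|Lam1 t s (g s) - g s| <= e / 2 * `|s - t| by lra.
    apply: le_trans (Lip1 _ _ _ tab' sab) _; rewrite [`|t - s|]distrC.
    apply: ler_wpM2r => //; apply: (@le_trans _ _ (K2 * `|s - t|)); last by rewrite mulrC -ler_pdivlMr// ltW.
    apply: (@le_trans _ _ (2 * L1 * (1 + `|z|) * `|s - t|)).
      by rewrite -[leRHS]mulrA ler_wpM2l// mulr_ge0.
    by rewrite ler_wpM2r// /K2 lerDl.
  have [ell2 ell2E] : {ell2 : {linear V -> R^o} | forall u, ell2 u = ell (Lam1 a t u)}.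
    by apply: mk_linear => c u w; rewrite Lin1// linearP.
  have z0 : ell2 z = 0.
    rewrite ell2E ellLam//; apply: ht; [by rewrite (le_lt_trans (ad_a ad1) at_) (lt_le_trans tb (ad_b ad1))|exact: pq| |].
      by apply: (ad_diff ad1) => //; have [_ h _] := adapted_reference ad1; exact: h.
    by apply: (ad_diff ad2) => //; have [_ h _] := adapted_reference ad2; exact: h.
  have := der_linear B ell2 hd; rewrite z0 => d5.
  have := derD (der_cst (phi t) t) d5; rewrite addr0; apply: der_eq_interior tab _ => s sab.
  by rewrite /= ell2E Co1// -phiB// addrC subrK.
have := ae_derivative_bound ab (lexx 0) (lip_on_abs_continuous (fun t h => h) phil) phid.
by rewrite mul0r normr_le0 subr_eq0 => /eqP ->.
Qed.

Lemma two_flows_constant s t : 0 <= s <= T -> 0 <= t <= T -> phi s = phi t.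
Proof.
have H : forall x y, 0 <= x -> x <= y -> y <= T -> phi x = phi y.
  move=> x y x0 xy yT; refine (@cousin R (fun x y => phi x = phi y) x y xy _ _).
    by move=> ? ? ? _ _ _ _ h1 h2; exact: (etrans h1 h2).
  move=> t0 /andP[xt ty]; have t0T : 0 <= t0 <= T by rewrite (le_trans x0)//= (le_trans ty).
  have [rho1 [C1 [L1 [e1 e10 E1]]]] := adapted_exists hM hX1 hq1 t0T.
  have [rho2 [C2 [L2 [e2 e20 E2]]]] := adapted_exists hM hX2 hq2 t0T.
  exists (Num.min e1 e2); first by rewrite lt_min e10.
  move=> a b xa at_ tb by_; rewrite lt_min => /andP[ab1 ab2].
  have a0 := le_trans x0 xa; have bT := le_trans by_ yT.
  exact: two_flows_local (E1 a b a0 at_ tb bT ab1) (E2 a b a0 at_ tb bT ab2).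
move=> /andP[s0 sT] /andP[t0 tT].
by have [st|/ltW ts] := leP s t; [exact: H|apply/esym; exact: H].
Qed.

End TwoFlows.

(** * Derivative of a combination of frame fields at a zero *)

Section FieldDifference.
Context {R : realType} {V : normedModType R} (B : coordinates V).

(** [nu (Z x)] is the sum of the [a x i * nu (Y i x)]. The first factor is of the order of
    [|x - x0|], as [Z] is; the second tends to 0, because [nu] kills the frame at [x0] and the frame
    is continuous. So [nu (Z x)] has zero derivative at [x0]. *)
Lemma frame_difference (d : nat) (Z : V -> V) (x0 : V) (a : V -> 'I_d -> R) (Y : 'I_d -> V -> V)
    (c : 'I_d -> {linear V -> R^o}) (nu : {linear V -> R^o}) :
  differentiable Z x0 -> Z x0 = 0 ->
  (\forall x \near x0, Z x = \sum_i a x i *: Y i x) ->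
  (forall i, {for x0, continuous (Y i)}) ->
  (forall i j, c j (Y i x0) = (i == j)%:R) ->
  (forall i, nu (Y i x0) = 0) ->
  forall w, nu ('d Z x0 w) = 0.
Proof.
move=> Zdiff Z0 /nbhs_ex[d1 d10 D1] Yc cY nuY; have Zd := differentiable_frechet Zdiff.
have [K K0 HK] := linear_bound B ('d Z x0).
have [d2 d20 D2] := Zd 1 ltr01.
have [N N0 HN] := linear_bound B nu.
have [kc kc0 Hc] : exists2 kc : R, 0 <= kc & forall j v, `|c j v| <= kc * `|v|.
  have H j := cid2 (linear_bound B (c j)).
  exists (\sum_j projT1 (H j)).
    by apply: sumr_ge0 => j _; case: (H j).
  move=> j v; rewrite (bigD1 j)//=; case: (H j) => kj kj0 /= Hj; apply: le_trans (Hj v) _.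
  by rewrite ler_wpM2r// lerDl; apply: sumr_ge0 => i _; case: (H i).
(* Chosen so that [kc * eps * d.+1 <= 1 / 2]: the sum [m] of the coefficients then absorbs its own
   contribution to the bound. *)
pose eta : R := (2 * (kc + 1) * d.+1%:R)^-1.
have dpos : 0 < d.+1%:R :> R by [].
have eta0 : 0 < eta by rewrite invr_gt0 !mulr_gt0// ltr_wpDl.
have key e : 0 < e -> exists2 r : R, 0 < r & forall x, `|x - x0| < r -> `|nu (Z x)| <= e * `|x - x0|.
  move=> e0; pose K' := 2 * d.+1%:R * kc * (K + 1) * N + 1.
  have K'0 : 0 < K' by rewrite ltr_wpDl// !mulr_ge0// addr_ge0.
  pose eps := Num.min eta (e / K'); have eps0 : 0 < eps by rewrite lt_min eta0 divr_gt0.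
  have [d3 d30 D3] : exists2 d : R, 0 < d & forall r, 0 < r -> r < d -> forall i x, `|x - x0| < r -> `|Y i x - Y i x0| <= eps.
    apply: uniform_radius => i; have [r r0 Hr] := (continuousE _ _).1 (Yc i) eps eps0.
    by exists r => // s s0 sr x xs; apply: Hr; exact: lt_trans sr.
  exists (Num.min (Num.min d1 d2) (d3 / 2)); first by rewrite !lt_min d10 d20 divr_gt0.
  move=> x; rewrite !lt_min => /andP[/andP[x1 x2] x3].
  have Yx i : `|Y i x - Y i x0| <= eps by apply: (D3 (d3 / 2)) => //; [rewrite divr_gt0|lra].
  have Zx : `|Z x| <= (K + 1) * `|x - x0|.
    have := D2 _ x2; rewrite Z0 subr0 => h.
    rewrite -[Z x](subrK ('d Z x0 (x - x0))) mulrDl addrC; apply: le_trans (ler_normD _ _) _.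
    by apply: lerD.
  (* Applying the dual forms [c j] to [Z x] bounds the coefficients by [Z x],
     since [Y i x] is close to [Y i x0]. *)
  pose m := \sum_i `|a x i|; have m0 : 0 <= m by apply: sumr_ge0.
  have aj j : `|a x j| <= kc * `|Z x| + kc * eps * m.
    have -> : a x j = c j (Z x) - \sum_i a x i * c j (Y i x - Y i x0).
      rewrite D1// linear_sum -sumrB (bigD1 j)//= big1 ?addr0 => [|i ij].
        by rewrite linearZ_LR linearB cY eqxx -mulrBr opprB addrC subrK mulr1.
      by rewrite linearZ_LR linearB cY (negPf ij) -mulrBr opprB addrC subrK mulr0.
    apply: le_trans (ler_normB _ _) _; apply: lerD; first exact: Hc.
    apply: le_trans (ler_norm_sum _ _ _) _; rewrite /m mulr_sumr; apply: ler_sum => i _.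
    rewrite normrM mulrC; apply: ler_wpM2r => //; apply: le_trans (Hc _ _) _.
    by rewrite ler_wpM2l.
  have mle : m <= 2 * d.+1%:R * kc * `|Z x|.
    have h1 : m <= d%:R * (kc * `|Z x| + kc * eps * m).
      apply: (@le_trans _ _ (\sum_(i < d) (kc * `|Z x| + kc * eps * m))); first exact: ler_sum.
      by rewrite sumr_const card_ord mulr_natl.
    have h2 : kc * eps * m * d.+1%:R <= m / 2.
      have h3 : kc * eps * d.+1%:R <= 2^-1.
        apply: (@le_trans _ _ ((kc + 1) * eta * d.+1%:R)).
          rewrite ler_wpM2r// ler_pM// ?(ltW eps0) ?lerDl//.
          by rewrite /eps ge_min lexx.
        rewrite /eta !invfM; have := lt0r_neq0 dpos.
        have k1 : kc + 1 != 0 by rewrite gt_eqF// ltr_wpDl.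
        move=> d1'; rewrite [_^-1 * (kc + 1)^-1]mulrC !mulrA divff// mul1r.
        by rewrite mulrAC mulfK// mulVf.
      by have := ler_wpM2r m0 h3; lra.
    have h4 : d%:R * (kc * `|Z x| + kc * eps * m) <= d.+1%:R * (kc * `|Z x| + kc * eps * m).
      rewrite ler_wpM2r ?ler_nat// addr_ge0// !mulr_ge0//; exact: ltW.
    by have := le_trans h1 h4; lra.
  have nuZ : `|nu (Z x)| <= m * (N * eps).
    rewrite D1// linear_sum; apply: le_trans (ler_norm_sum _ _ _) _.
    rewrite /m mulr_suml; apply: ler_sum => i _; rewrite linearZ_LR normrM ler_wpM2l//.
    rewrite -[Y i x](subrK (Y i x0)) linearD nuY addr0; apply: le_trans (HN _) _.
    by rewrite ler_wpM2l.
  apply: le_trans nuZ _.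
  apply: (@le_trans _ _ (2 * d.+1%:R * kc * ((K + 1) * `|x - x0|) * (N * eps))).
    rewrite ler_wpM2r ?mulr_ge0 ?(ltW eps0)//; apply: le_trans mle _.
    by rewrite ler_wpM2l// !mulr_ge0.
  apply: (@le_trans _ _ (K' * eps * `|x - x0|)).
    rewrite /K'.
    have -> : 2 * d.+1%:R * kc * ((K + 1) * `|x - x0|) * (N * eps) =
       2 * d.+1%:R * kc * (K + 1) * N * eps * `|x - x0| by ring.
    by rewrite ler_wpM2r// ler_wpM2r ?(ltW eps0)// lerDl.
  rewrite ler_wpM2r// mulrC -ler_pdivlMr// /eps ge_min lexx orbT//.
move=> w; apply: (@der_uniq R R^o (fun r => nu (Z (x0 + r *: w))) 0).
  exact: (der_linear B nu (f := fun r => Z (x0 + r *: w)) (der_line B w Zdiff)).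
move=> e e0; have w0 : 0 < `|w| + 1 by rewrite ltr_wpDl.
have [r r0 Hr] := key (e / (`|w| + 1)) (ltac:(by rewrite divr_gt0)).
exists (r / (`|w| + 1)); first by rewrite divr_gt0.
move=> s; rewrite !subr0 scale0r addr0 scaler0 Z0 linear0 !subr0 => sr.
have nw : `|x0 + s *: w - x0| <= `|s| * (`|w| + 1).
  by rewrite [x0 + _]addrC addrK normrZ ler_wpM2l// lerDl.
apply: le_trans (Hr _ _) _; first by apply: le_lt_trans nw _; rewrite -ltr_pdivlMr.
apply: (@le_trans _ _ (e / (`|w| + 1) * (`|s| * (`|w| + 1)))); first by rewrite ler_wpM2l// ltW// divr_gt0.
by rewrite mulrCA mulrC divfK// gt_eqF.
Qed.

End FieldDifference.

(** * The extended control system *)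

Section RowCoordinates.
Context {R : realType} {n : nat}.

Lemma norm_entry_le (v : 'rV[R]_n) i : `|v ord0 i| <= `|v|.
Proof.
rewrite {2}/Num.norm /= mx_normrE.
exact: (le_bigmax _ (fun ij : 'I_1 * 'I_n => `|v ij.1 ij.2|) (ord0, i)).
Qed.

Definition row_coordinates : coordinates 'rV[R]_n.
Proof.
refine (@Coordinates R _ n (delta_mx 0) (fun i v => v ord0 i) _ _ _).
- by move=> i a v w; rewrite !mxE.
- by move=> i v; exact: norm_entry_le.
- by move=> v; exact: row_sum_delta.
Defined.

End RowCoordinates.

Lemma norm_fst_le (R : realType) (V W : normedModType R) (z : V * W) : `|z.1| <= `|z|.
Proof. by rewrite prod_normE le_max lexx. Qed.

Lemma norm_snd_le (R : realType) (V W : normedModType R) (z : V * W) : `|z.2| <= `|z|.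
Proof. by rewrite prod_normE le_max lexx orbT. Qed.

Lemma norm_pair_le (R : realType) (V W : normedModType R) (z : V * W) (e : R) : `|z.1| <= e -> `|z.2| <= e -> `|z| <= e.
Proof. by rewrite prod_normE ge_max => -> ->. Qed.

Section Product.
Context {R : realType} {V : normedModType R}.

(** Index [ord0] is the cost coordinate; the other indices are lifted from [B]. *)
Definition product_coordinates (B : coordinates V) : coordinates (V * R^o)%type.
Proof.
refine (@Coordinates R (V * R^o)%type (cdim B).+1
  (fun i => if unlift ord0 i is Some j then (cvec B j, 0) else (0, 1))
  (fun i z => if unlift ord0 i is Some j then coef B j z.1 else z.2) _ _ _).
- by move=> i a v w; case: unlift => [j|] //=; rewrite coef_linear.
- move=> i v; case: unlift => [j|]; last exact: norm_snd_le.
  exact: (le_trans (coef_bound j v.1) (norm_fst_le v)).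
- move=> [v r]; rewrite big_ord_recl unlift_none /=.
  under eq_bigr do rewrite liftK.
  have -> : \sum_i coef B i v *: (cvec B i, 0 : R^o) = (v, 0).
    rewrite [in RHS](coefK B v); elim/big_rec2: _ => // i x y _ ->.
    by congr pair => /=; rewrite [_ *: 0]mulr0 add0r.
  by congr pair => /=; rewrite ?scaler0 ?add0r// [_ *: 1]mulr1 addr0.
Defined.

Lemma near_fst (T U : topologicalType) (z : T * U) (P : set T) : nbhs z.1 P -> \forall y \near z, P y.1.
Proof.
by move=> h; exists (P, setT); [split=> //; exact: filterT|move=> [a b] []].
Qed.

Lemma near_snd (T U : topologicalType) (z : T * U) (P : set U) : nbhs z.2 P -> \forall y \near z, P y.2.
Proof.
by move=> h; exists (setT, P); [split=> //; exact: filterT|move=> [a b] []].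
Qed.

(* Both the transition maps of the extended atlas and the local representatives
   of translation-invariant fields have this triangular form. *)
Lemma diff_triangular (W : normedModType R) (B : coordinates V) (f : V -> W) (k : V -> R^o) (c : R) (z : V * R^o) :
  differentiable f z.1 -> differentiable k z.1 ->
  differentiable (fun y : V * R^o => (f y.1, k y.1 + c *: y.2) : W * R^o) z /\
  forall v : V * R^o, 'd (fun y : V * R^o => (f y.1, k y.1 + c *: y.2) : W * R^o) z v =
    ('d f (z.1) v.1, 'd k (z.1) v.1 + c *: v.2).
Proof.
move=> /differentiable_frechet fd /differentiable_frechet kd.
have [l lE] : {l : {linear (V * R^o)%type -> (W * R^o)%type} |
    forall v : V * R^o, l v = ('d f (z.1) v.1, 'd k (z.1) v.1 + c *: v.2)}.
  apply: mk_linear => a [v r] [w s]; congr pair => /=; rewrite linearP//.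
  by rewrite scalerDr scalerDr !scalerA [c * a]mulrC; zmod.
have fr : frechet (fun y : V * R^o => (f y.1, k y.1 + c *: y.2) : W * R^o) z l.
  move=> e e0; have [d1 d10 D1] := fd e e0; have [d2 d20 D2] := kd e e0.
  exists (Num.min d1 d2); first by rewrite lt_min d10.
  move=> y; rewrite lt_min => /andP[y1 y2].
  have h1 : `|y.1 - z.1| <= `|y - z| := norm_fst_le (y - z).
  rewrite lE; apply: norm_pair_le => /=.
    by apply: le_trans (D1 _ (le_lt_trans h1 y1)) _; rewrite ler_wpM2l// ltW.
  have -> : k y.1 + c *: y.2 - (k z.1 + c *: z.2) - ('d k (z.1) (y.1 - z.1) + c *: (y.2 - z.2)) =
    k y.1 - k z.1 - 'd k (z.1) (y.1 - z.1) by zmod.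
  by apply: le_trans (D2 _ (le_lt_trans h1 y2)) _; rewrite ler_wpM2l// ltW.
have [dd dE] := frechet_diff (product_coordinates B) fr.
by split=> // v; rewrite dE lE.
Qed.

End Product.

Section Smoothness.
Context {R : realType} {V W : normedModType R}.

(** At level 2 of [Ck] the directional derivative ['D_v h] is itself differentiable, hence
    continuous, and near [x] it coincides with ['d h _ v]. *)
Lemma smooth_on_c1 (S : set V) (h : V -> W) x : smooth_on S h -> nbhs x S -> c1_at h x.
Proof.
move=> /(_ 2)[hd hc] xS; have Sx := nbhs_singleton xS; split; first exact: hd.
move=> v; have {}hc := (hc v).1 _ Sx.
have {hc} := differentiable_continuous hc.
rewrite /continuous_at => hc.
suff : 'd h y v @[y --> x] --> 'd h x v by [].
rewrite -(deriveE v (hd _ Sx)); apply: cvg_trans hc; apply: near_eq_cvg.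
by apply: filterS xS => y Sy; rewrite deriveE//; exact: hd.
Qed.

Lemma c1_at_eq (B : coordinates V) (h k : V -> W) x : c1_at h x ->
  (\forall y \near x, differentiable h y) -> (\forall y \near x, h y = k y) -> c1_at k x.
Proof.
move=> [hd hc] nd E; have [kd kE] := diff_near_eq B hd E; split; first exact: kd.
move=> v.
suff : 'd k y v @[y --> x] --> 'd k x v by [].
rewrite kE; apply: cvg_trans (hc v); apply: near_eq_cvg.
have E2 := near_join E; apply: filterS2 nd E2 => y yd /(diff_near_eq B yd)[_ ->//].
Qed.

Lemma c1_at_triangular (B : coordinates V) (f : V -> W) (k : V -> R^o) (c : R) (z : V * R^o) :
  (\forall y \near z.1, differentiable f y /\ differentiable k y) -> c1_at f z.1 -> c1_at k z.1 ->
  c1_at (fun y : V * R^o => (f y.1, k y.1 + c *: y.2) : W * R^o) z.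
Proof.
move=> nd [fd fc] [kd kc]; have [dd dE] := diff_triangular B c fd kd; split=> // v.
apply/continuousE => e e0.
have [d1 d10 D1] := (continuousE _ _).1 (fc v.1) e e0.
have [d2 d20 D2] := (continuousE _ _).1 (kc v.1) e e0.
have [d3 d30 D3] := nbhs_ex nd.
exists (Num.min d3 (Num.min d1 d2)); first by rewrite !lt_min d10 d20 d30.
move=> y; rewrite !lt_min => /and3P[y3 y1 y2].
have h1 : `|y.1 - z.1| <= `|y - z| := norm_fst_le (y - z).
have [yf yk] := D3 _ (le_lt_trans h1 y3); have [_ yE] := diff_triangular B c yf yk.
rewrite [X in `|X - _|](yE v) [X in `|_ - X|](dE v).
apply: norm_pair_le.
  exact: (D1 _ (le_lt_trans h1 y1)).
rewrite [X in `|X|]/=.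
have -> : 'd k (y.1) v.1 + c *: v.2 - ('d k (z.1) v.1 + c *: v.2) = 'd k (y.1) v.1 - 'd k (z.1) v.1 by zmod.
exact: D2 (le_lt_trans h1 y2).
Qed.

Lemma frechet_combination (J : finType) (c : J -> R) (h : J -> V -> W) (L : J -> V -> W) y :
  (forall j, frechet (h j) y (L j)) ->
  frechet (fun x => \sum_j c j *: h j x) y (fun v => \sum_j c j *: L j v).
Proof.
move=> hd; elim: (index_enum J) => [|j s IH] e e0.
  exists 1 => // x _; rewrite !big_nil !subr0 normr0 mulr_ge0// ltW//.
have k0 : 0 < 2 * (`|c j| + 1) by rewrite mulr_gt0// ltr_wpDl.
have [d1 d10 D1] := hd j (e / (2 * (`|c j| + 1))) (ltac:(by rewrite divr_gt0)).
have [d2 d20 D2] := IH (e / 2) (ltac:(by rewrite divr_gt0)).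
exists (Num.min d1 d2); first by rewrite lt_min d10.
move=> x; rewrite lt_min !big_cons => /andP[/D1 {}D1 /D2 {}D2].
set S1 := \sum_(i <- s) _ in D2 *; set S2 := \sum_(i <- s) _ in D2 *; set S3 := \sum_(i <- s) _ in D2 *.
have -> : c j *: h j x + S1 - (c j *: h j y + S2) - (c j *: L j (x - y) + S3) =
  c j *: (h j x - h j y - L j (x - y)) + (S1 - S2 - S3) by zmod.
apply: le_trans (ler_normD _ _) _; rewrite normrZ.
suff : `|c j| * `|h j x - h j y - L j (x - y)| <= e / 2 * `|x - y| by lra.
apply: le_trans (ler_wpM2l _ D1) _ => //; rewrite mulrA ler_wpM2r//.
rewrite mulrA ler_pdivrMr// mulrC -mulrA ler_wpM2l ?(ltW e0)//; lra.
Qed.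

Lemma diff_combination (B : coordinates V) (J : finType) (c : J -> R) (h : J -> V -> W) y :
  (forall j, differentiable (h j) y) ->
  differentiable (fun x => \sum_j c j *: h j x) y /\
  forall v, 'd (fun x => \sum_j c j *: h j x) y v = \sum_j c j *: 'd (h j) y v.
Proof.
move=> hd; have fr := frechet_combination c (fun j => differentiable_frechet (hd j)).
have [l lE] : {l : {linear V -> W} | forall v, l v = \sum_j c j *: 'd (h j) y v}.
  apply: mk_linear => a v w; rewrite scaler_sumr -big_split; apply: eq_bigr => j _.
  by rewrite linearP scalerDr !scalerA mulrC.
have [|h1 h2] := @frechet_diff R V B W (fun x => \sum_j c j *: h j x) y l.
  by move=> e /fr[d d0 D]; exists d => // x xd; rewrite lE; exact: D.
by split; [exact: h1|move=> v; rewrite h2 lE].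
Qed.

End Smoothness.

Section SmoothManifolds.
Context {R : realType} {V : normedModType R} {M : topologicalType}.
Variables (B : coordinates V) (A : atlas V M).

Lemma smooth_c1_manifold : smooth_manifold A -> c1_manifold A.
Proof.
move=> hA; split; try by case: hA.
move=> p p' x px p'x; apply: (smooth_on_c1 (mfd_transition hA p p')).
have xdom : nbhs x (dom A p `&` dom A p').
  by apply: open_nbhs_nbhs; split=> //; apply: openI; exact: mfd_dom_open hA _.
have n1 : nbhs (chart A p x) (chart A p @` dom A p).
  by apply: open_nbhs_nbhs; split; [exact: mfd_image_open hA p|exists x].
have n2 : \forall y \near chart A p x, (dom A p `&` dom A p') (inv_chart A p y).
  by apply: (mfd_inv_cts hA px); rewrite (mfd_chartK hA).
by apply: filterS2 n1 n2 => y [z pz <-]; rewrite (mfd_chartK hA)// => h; exists z.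
Qed.

Hypothesis hM : c1_manifold A.

Definition c1_field (S : set M) (Y : M -> V) := forall p x, dom A p x -> S x ->
  c1_at (local_rep A Y p) (chart A p x).

Definition c1_function (S : set M) (h : M -> R^o) := forall p x, dom A p x -> S x ->
  c1_at (h \o inv_chart A p) (chart A p x).

Lemma chart_image_nbhsI S p x : open S -> dom A p x -> S x ->
  nbhs (chart A p x) (chart A p @` (dom A p `&` S)).
Proof.
move=> oS px Sx; have := near_inv_chart hM px (open_nbhs_nbhs (conj oS Sx)).
apply: filterS2 (near_dom hM px) => y [py yE] Sy; exists (inv_chart A p y) => //.
Qed.

Lemma smooth_c1_field S Y : open S -> smooth_field A S Y -> c1_field S Y.
Proof. by move=> oS hY p x px Sx; apply: smooth_on_c1 (hY p) _; exact: chart_image_nbhsI. Qed.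

Lemma smooth_c1_function S h : open S -> smooth_function A S h -> c1_function S h.
Proof. by move=> oS hY p x px Sx; apply: smooth_on_c1 (hY p) _; exact: chart_image_nbhsI. Qed.

Lemma c1_field_near S Y p x : open S -> c1_field S Y -> dom A p x -> S x ->
  \forall y \near chart A p x, c1_at (local_rep A Y p) y.
Proof.
move=> oS hY px Sx; apply: filterS (chart_image_nbhsI oS px Sx) => _ [z [pz Sz] <-].
exact: hY.
Qed.

Lemma c1_function_near S h p x : open S -> c1_function S h -> dom A p x -> S x ->
  \forall y \near chart A p x, c1_at (h \o inv_chart A p) y.
Proof.
move=> oS hY px Sx; apply: filterS (chart_image_nbhsI oS px Sx) => _ [z [pz Sz] <-].
exact: hY.
Qed.

Lemma local_rep_sum (J : finType) (c : J -> R) (Y : J -> M -> V) p y :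
  local_rep A (fun x => \sum_j c j *: Y j x) p y = \sum_j c j *: local_rep A (Y j) p y.
Proof. by rewrite /local_rep /coord_change linear_sum; apply: eq_bigr => j _; rewrite linearZ_LR. Qed.

(** With time and space separated, measurability rests on the coefficients and differentiability on
    the finitely many fields. Both the control field and its extension have this form, the latter
    with products of two controls as coefficients. *)
Lemma separated_caratheodory (T : R) (S : set M) (X : R -> M -> V) (J : finType)
    (a : J -> R -> R) (Y : J -> M -> V) : open S ->
  (forall t x, S x -> X t x = \sum_j a j t *: Y j x) ->
  (forall j, c1_field S (Y j)) ->
  (forall j, lebesgue_measurable_fun `[0, T] (a j)) ->
  (forall j t, 0 <= t <= T -> exists e C : R, 0 < e /\ forall s, 0 <= s <= T -> `|s - t| < e -> `|a j s| <= C) ->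
  caratheodory_field B A T [set x | S x.2] X.
Proof.
move=> oS XE Yc am ab t0 p t0T Sp; have pp := c1_dom_mem hM p.
have [d1 d10 D1] := nbhs_ex (chart_image_nbhsI oS pp Sp).
have nd j : \forall y \near chart A p p, differentiable (local_rep A (Y j) p) y.
  by apply: filterS (c1_field_near oS (Yc j) pp Sp) => y [].
have yb j := c1_bounded B (nd j) (Yc j p p pp Sp).
pose K j := projT1 (cid2 (yb j)).
have K0 j : 0 <= K j by rewrite /K; case: cid2.
have [d2 d20 D2] : exists2 d : R, 0 < d & forall r, 0 < r -> r < d -> forall j y, `|y - chart A p p| < r ->
    [/\ differentiable (local_rep A (Y j) p) y, `|local_rep A (Y j) p y| <= K j &
       forall v, `|'d (local_rep A (Y j) p) y v| <= K j * `|v|].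
  apply: uniform_radius => j; rewrite /K; case: cid2 => k k0 [d d0 D] /=.
  by exists d => // r r0 rd y yr; apply: D; exact: lt_trans rd.
have C j := cid (ab j t0 t0T).
pose c j := `|projT1 (cid (projT2 (C j)))|.
have [d3 d30 D3] : exists2 d : R, 0 < d & forall r, 0 < r -> r < d -> forall j s, 0 <= s <= T -> `|s - t0| < r -> `|a j s| <= c j.
  apply: uniform_radius => j; rewrite /c; case: (C j) => e' h /=; case: cid => k [e0 H] /=.
  exists e' => // r r0 rd s sT sr; apply: le_trans (H s sT (lt_trans sr rd)) _; exact: ler_norm.
pose e := Num.min d1 (Num.min (d2 / 2) (d3 / 2)).
have e0 : 0 < e by rewrite !lt_min d10 !divr_gt0.
exists e, (\sum_j c j * K j); split=> //=.
have near y : ball (chart A p p) e y -> [/\ `|y - chart A p p| < d1, `|y - chart A p p| < d2 / 2 & `|y - chart A p p| < d3 / 2].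
  rewrite -ball_normE /= distrC !lt_min => /and3P[]//.
have inS y : ball (chart A p p) e y -> dom A p (inv_chart A p y) /\ S (inv_chart A p y).
  by move=> /near[/D1[z [pz Sz] <-] _ _]; rewrite (c1_chartK hM).
have repE t y : ball (chart A p p) e y -> local_rep A (X t) p y = \sum_j a j t *: local_rep A (Y j) p y.
  by move=> /inS[_ Sy]; rewrite -local_rep_sum /local_rep XE.
have Yd j y : ball (chart A p p) e y -> [/\ differentiable (local_rep A (Y j) p) y, `|local_rep A (Y j) p y| <= K j &
       forall v, `|'d (local_rep A (Y j) p) y v| <= K j * `|v|].
  by move=> /near[_ h _]; apply: (D2 (d2 / 2)) => //; [rewrite divr_gt0|lra].
have nE y : ball (chart A p p) e y -> \forall z \near y, ball (chart A p p) e z.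
  move=> yb'; apply: open_nbhs_nbhs; split=> //; exact: ball_open.
have diffE t y : ball (chart A p p) e y -> differentiable (local_rep A (X t) p) y /\
    forall v, 'd (local_rep A (X t) p) y v = \sum_j a j t *: 'd (local_rep A (Y j) p) y v.
  move=> yb'; have dj j : differentiable (local_rep A (Y j) p) y by have [] := Yd j y yb'.
  have [h1 h2] := diff_combination B (fun j => a j t) dj.
  have [|h3 h4] := @diff_near_eq R V V B _ (local_rep A (X t) p) y h1.
    by apply: filterS (nE y yb') => z /(repE t) ->.
  by split; [exact: h3|move=> v; rewrite h4 h2].
have aK t j : 0 <= t <= T /\ `|t - t0| < e -> `|a j t| <= c j.
  move=> [tT te]; apply: (D3 (d3 / 2)) => //; [by rewrite divr_gt0|lra|].
  by apply: lt_le_trans te _; rewrite /e !ge_min lexx !orbT.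
have mI : measurable ([set t | 0 <= t <= T /\ `|t - t0| < e] :
    set (caratheodory_type (@wlength R idfun)^*%mu)).
  rewrite (_ : [set t | _] = `[0, T] `&` `]t0 - e, t0 + e[).
    by apply: measurableI; exact: measurable_itv_cara.
  by apply/seteqP; split=> t /=; rewrite !in_itv /= ltr_distl.
have m0T : measurable (`[0, T]%classic : set (caratheodory_type (@wlength R idfun)^*%mu)) by exact: measurable_itv_cara.
have am' j : lebesgue_measurable_fun [set t | 0 <= t <= T /\ `|t - t0| < e] (a j).
  by apply: measurable_funS (am j) => // t [tT _] /=; rewrite in_itv.
have vm (w : J -> V) : vector_measurable B [set t | 0 <= t <= T /\ `|t - t0| < e] (fun t => \sum_j a j t *: w j).
  move=> i; rewrite (_ : (fun t => _) = fun t => \sum_j (a j t * coef B i (w j))).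
    by apply: measurable_sum => j; apply: measurable_funM => //; exact: am'.
  by apply/funext => t; rewrite coef_sum; apply: eq_bigr => j _; rewrite coefZ.
split.
- by move=> y /near[/D1[z [pz Sz] <-] _ _]; exists z.
- by move=> t y _ /inS[].
- move=> t y tI yb'; have [h1 h2] := diffE t y yb'; split=> //.
  + rewrite repE//; apply: le_trans (ler_norm_sum _ _ _) _; apply: ler_sum => j _.
    by rewrite normrZ ler_pM//; [exact: aK|have [] := Yd j y yb'].
  + move=> v; rewrite h2 mulr_suml; apply: le_trans (ler_norm_sum _ _ _) _; apply: ler_sum => j _.
    by rewrite normrZ -mulrA ler_pM//; [exact: aK|have [_ _] := Yd j y yb'; exact].
  + move=> v; have [pz Sz] := inS y yb'.
    have yE : chart A p (inv_chart A p y) = y by have [/D1[z [pz' Sz'] <-] _ _] := near y yb'; rewrite (c1_chartK hM).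
    have cj j : {for y, continuous (fun y => 'd (local_rep A (Y j) p) y v)}.
      by rewrite -yE; exact: (Yc j p _ pz Sz).2.
    have sc : (fun z => \sum_j a j t *: 'd (local_rep A (Y j) p) z v) z @[z --> y] --> \sum_j a j t *: 'd (local_rep A (Y j) p) y v.
      elim: (index_enum J) => [|j s IH].
        by rewrite big_nil; under eq_fun do rewrite big_nil; exact: cvg_cst.
      rewrite big_cons; under eq_fun do rewrite big_cons.
      by apply: cvgD => //; apply: cvgZr; exact: cj.
    suff : 'd (local_rep A (X t) p) z v @[z --> y] --> 'd (local_rep A (X t) p) y v by [].
    rewrite h2; apply: cvg_trans sc; apply: near_eq_cvg.
    by apply: filterS (nE y yb') => z /(diffE t)[_ ->].
- move=> y yb'; split; last first.
    move=> v; rewrite (_ : (fun t => _) = fun t => \sum_j a j t *: 'd (local_rep A (Y j) p) y v); first exact: vm.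
    by apply/funext => t; rewrite (diffE t y yb').2.
  rewrite (_ : (fun t => _) = fun t => \sum_j a j t *: local_rep A (Y j) p y); first exact: vm.
  by apply/funext => t; rewrite repE.
Qed.

End SmoothManifolds.

Lemma open_setX (T U : topologicalType) (S : set T) (S' : set U) : open S -> open S' -> open (S `*` S').
Proof.
rewrite !openE => oS oS' [x y] [/oS Sx /oS' Sy]; by exists (S, S').
Qed.

Lemma continuous_pair (S T U : topologicalType) (f : S -> T) (k : S -> U) (x : S) :
  {for x, continuous f} -> {for x, continuous k} -> {for x, continuous (fun y => (f y, k y))}.
Proof.
move=> fc kc P [[P1 P2] /= [h1 h2] H]; have n1 := fc _ h1; have n2 := kc _ h2.
have {}n1 : \forall y \near x, P1 (f y) := n1; have {}n2 : \forall y \near x, P2 (k y) := n2.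
by have : \forall y \near x, P (f y, k y) by apply: filterS2 n1 n2 => y a b; apply: H.
Qed.

(** * The product of the manifold with the cost axis *)

Section Extended.
Context {R : realType} {V : normedModType R} {M : topologicalType}.
Variables (B : coordinates V) (A : atlas V M).
Hypothesis hM : c1_manifold A.
Notation A' := (extended_atlas A).

Lemma c1_at_cst (W U : normedModType R) (w : U) (x : W) : c1_at (fun=> w) x.
Proof.
split; first exact: differentiable_cst.
move=> v; rewrite (_ : (fun y => _) = cst 0); first exact: cst_continuous.
by apply/funext => y; rewrite diff_cst.
Qed.

Lemma c1_atZ (W U : normedModType R) (BW : coordinates W) (c : R) (h : W -> U) (x : W) :
  (\forall y \near x, differentiable h y) -> c1_at h x -> c1_at (fun y => c *: h y) x.
Proof.
move=> nd [hd hc].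
have dZ y : differentiable h y -> differentiable (fun y => c *: h y) y /\
    forall v, 'd (fun y => c *: h y) y v = c *: 'd h y v.
  move=> dy; have [h1 h2] := diff_combination BW (fun _ : 'I_1 => c) (fun _ : 'I_1 => dy).
  have E : (fun z => \sum_(j < 1) c *: h z) = fun z => c *: h z by apply/funext => z; rewrite big_ord1.
  by rewrite E in h1 h2; split=> // v; rewrite h2 big_ord1.
split; first exact: (dZ _ hd).1.
move=> v; suff : 'd (fun y => c *: h y) y v @[y --> x] --> 'd (fun y => c *: h y) x v by [].
rewrite (dZ x hd).2; have sc : c *: 'd h y v @[y --> x] --> c *: 'd h x v by apply: cvgZr; exact: hc.
apply: cvg_trans sc; apply: near_eq_cvg; apply: filterS nd => y yd.
by rewrite (dZ y yd).2.
Qed.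

Lemma extended_transition_c1 p p' (x : M * R) : dom A' p x -> dom A' p' x ->
  c1_at (chart A' p' \o inv_chart A' p) (chart A' p x).
Proof.
move=> [px _] [p'x _].
rewrite (_ : chart A' p' \o inv_chart A' p =
  fun y : V * R^o => (transition A p.1 p'.1 y.1, (fun=> 0 : R^o) y.1 + 1 *: y.2) : V * R^o); last first.
  by apply/funext => y /=; congr pair; rewrite add0r scale1r.
apply: (@c1_at_triangular R V V B (transition A p.1 p'.1) (fun=> 0 : R^o) 1 (chart A' p x)).
- apply: filterS (near_dom2 hM px p'x) => y [py yE p'y]; split; last exact: differentiable_cst.
  by rewrite -yE; have [] := c1_transition hM py p'y.
- exact: (c1_transition hM px p'x).
- exact: c1_at_cst.
Qed.

Lemma extended_c1_manifold : c1_manifold A'.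
Proof.
split.
- move=> [x r] [y s] H; have Rh : hausdorff_space R by exact: Rhausdorff.
  congr pair.
    apply: (c1_hausdorff hM) => U W xU yW.
    have [[z1 z2] /= [h1 h2]] := H [set z | U z.1] [set z | W z.1] (@near_fst M R (x, r) U xU) (@near_fst M R (y, s) W yW).
    by exists z1.
  apply: Rh => U W xU yW.
  have [[z1 z2] /= [h1 h2]] := H [set z | U z.2] [set z | W z.2] (@near_snd M R (x, r) U xU) (@near_snd M R (y, s) W yW).
  by exists z2.
- by move=> p; apply: open_setX; [exact: c1_dom_open hM _|exact: openT].
- by move=> p; split=> //; exact: c1_dom_mem.
- move=> p; rewrite (_ : _ @` _ = (chart A p.1 @` dom A p.1) `*` setT).
    by apply: open_setX; [exact: c1_image_open hM _|exact: openT].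
  apply/seteqP; split=> [_ [x [px _] <-]|[y r] /= [[x px E] _]]; first by split=> //; exists x.1.
  by exists (x, r) => //=; rewrite E.
- by move=> p [x r] [px _] /=; rewrite (c1_chartK hM).
- move=> p x [px _]; apply: continuous_pair => U.
    by move=> /(c1_chart_cts hM px) xU; exact: (@near_fst M R x _ xU).
  exact: (@near_snd M R).
- move=> p x [px _]; apply: continuous_pair => U.
    by move=> /(c1_inv_cts hM px) xU; exact: (@near_fst V R (chart A' p x) _ xU).
  exact: (@near_snd V R).
- by move=> p p' x px p'x; exact: extended_transition_c1.
Qed.

Lemma extended_coord_change (x p : M * R) v r : dom A p.1 x.1 ->
  coord_change A' x p (v, r) = (coord_change A x.1 p.1 v, r).
Proof.
move=> px; have xx := c1_dom_mem hM x.1; have [d _] := c1_transition hM xx px.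
have [_ E] := @diff_triangular R V V B (transition A x.1 p.1) (fun=> 0 : R^o) 1 (chart A' x x) d (differentiable_cst _ _).
have Ef : chart A' p \o inv_chart A' x = fun y : V * R^o => (transition A x.1 p.1 y.1, 0 + 1 *: y.2).
  by apply/funext => y /=; congr pair; rewrite add0r scale1r.
by rewrite /coord_change Ef E diff_cst /= add0r scale1r.
Qed.

Lemma extended_local_rep (Y : M -> V) (h : M -> R^o) p (y : V * R^o) : dom A p.1 (inv_chart A p.1 y.1) ->
  local_rep A' (fun x => (Y x.1, h x.1)) p y = (local_rep A Y p.1 y.1, h (inv_chart A p.1 y.1)).
Proof. by move=> py; rewrite /local_rep extended_coord_change. Qed.

Lemma extended_c1_field (S : set M) (Y : M -> V) (h : M -> R^o) : open S ->
  c1_field A S Y -> c1_function A S h ->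
  c1_field A' [set x | S x.1] (fun x => (Y x.1, h x.1)).
Proof.
move=> oS Yc hc p x [px _] Sx.
have nd : \forall y \near chart A p.1 x.1, c1_at (local_rep A Y p.1) y /\ c1_at (h \o inv_chart A p.1) y.
  by apply: filterS2 (c1_field_near hM oS Yc px Sx) (c1_function_near hM oS hc px Sx).
have nd' : \forall y \near (chart A' p x).1, differentiable (local_rep A Y p.1) y /\ differentiable (h \o inv_chart A p.1) y.
  by apply: filterS nd => y [[h1 _] [h2 _]].
apply: (c1_at_eq (product_coordinates B)).
(* Coefficient 0: the field is independent of the cost coordinate. For transition maps the
   coefficient is 1. *)
- exact: (c1_at_triangular B 0 nd' (Yc _ _ px Sx) (hc _ _ px Sx)).
- have := @near_fst V R^o (chart A' p x) _ nd'.
  by apply: filterS => y [h1 h2]; exact: (diff_triangular B 0 h1 h2).1.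
- have := @near_fst V R^o (chart A' p x) _ (near_dom hM px).
  apply: filterS => y [py yE]; rewrite extended_local_rep//.
  by congr pair; rewrite scale0r addr0.
Qed.

End Extended.

Lemma row_caratheodory (R : realType) (n : nat) (Q : topologicalType) (A : atlas 'rV[R]_n Q)
  (T : R) (O : set (R * Q)) (X : R -> Q -> 'rV[R]_n) :
  caratheodory A T O X -> caratheodory_field row_coordinates A T O X.
Proof.
move=> hX t0 p t0T Op; have [e [C [e0 [h1 h2 h3 h4]]]] := hX t0 p t0T Op.
exists e, C; split=> //; split=> // x Nx.
by split=> [i|v i]; have [H1 H2] := h4 x i Nx; [exact: H1|exact: H2].
Qed.

(** * The control field and its extension as Caratheodory fields *)

Section SubRiemannianFields.
Context {R : realType} {n d : nat} {Q : topologicalType}.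
Variables (A : atlas 'rV[R]_n Q) (g : Q -> 'rV[R]_n -> 'rV[R]_n -> R).
Variables (D : Q -> {vspace 'rV[R]_n}) (W : set Q) (f : 'I_d -> Q -> 'rV[R]_n).
Variables (T : R) (u : R -> 'rV[R]_d).
Hypotheses (hM : c1_manifold A) (hg : sr_metric A D g) (hf : local_frame A D W f).
Hypothesis hu : admissible_control T u.

Let oW : open W. Proof. by have [] := hf. Qed.

Lemma frame_mem x i : W x -> f i x \in D x.
Proof. by have [_ _ E] := hf; move=> /E ->; apply: memv_span; apply/mapP; exists i; rewrite ?mem_enum. Qed.

Lemma frame_c1 i : c1_field A W (f i).
Proof. by have [_ fs _] := hf; exact: smooth_c1_field. Qed.

Lemma control_field_mem x v : W x -> control_field f v x \in D x.
Proof. by move=> Wx; apply: rpred_sum => i _; apply: rpredZ; exact: frame_mem. Qed.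

Let umeas i : lebesgue_measurable_fun `[0, T] (fun t => u t ord0 i).
Proof. exact: hu.1. Qed.

Let ubound i t : 0 <= t <= T -> exists e C : R, 0 < e /\ forall s, 0 <= s <= T -> `|s - t| < e -> `|u s ord0 i| <= C.
Proof.
move=> /hu.2[e [C [e0 H]]]; exists e, C; split=> // s sT st.
exact: le_trans (norm_entry_le _ _) (H s sT st).
Qed.

Lemma control_caratheodory :
  caratheodory_field row_coordinates A T (frame_domain W) (fun t => control_field f (u t)).
Proof.
by apply: (@separated_caratheodory R _ Q row_coordinates A hM T W (fun t => control_field f (u t)) 'I_d
  (fun i t => u t ord0 i) f oW _ frame_c1 umeas ubound).
Qed.

(** Writing the cost as a quadratic form in the control separates time from space. *)
Lemma lagrangianE x v : W x -> lagrangian g f x v =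
  \sum_(ij : 'I_d * 'I_d) (v ord0 ij.1 * v ord0 ij.2) * (2^-1 * g x (f ij.1 x) (f ij.2 x)).
Proof.
move=> Wx; have gsum (J : finType) (c : J -> R) (z : J -> 'rV[R]_n) w : (forall j, z j \in D x) -> w \in D x ->
    g x (\sum_j c j *: z j) w = \sum_j c j * g x (z j) w.
  move=> zD wD; have g0 : g x 0 w = 0.
    by have := srg_linear hg 1 (mem0v _) (mem0v _) wD; rewrite scaler0 addr0 mul1r => /eqP; rewrite -subr_eq0 opprD addrA subrr sub0r oppr_eq0 => /eqP.
  suff [] : \sum_j c j *: z j \in D x /\ g x (\sum_j c j *: z j) w = \sum_j c j * g x (z j) w by [].
  elim: (index_enum J) => [|j s [IH1 IH2]]; first by rewrite !big_nil mem0v.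
  rewrite !big_cons; split; first by apply: rpredD => //; exact: rpredZ.
  by rewrite (srg_linear hg)// IH2.
have fD i := frame_mem i Wx; have uD := control_field_mem v Wx.
rewrite /lagrangian {1}/control_field gsum//.
rewrite [RHS](eq_bigr (fun ij => 2^-1 * (v ord0 ij.1 * (v ord0 ij.2 * g x (f ij.1 x) (f ij.2 x))))); last first.
  by move=> ij _; ring.
rewrite -mulr_sumr; congr (_ * _); rewrite -(pair_big xpredT xpredT (fun i j => v ord0 i * (v ord0 j * g x (f i x) (f j x)))) /=.
apply: eq_bigr => i _; rewrite -mulr_sumr; congr (_ * _).
rewrite (srg_sym hg)//; rewrite /control_field gsum//; apply: eq_bigr => j _.
by rewrite (srg_sym hg).
Qed.

Lemma extended_caratheodory : caratheodory_field (product_coordinates row_coordinates) (extended_atlas A) T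
  (extended_domain W) (fun t => extended_field g f (u t)).
Proof.
(* Left indices are the linear monomials in [u], which drive the point of [Q]; right indices are the
   quadratic ones, which drive the cost. *)
pose J := ('I_d + 'I_d * 'I_d)%type.
pose a (j : J) t := match j with inl i => u t ord0 i | inr ij => u t ord0 ij.1 * u t ord0 ij.2 end.
pose Y (j : J) (x : Q * R) : 'rV[R]_n * R^o :=
  match j with inl i => (f i x.1, 0) | inr ij => (0, 2^-1 * g x.1 (f ij.1 x.1) (f ij.2 x.1)) end.
have gc ij : c1_function A W (fun x => 2^-1 * g x (f ij.1 x) (f ij.2 x) : R^o).
  have [_ fs _] := hf.
  have := smooth_c1_function hM oW (srg_smooth hg oW (fs ij.1) (fs ij.2) (fun p Wp => conj (frame_mem ij.1 Wp) (frame_mem ij.2 Wp))).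
  move=> H p x px Wx.
  apply: (c1_atZ row_coordinates 2^-1 _ (H p x px Wx)).
  by apply: filterS (c1_function_near hM oW H px Wx) => y [].
have c0 : c1_field A W (fun=> 0).
  move=> p x _ _; rewrite (_ : local_rep _ _ _ = fun=> 0); first exact: c1_at_cst.
  by apply/funext => y; rewrite /local_rep /coord_change linear0.
apply: (@separated_caratheodory R _ _ (product_coordinates row_coordinates) _ (extended_c1_manifold row_coordinates hM)
  T [set x | W x.1] (fun t => extended_field g f (u t)) _ a Y).
- by have := @open_setX _ _ W [set: R] oW openT; rewrite (_ : W `*` setT = [set x | W x.1])//; apply/seteqP; split=> x; [case|].
- move=> t x Wx; rewrite big_sumType /= /extended_field lagrangianE//.
  have -> : \sum_i u t ord0 i *: ((f i x.1, 0) : 'rV[R]_n * R^o) = (control_field f (u t) x.1, 0).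
    rewrite /control_field; elim/big_rec2: _ => // i y z _ ->.
    by congr pair => /=; rewrite scaler0 add0r.
  have -> : \sum_(ij : 'I_d * 'I_d) (u t ord0 ij.1 * u t ord0 ij.2) *: ((0, 2^-1 * g x.1 (f ij.1 x.1) (f ij.2 x.1)) : 'rV[R]_n * R^o) =
     (0, \sum_(ij : 'I_d * 'I_d) (u t ord0 ij.1 * u t ord0 ij.2) * (2^-1 * g x.1 (f ij.1 x.1) (f ij.2 x.1))).
    elim/big_rec2: _ => // i y z _ ->.
    by congr pair => /=; rewrite scaler0 add0r.
  by congr pair => /=; rewrite ?addr0 ?add0r.
- case=> [i|ij].
    apply: (extended_c1_field row_coordinates hM oW (@frame_c1 i) (h := fun=> 0)).
    by move=> p x _ _; exact: c1_at_cst.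
  exact: (extended_c1_field row_coordinates hM oW c0 (@gc ij)).
- case=> [i|[i j]]; first exact: umeas.
  by apply: measurable_funM; exact: umeas.
- case=> [i|[i j]] t tT; first exact: ubound.
  have [e1 [C1 [e10 H1]]] := ubound i tT; have [e2 [C2 [e20 H2]]] := ubound j tT.
  exists (Num.min e1 e2), (C1 * C2); split; first by rewrite lt_min e10.
  move=> s sT; rewrite lt_min => /andP[s1 s2]; rewrite normrM ler_pM//; [exact: H1|exact: H2].
Qed.

End SubRiemannianFields.

Section ProductCurves.
Context {R : realType} {V W : normedModType R}.

Lemma der_pair (f : R -> V) (h : R -> W) t v w : der f t v -> der h t w ->
  der (fun s => (f s, h s)) t (v, w).
Proof.
move=> fv hw e e0; have [d1 d10 D1] := fv e e0; have [d2 d20 D2] := hw e e0.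
exists (Num.min d1 d2); first by rewrite lt_min d10.
move=> s; rewrite lt_min => /andP[s1 s2].
by apply: norm_pair_le => /=; [exact: D1|exact: D2].
Qed.

Lemma der_fst (f : R -> (V * W)%type) t z : der f t z -> der (fun s => (f s).1) t z.1.
Proof.
move=> fz e e0; have [d d0 D] := fz e e0; exists d => // s sd.
exact: le_trans (norm_fst_le (f s - f t - (s - t) *: z)) (D s sd).
Qed.

Lemma near_line (x z : V) (P : V -> Prop) : (\forall y \near x, P y) ->
  exists2 d : R, 0 < d & forall r : R, `|r| < d -> P (x + r *: z).
Proof.
move=> /nbhs_ex[d d0 D]; have z0 : 0 < `|z| + 1 by rewrite ltr_wpDl.
exists (d / (`|z| + 1)); first by rewrite divr_gt0.
move=> r; rewrite ltr_pdivlMr// => rd; apply: D.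
rewrite [x + _]addrC addrK normrZ; apply: le_lt_trans rd.
by rewrite ler_wpM2l// lerDl.
Qed.

Lemma abs_continuous_on_pair (I : set R) (f : R -> V) (h : R -> W) :
  abs_continuous_on I f -> abs_continuous_on I h -> abs_continuous_on I (fun s => (f s, h s)).
Proof.
move=> fI hI e e0; have e2 : 0 < e / 2 by rewrite divr_gt0.
have [d1 d10 D1] := fI _ e2; have [d2 d20 D2] := hI _ e2.
exists (Num.min d1 d2); first by rewrite lt_min d10.
move=> k a b ab dis; rewrite lt_min => /andP[s1 s2].
have := D1 k a b ab dis s1; have := D2 k a b ab dis s2 => h2 h1.
apply: (@le_lt_trans _ _ (\sum_(i < k) (`|f (b i) - f (a i)| + `|h (b i) - h (a i)|))).
  apply: ler_sum => i _; apply: norm_pair_le => /=; first by rewrite lerDl.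
  by rewrite lerDr.
by rewrite big_split /=; lra.
Qed.

Lemma abs_continuous_on_fst (I : set R) (f : R -> (V * W)%type) :
  abs_continuous_on I f -> abs_continuous_on I (fun s => (f s).1).
Proof.
move=> fI e e0; have [d d0 D] := fI e e0; exists d => // k a b ab dis s1.
apply: le_lt_trans (D k a b ab dis s1); apply: ler_sum => i _.
exact: (norm_fst_le (f (b i) - f (a i))).
Qed.

End ProductCurves.

(** * The trajectory and flow of the extended system *)

Section ExtendedTrajectory.
Context {R : realType} {n d : nat} {Q : topologicalType}.
Variables (A : atlas 'rV[R]_n Q) (g : Q -> 'rV[R]_n -> 'rV[R]_n -> R).
Variables (D : Q -> {vspace 'rV[R]_n}) (W : set Q) (f : 'I_d -> Q -> 'rV[R]_n).
Variables (T : R) (u : R -> 'rV[R]_d) (qq : R -> Q * R).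
Hypotheses (hM : c1_manifold A) (hg : sr_metric A D g) (hf : local_frame A D W f).
Hypotheses (hT : 0 < T) (hu : admissible_control T u) (hqq : sr_trajectory A g W f T u qq).
Notation mu := (@lebesgue_measure R).
Notation A' := (extended_atlas A).
Notation q := (fun t => (qq t).1).
Notation fu := (fun t => control_field f (u t)).
Notation fu' := (fun t => extended_field g f (u t)).
Notation Br := (@row_coordinates R n).
Notation Bp := (product_coordinates (@row_coordinates R n)).

Let hM' : c1_manifold A' := extended_c1_manifold Br hM.
Let hX : caratheodory_field Br A T (frame_domain W) fu := control_caratheodory hM hf hu.
Let hX' : caratheodory_field Bp A' T (extended_domain W) fu' := extended_caratheodory hM hg hf hu.
Let hq : integral_curve A (frame_domain W) fu 0 T q := hqq.1.
Let T0 : 0 <= T := ltW hT.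

Let ell t := lagrangian g f (qq t).1 (u t).

(** This has to precede any regularity of the cost component of [qq], which is only given as an
    integral. The integrand is the cost component of the extended field in a chart, where
    superposition and the flow-box bound apply. *)
Lemma lagrangian_along : lebesgue_measurable_fun `[0, T] ell /\
  exists K : R, forall t, 0 <= t <= T -> `|ell t| <= K.
Proof.
apply: (@cousin R (fun x y => lebesgue_measurable_fun `[x, y] ell /\
   exists K : R, forall t, x <= t <= y -> `|ell t| <= K)) => //.
- move=> x y z x0 xy yz zT [m1 [K1 H1]] [m2 [K2 H2]]; split.
    have -> : `[x, z]%classic = `[x, y] `|` `[y, z] :> set R.
      apply/seteqP; split=> t /=; rewrite !in_itv /=.
        by move=> /andP[xt tz]; have [ty|/ltW yt] := leP t y; [left|right]; apply/andP.
      by case=> /andP[h1 h2]; apply/andP; split=> //; [exact: le_trans yz|exact: le_trans h1].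
    by apply/measurable_funU; [exact: measurable_itv_cara|exact: measurable_itv_cara|split].
  exists (Num.max K1 K2) => t /andP[xt tz]; rewrite le_max.
  by have [ty|/ltW yt] := leP t y; [rewrite H1 ?xt|rewrite H2 ?yt// orbT].
- move=> t0 t0T; have Wq := integral_curve_dom hq t0T.
  have [r1 [rho1 [C1 [L1 b1]]]] := flow_box_exists hX t0T Wq.
  have [r [rho [C [L b2]]]] := flow_box_exists (t0 := t0) (p := (q t0, 0)) hX' t0T Wq.
  have [e e0 E] := local_chart_solution hM hq (lexx _) (lexx _) t0T b1 (fb_rho b2).
  have r0 := fb_r b2.
  exists (Num.min e r); first by rewrite lt_min e0.
  move=> a b a0 at0 t0b bT; rewrite lt_min => /andP[be br]; have ab := le_trans at0 t0b.
  have [||[cd cl _] cn] := E a b a0 ab bT; [lra|lra|].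
  set p := q t0 in cd cl cn b2 Wq *.
  (* The cost coordinate is frozen at 0: the field does not depend on it, and [y] is Lipschitz
     because [q] is. *)
  pose y (t : R) : 'rV[R]_n * R^o := (chart A p (q t), 0).
  have yl : lip_on a b y.
    have [K HK] := cl; exists K => s t sab tab; apply: norm_pair_le => /=; first exact: HK.
    by rewrite subrr normr0; apply: le_trans (HK _ _ sab tab).
  have yS t : a <= t <= b -> `|y t - chart A' (p, 0) (p, 0)| < rho.
    move=> tab; apply: (@le_lt_trans _ _ `|chart A p (q t) - chart A p p|); last exact: cn.
    by apply: norm_pair_le => //=; rewrite subrr normr0.
  have nr t : a <= t <= b -> 0 <= t <= T /\ `|t - t0| < r.
    move=> /andP[at_ tb]; split; first by apply/andP; split; lra.
    by rewrite ltr_norml; apply/andP; split; lra.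
  have E2 t : a <= t <= b -> (local_rep A' (fu' t) (p, 0) (y t)).2 = ell t.
    move=> tab; have pt := (cd t tab).1.
    have iE := c1_chartK hM pt.
    have := @extended_local_rep _ _ _ Br _ hM (fu t) (lagrangian g f ^~ (u t)) (p, 0) (y t).
    by rewrite /= iE => /(_ pt) ->.
  split; last first.
    exists C => t tab; rewrite -E2//; apply: le_trans (norm_snd_le _) _.
    by have [h1 h2] := nr t tab; apply: (fb_bound b2) => //; exact: yS.
  have ms : vector_measurable Bp `[a, b] (fun t => local_rep A' (fu' t) (p, 0) (y t)).
    apply: (@superposition_measurable _ _ Bp (fun t => local_rep A' (fu' t) (p, 0)) a b L [set x | `|x - chart A' (p, 0) (p, 0)| < rho] (fb_L b2)) => //.
    - by move=> t x z /nr[h1 h2]; exact: (fb_lip b2).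
    - by move=> x xS; apply: (fb_meas b2) => //; lra.
  have := ms ord0; rewrite /= unlift_none => ms0.
  apply: eq_measurable_fun ms0 => t; rewrite inE /= in_itv /= => tab; exact: E2.
Qed.

Lemma extended_integral_curve : integral_curve A' (extended_domain W) fu' 0 T qq.
Proof.
have [cO cac cv] := hq; have [ml [K HK]] := lagrangian_along.
have q2 t : 0 <= t <= T -> (qq t).2 = primitive ell 0 t by exact: hqq.2.
have ql : lip_on 0 T (fun t => (qq t).2 : R^o).
  exists K; apply: lipschitz_ordered => s t s0 st tT.
  rewrite !q2 ?s0 ?(le_trans s0) ?(le_trans st)//; exact: (primitive_lipschitz ml HK s0 st tT).
split=> //.
- move=> t tT; have [e e0 /= [ed eac]] := cac t tT; exists e => //=; split.
    by move=> s /ed.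
  apply: (abs_continuous_on_pair eac (h := fun t => (qq t).2 : R^o)).
  by apply: lip_on_abs_continuous ql => s [].
- apply: ae_closed_interval; apply: ae_impl2 cv (primitive_der ml HK) => t h1 h2 tT.
  have tT' : 0 <= t <= T by case/andP: tT => t0 t1; rewrite !ltW.
  apply/is_derive_der; have /is_derive_der h4 := h1 tT'.
  apply: (der_pair (h := fun t => (qq t).2 : R^o) h4).
  by apply: der_eq_interior tT _ (h2 tT) => s sT; rewrite q2.
Qed.

Lemma extended_curve_fst a b c : integral_curve A' (extended_domain W) fu' a b c ->
  integral_curve A (frame_domain W) fu a b (fun t => (c t).1).
Proof.
move=> [cO cac cv]; split=> //.
- move=> t tab; have [e e0 /= [ed eac]] := cac t tab; exists e => //=; split.
    by move=> s /ed[].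
  exact: abs_continuous_on_fst eac.
- apply: ae_impl cv => t ct /ct /is_derive_der/der_fst h.
  by apply/is_derive_der; exact: h.
Qed.

Notation F := (control_flow A W f u).
Notation F' := (extended_flow A g W f u).
Notation DF t tau := (tangent_map A (control_flow A W f u t tau) (qq tau).1).
Notation DF' t tau := (extended_transport A g W f u qq t tau).

Let hq' := extended_integral_curve.

(** Near [qq tau] an extended integral curve projects to one of [f_u], so uniqueness makes the
    projected extended flow equal to the flow of the projection. The derivatives are compared along
    the line in direction [z]. *)
Lemma extended_transport_fst t tau z : 0 <= t <= T -> 0 <= tau <= T -> (DF' t tau z).1 = DF t tau z.1.
Proof.
move=> tT sT.
have [_ d1] := flow_tangent_exists hM hX T0 hq tT sT.
have [_ d2] := flow_tangent_exists hM' hX' T0 hq' tT sT.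
have E1 := flow_reference hM hX hq tT sT.
have E2 := flow_reference hM' hX' hq' tT sT.
have n1 : \forall x \near qq tau, F t tau x.1 = (F' t tau x).1.
  apply: filterS (near_flow_curve hM' hX' T0 hq' sT) => x [c [ci cx cF]].
  by rewrite /extended_flow cF// -cx; exact: (flow_eq hM hX (lexx _) (lexx _) (extended_curve_fst ci)).
have xx : dom A' (qq tau) (qq tau) := c1_dom_mem hM' _.
have [dl dl0 L] := near_line z (near_inv_chart hM' xx n1).
apply: (der_uniq (der_fst (der_line Bp z d2))).
apply: der_eq (der_line Br z.1 d1); exists dl => // r; rewrite subr0 => /L.
by rewrite /= E1 E2 /= => <-.
Qed.

End ExtendedTrajectory.

(** * Spans along the curve and abnormal extremals *)

Section Subspaces.
Context {R : realType} {n : nat}.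
Implicit Types (S : set 'rV[R]_n) (U : {vspace 'rV[R]_n}).

Lemma linear_span_sub S v : S v -> linear_span S v.
Proof. by move=> Sv; exists 1%N, (fun=> 1), (fun=> v); rewrite big_ord1 scale1r. Qed.

Lemma linear_span0 S : linear_span S 0.
Proof. by exists 0%N, (fun=> 0), (fun=> 0); split=> [[]|]; rewrite ?big_ord0. Qed.

Lemma linear_spanP S a v w : linear_span S v -> linear_span S w -> linear_span S (a *: v + w).
Proof.
move=> [k1 [a1 [v1 [S1 ->]]]] [k2 [a2 [v2 [S2 ->]]]].
exists (k1 + k2)%N, (fun i => match fintype.split i with inl j => a * a1 j | inr j => a2 j end),
  (fun i => match fintype.split i with inl j => v1 j | inr j => v2 j end).
split; first by move=> i; case: fintype.split.
rewrite big_split_ord /= scaler_sumr; congr (_ + _); apply: eq_bigr => i _.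
  by rewrite (unsplitK (inl i)) scalerA.
by rewrite (unsplitK (inr i)).
Qed.

Lemma linear_span_min S B : B 0 -> (forall a v w, B v -> B w -> B (a *: v + w)) ->
  S `<=` B -> linear_span S `<=` B.
Proof.
move=> B0 Bl SB _ [k [a [v [Sv ->]]]]; elim/big_rec: _ => // i x _ Bx.
by apply: Bl => //; exact: SB.
Qed.

(** Among the [vspace]s contained in [S] take one of maximal dimension; a vector of [S] outside it
    could be added. *)
Lemma subspace_vspace S : S 0 -> (forall a v w, S v -> S w -> S (a *: v + w)) ->
  exists U, S = [set v | v \in U].
Proof.
move=> S0 Sl; pose P k := `[< exists U, \dim U = k /\ forall v, v \in U -> S v >].
have exP : exists k, P k.
  by exists 0%N; apply/asboolP; exists 0%VS; rewrite dimv0; split=> // v; rewrite memv0 => /eqP ->.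
have bP k : P k -> (k <= \dim (@fullv R 'rV[R]_n))%N.
  by move=> /asboolP[U [<- _]]; apply: dimvS; exact: subvf.
case: (ex_maxnP exP bP) => k /asboolP[U [dU US]] kmax.
exists U; apply/seteqP; split=> v /=; last exact: US.
move=> Sv; apply/negPn/negP => vU; pose U' := (U + <[v]>)%VS.
have PU' : P (\dim U').
  apply/asboolP; exists U'; split=> // w /memv_addP[x xU [_ /vlineP[c ->] ->]].
  by rewrite addrC; apply: Sl => //; exact: US.
have := kmax _ PU'; rewrite -dU leqNgt => /negP; apply.
rewrite (ltn_leqif (dimv_leqif_sup (addvSl U <[v]>))).
apply/negP => /subvP/(_ v) H; move: vU; rewrite H//.
by apply: (subvP (addvSr U <[v]>)); exact: memv_line.
Qed.

(** Some entry of [z - projv U z] is nonzero, and that entry of [v - projv U v] is the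
    functional. *)
Lemma separating_functional U z : z \notin U ->
  exists2 l : {linear 'rV[R]_n -> R^o}, (forall v, v \in U -> l v = 0) & l z != 0.
Proof.
move=> zU; have z0 : z - projv U z != 0.
  by apply: contra zU; rewrite subr_eq0 => /eqP ->; exact: memv_proj.
have [i zi] : exists i, (z - projv U z) ord0 i != 0.
  apply: contrapT => H; move: z0; apply/negP/negPn/eqP/rowP => i.
  by rewrite [RHS]mxE; apply/eqP; apply: contrapT => /negP h; apply: H; exists i.
have [l lE] : {l : {linear 'rV[R]_n -> R^o} | forall v, l v = (v - projv U v) ord0 i}.
  apply: mk_linear => a v w; rewrite linearP.
  have -> : a *: v + w - (a *: projv U v + projv U w) = a *: (v - projv U v) + (w - projv U w) by zmod.
  by rewrite mxE mxE.
by exists l => [v vU|]; rewrite lE// projv_id// subrr mxE.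
Qed.

Lemma dimv_lt_ex U : (\dim U < n)%N <-> exists z, z \notin U.
Proof.
have dn : \dim (@fullv R 'rV[R]_n) = n by rewrite dimvf /dim /= mul1n.
rewrite -[X in (_ < X)%N]dn (ltn_leqif (dimv_leqif_sup (subvf U))); split=> [|[z]].
  by move=> /subvPn[z _ zU]; exists z.
by move=> zU; apply: contra zU => /subvP; apply; exact: memvf.
Qed.

End Subspaces.

(** * The smallest invariant distribution *)

Section FlowSpan.
Context {R : realType} {n : nat} {Q : topologicalType}.
Variables (A : atlas 'rV[R]_n Q) (D : Q -> {vspace 'rV[R]_n}).
Hypothesis hM : c1_manifold A.
Variables (T : R) (O : set (R * Q)) (X : R -> Q -> 'rV[R]_n).
Hypothesis hX : caratheodory_field row_coordinates A T O X.
Hypothesis T0 : 0 <= T.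
Variable q : R -> Q.
Hypothesis hq : integral_curve A O X 0 T q.
Notation F := (flow A O X).
Notation DF t tau := (tangent_map A (flow A O X t tau) (q tau)).
Notation B := (flow_span A T q (flow A O X) D).

Lemma flow_span_linear t a v w : B t v -> B t w -> B t (a *: v + w).
Proof. exact: linear_spanP. Qed.

Lemma flow_span_vspace t : exists U : {vspace 'rV[R]_n}, B t = [set v | v \in U].
Proof. by apply: subspace_vspace; [exact: linear_span0|exact: flow_span_linear]. Qed.

Lemma flow_span_min t (S : set 'rV[R]_n) : S 0 -> (forall a v w, S v -> S w -> S (a *: v + w)) ->
  (forall tau Y, 0 <= tau <= T -> Y \in D (q tau) -> S (DF t tau Y)) -> B t `<=` S.
Proof. by move=> S0 Sl SD; apply: linear_span_min => // _ [tau [Y [tT YD ->]]]; exact: SD. Qed.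

Lemma flow_span_kill t (l : {linear 'rV[R]_n -> R^o}) :
  (forall tau Y, 0 <= tau <= T -> Y \in D (q tau) -> l (DF t tau Y) = 0) -> forall v, B t v -> l v = 0.
Proof.
move=> lD; apply: (@flow_span_min t [set v | l v = 0]) => //=; first exact: linear0.
by move=> a v w /= lv lw; rewrite linearP lv lw scaler0 addr0.
Qed.

Lemma flow_span_mem t tau Y : 0 <= tau <= T -> Y \in D (q tau) -> B t (DF t tau Y).
Proof. by move=> tT YD; apply: linear_span_sub; exists tau, Y. Qed.

Lemma flow_span_transport t tau v : 0 <= t <= T -> 0 <= tau <= T -> B tau v -> B t (DF t tau v).
Proof.
move=> tT sT; move: v; apply: (@flow_span_min tau [set v | B t (DF t tau v)]) => /=.
- by rewrite /tangent_map linear0; exact: linear_span0.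
- by move=> a v w hv hw; rewrite flow_tangent_linear; exact: flow_span_linear.
- by move=> r Y rT YD; rewrite (flow_tangent_comp hM hX T0 hq); [exact: flow_span_mem| | |].
Qed.

Lemma flow_span_smallest : smallest_invariant A T q F D B.
Proof.
split.
- by move=> t tT; split; [exact: linear_span0|exact: flow_span_linear].
- move=> t tau tT sT; apply/seteqP; split=> [v Bv|_ [v Bv <-]]; last exact: flow_span_transport.
  exists (DF tau t v); first exact: flow_span_transport.
  by rewrite (flow_tangent_comp hM hX T0 hq)// (flow_tangent_id hM hX T0 hq).
- move=> t tT v vD; rewrite -(flow_tangent_id hM hX T0 hq v tT).
  exact: flow_span_mem.
- move=> B' B'l B'i B'D t tT; have [B'0 B'P] := B'l t tT.
  apply: flow_span_min => // tau Y sT YD; rewrite (B'i t tau tT sT); exists Y => //.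
  exact: B'D.
Qed.

End FlowSpan.

(** * Frames and independence of the extension *)

Section Frame.
Context {R : realType} {n d : nat} {Q : topologicalType}.
Variables (A : atlas 'rV[R]_n Q) (D : Q -> {vspace 'rV[R]_n}).
Variables (W : set Q) (f : 'I_d -> Q -> 'rV[R]_n).
Hypotheses (hM : c1_manifold A) (hf : local_frame A D W f) (hD : forall p, \dim (D p) = d).

Let F x : d.-tuple 'rV[R]_n := [tuple f i x | i < d].

Let FE x (i : 'I_d) : (F x)`_i = f i x.
Proof. by rewrite -tnth_nth tnth_mktuple. Qed.

Let Fspan x : W x -> D x = <<F x>>%VS.
Proof. by have [_ _ E] := hf; move=> /E. Qed.

Lemma frame_combination x v : W x -> v \in D x -> v = \sum_i coord (F x) i v *: f i x.
Proof.
move=> Wx; rewrite (Fspan Wx) => /coord_span {1}->.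
by apply: eq_bigr => i _; rewrite FE.
Qed.

(** [d] vectors that span a space of dimension [d] are free; the constant rank of the distribution
    enters here. *)
Lemma frame_dual x i j : W x -> coord (F x) j (f i x) = (i == j)%:R.
Proof.
move=> Wx; rewrite -FE coord_free; first by rewrite eq_sym.
by rewrite /free -(Fspan Wx) hD size_tuple.
Qed.

Lemma frame_kill x (l : {linear 'rV[R]_n -> R^o}) : W x -> (forall i, l (f i x) = 0) ->
  forall v, v \in D x -> l v = 0.
Proof.
move=> Wx lf v vD; rewrite (frame_combination Wx vD) linear_sum big1// => i _.
by rewrite linearZ_LR lf scaler0.
Qed.

(** [frame_difference] transported to the manifold: the difference of two [D]-valued fields that
    agree at [q t] is a combination of the frame near that point and vanishes there. *)
Lemma equal_fields_derivative (O1 O2 : set (R * Q)) (X1 X2 : R -> Q -> 'rV[R]_n)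
    (q : R -> Q) t p (l : {linear 'rV[R]_n -> R^o}) w :
  open O1 -> open O2 -> O1 (t, q t) -> O2 (t, q t) -> W (q t) -> X1 t (q t) = X2 t (q t) ->
  (forall x, O1 (t, x) -> X1 t x \in D x) -> (forall x, O2 (t, x) -> X2 t x \in D x) ->
  dom A p (q t) ->
  differentiable (local_rep A (X1 t) p) (chart A p (q t)) ->
  differentiable (local_rep A (X2 t) p) (chart A p (q t)) ->
  (forall v, v \in D (q t) -> l v = 0) ->
  l ('d (transition A p (q t)) (chart A p (q t))
    ('d (local_rep A (X2 t) p) (chart A p (q t)) w - 'd (local_rep A (X1 t) p) (chart A p (q t)) w)) = 0.
Proof.
move=> oO1 oO2 O1q O2q Wq XE X1D X2D pq d1 d2 lD.
have [oW fs _] := hf.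
pose x0 := chart A p (q t); pose Z y := local_rep A (X2 t) p y - local_rep A (X1 t) p y.
have Zd : differentiable Z x0 by exact: differentiableB.
have ZE v : 'd Z x0 v = 'd (local_rep A (X2 t) p) x0 v - 'd (local_rep A (X1 t) p) x0 v.
  exact: (der_uniq (der_line row_coordinates v Zd)
    (derB (der_line row_coordinates v d2) (der_line row_coordinates v d1))).
have [nu nuE] : {nu : {linear 'rV[R]_n -> R^o} | forall v, nu v = l ('d (transition A p (q t)) x0 v)}.
  by apply: mk_linear => a v z; rewrite !linearP.
rewrite -/x0 -ZE -nuE.
have [c cE] : {c : 'I_d -> {linear 'rV[R]_n -> R^o} | forall j v, c j v = coord (F (q t)) j ('d (transition A p (q t)) x0 v)}.
  have H j : {c : {linear 'rV[R]_n -> R^o} | forall v, c v = coord (F (q t)) j ('d (transition A p (q t)) x0 v)}.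
    by apply: mk_linear => a v z; rewrite !linearP.
  by exists (fun j => projT1 (H j)) => j v; case: (H j).
have back v : 'd (transition A p (q t)) x0 (coord_change A (q t) p v) = v.
  exact: (coord_changeK row_coordinates hM v pq).
(* The coefficients are the frame coordinates of [X2 - X1]. The dual forms are the frame coordinates
   at [q t], read through the derivative of the transition back to the centred chart. *)
apply: (@frame_difference R _ row_coordinates d Z x0
  (fun y i => coord (F (inv_chart A p y)) i (X2 t (inv_chart A p y) - X1 t (inv_chart A p y)))
  (fun i => local_rep A (f i) p) c nu) => //.
- by rewrite /Z /x0 !(local_repE hM)// XE subrr.
- have n1 : \forall y \near x0, W (inv_chart A p y).
    by apply: (near_inv_chart hM pq); exact: open_nbhs_nbhs.
  have n2 (O : set (R * Q)) : open O -> O (t, q t) -> \forall y \near x0, O (t, inv_chart A p y).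
    move=> oO Oq; apply: (near_inv_chart hM pq (P := fun x => O (t, x))).
    have [[P1 P2] /= [h1 h2] H] := open_nbhs_nbhs (conj oO Oq).
    by apply: filterS h2 => x P2x; apply: H; split=> //; exact: nbhs_singleton h1.
  move: n1 (n2 _ oO1 O1q) (n2 _ oO2 O2q); apply: filterS3 => y Wy h1 h2.
  have vD : X2 t (inv_chart A p y) - X1 t (inv_chart A p y) \in D (inv_chart A p y).
    by apply: rpredB; [exact: X2D|exact: X1D].
  rewrite /Z /local_rep -(@linearB _ _ _ _ ('d (chart A p \o inv_chart A (inv_chart A p y)) (chart A (inv_chart A p y) (inv_chart A p y)))).
  rewrite {1}(frame_combination Wy vD) linear_sum; apply: eq_bigr => i _.
  by rewrite linearZ_LR.
- by move=> i; have [h _] := frame_c1 hM hf i pq Wq; exact: differentiable_continuous h.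
- by move=> i j; rewrite cE /x0 (local_repE hM)// back; exact: frame_dual.
- by move=> i; rewrite nuE /x0 (local_repE hM)// back; apply: lD; exact: (frame_mem hf i Wq).
Qed.

End Frame.

Section EqualSpans.
Context {R : realType} {n d : nat} {Q : topologicalType}.
Variables (A : atlas 'rV[R]_n Q) (D : Q -> {vspace 'rV[R]_n}).
Variables (W : set Q) (f : 'I_d -> Q -> 'rV[R]_n).
Hypotheses (hM : c1_manifold A) (hf : local_frame A D W f) (hD : forall p, \dim (D p) = d).
Variables (T : R) (O1 O2 : set (R * Q)) (X1 X2 : R -> Q -> 'rV[R]_n) (q : R -> Q).
Hypotheses (T0 : 0 <= T) (hX1 : caratheodory_field row_coordinates A T O1 X1)
  (hX2 : caratheodory_field row_coordinates A T O2 X2)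
  (hq1 : integral_curve A O1 X1 0 T q) (hq2 : integral_curve A O2 X2 0 T q)
  (oO1 : open O1) (oO2 : open O2)
  (qW : forall t, 0 <= t <= T -> W (q t))
  (X1D : forall t p, 0 <= t <= T -> O1 (t, p) -> X1 t p \in D p)
  (X2D : forall t p, 0 <= t <= T -> O2 (t, p) -> X2 t p \in D p)
  (XE : {ae (@lebesgue_measure R), forall t, 0 <= t <= T -> X1 t (q t) = X2 t (q t)}).

(** A vector transported by the second flow that lay outside the first span would be detected by
    some [l] killing that span; this [l] satisfies the hypothesis of [two_flows_constant], which
    forces it to vanish on the vector. *)
Lemma flow_span_sub t : 0 <= t <= T ->
  flow_span A T q (flow A O2 X2) D t `<=` flow_span A T q (flow A O1 X1) D t.
Proof.
move=> tT; have [U UE] := flow_span_vspace A D T O1 X1 q t.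
apply: flow_span_min; [exact: linear_span0|exact: linear_spanP|move=> tau Y sT YD].
rewrite UE /=; apply/negPn/negP => /separating_functional[l lU]; apply/negP/negPn/eqP.
have lB v : flow_span A T q (flow A O1 X1) D t v -> l v = 0 by rewrite UE => /lU.
have H : {ae (@lebesgue_measure R), forall s, 0 < s < T -> forall p w, dom A p (q s) ->
  differentiable (local_rep A (X1 s) p) (chart A p (q s)) ->
  differentiable (local_rep A (X2 s) p) (chart A p (q s)) ->
  l (tangent_map A (flow A O1 X1 t s) (q s) ('d (transition A p (q s)) (chart A p (q s))
    ('d (local_rep A (X2 s) p) (chart A p (q s)) w - 'd (local_rep A (X1 s) p) (chart A p (q s)) w))) = 0}.
  apply: ae_impl XE => s sE /andP[s0 s1] p w pq d1 d2.
  have ssT : 0 <= s <= T by rewrite !ltW.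
  have [nu nuE] : {nu : {linear 'rV[R]_n -> R^o} | forall v, nu v = l (tangent_map A (flow A O1 X1 t s) (q s) v)}.
    by apply: mk_linear => a v z; rewrite flow_tangent_linear linearP.
  rewrite -nuE; apply: (@equal_fields_derivative _ _ _ _ A D W f hM hf hD O1 O2 X1 X2 q s p nu w oO1 oO2) => //.
  - exact: integral_curve_dom hq1 ssT.
  - exact: integral_curve_dom hq2 ssT.
  - exact: qW.
  - exact: sE.
  - by move=> x; exact: X1D.
  - by move=> x; exact: X2D.
  - by move=> v vD; rewrite nuE; apply: lB; exact: flow_span_mem.
(* At time [t] the constant function is [l] of the vector moved by the second flow; at time [tau] it
   is [l] of the one moved by the first flow, which is in the first span. *)
have := two_flows_constant hM hX1 hX2 T0 hq1 hq2 (l := l) Y tT sT H tT sT.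
rewrite [X in l X = _](flow_tangent_id hM hX1 T0 hq1 _ tT) => ->.
rewrite (flow_tangent_id hM hX2 T0 hq2 Y sT).
by apply: lB; exact: flow_span_mem.
Qed.

End EqualSpans.

Lemma ae_dense {R : realType} (P : R -> Prop) (a b : R) : a < b ->
  {ae (@lebesgue_measure R), forall t, P t} -> exists2 t, a < t < b & P t.
Proof.
move=> ab [N [mN N0 NP]]; apply: contrapT => H.
have sub : `]a, b[%classic `<=` N.
  move=> t /=; rewrite in_itv /= => tab; apply: NP => /= Pt.
  by apply: H; exists t.
have : (@lebesgue_measure R `]a, b[%classic <= @lebesgue_measure R N)%E := le_measure (@lebesgue_measure R) (mem_set (measurable_itv `]a, b[)) (mem_set mN) sub.
rewrite N0 lebesgue_measure_itv /= lte_fin ab.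
by rewrite -EFinB lee_fin subr_le0 leNgt ab.
Qed.

(** * Abnormal extremals and annihilating covectors *)

Section Abnormal.
Context {R : realType} {n d : nat} {Q : topologicalType}.
Variables (A : atlas 'rV[R]_n Q) (g : Q -> 'rV[R]_n -> 'rV[R]_n -> R).
Variables (D : Q -> {vspace 'rV[R]_n}) (W : set Q) (f : 'I_d -> Q -> 'rV[R]_n).
Variables (T : R) (u : R -> 'rV[R]_d) (qq : R -> Q * R).
Hypotheses (hM : c1_manifold A) (hg : sr_metric A D g) (hf : local_frame A D W f).
Hypotheses (hD : forall p, \dim (D p) = d).
Hypotheses (hT : 0 < T) (hu : admissible_control T u) (hqq : sr_trajectory A g W f T u qq).
Notation q := (fun t => (qq t).1).
Notation fu := (fun t => control_field f (u t)).
Notation F := (control_flow A W f u).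
Notation DF t tau := (tangent_map A (flow A (frame_domain W) fu t tau) (qq tau).1).
Notation DF' t tau := (extended_transport A g W f u qq t tau).
Notation B := (flow_span A T q F D).

Let hX := control_caratheodory hM hf hu.
Let hq : integral_curve A (frame_domain W) fu 0 T q := hqq.1.
Let T0 : 0 <= T := ltW hT.
Let hM' := extended_c1_manifold (@row_coordinates R n) hM.
Let hX' := extended_caratheodory hM hg hf hu.
Let hq' := extended_integral_curve hM hg hf hT hu hqq.
Let zT : (0 : R) <= 0 <= T.
Proof. by rewrite lexx. Qed.

Let qW t : 0 <= t <= T -> W (qq t).1.
Proof. exact: integral_curve_dom hq. Qed.

Let transport_fst t tau z : 0 <= t <= T -> 0 <= tau <= T -> (DF' t tau z).1 = DF t tau z.1.
Proof. exact: (extended_transport_fst hM hg hf hT hu hqq). Qed.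

Let transport_comp t s tau z : 0 <= t <= T -> 0 <= s <= T -> 0 <= tau <= T ->
  DF' t s (DF' s tau z) = DF' t tau z.
Proof. exact: (flow_tangent_comp hM' hX' T0 hq' z). Qed.

Let transport_id t z : 0 <= t <= T -> DF' t t z = z.
Proof. exact: (flow_tangent_id hM' hX' T0 hq' z). Qed.

Let DFcomp t s tau v : 0 <= t <= T -> 0 <= s <= T -> 0 <= tau <= T -> DF t s (DF s tau v) = DF t tau v.
Proof. exact: (flow_tangent_comp hM hX T0 hq v). Qed.

Let DFid t v : 0 <= t <= T -> DF t t v = v.
Proof. exact: (flow_tangent_id hM hX T0 hq v). Qed.

Let DFlin t tau a v w : DF t tau (a *: v + w) = a *: DF t tau v + DF t tau w.
Proof. exact: tangent_map_linear. Qed.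

Let DF0 t tau : DF t tau 0 = 0.
Proof. exact: linear0. Qed.

Lemma kill_frame_continuous (l : {linear 'rV[R]_n -> R^o}) i :
  (forall s, regular_point T u s -> l (DF 0 s (f i (qq s).1)) = 0) ->
  forall t, 0 <= t <= T -> l (DF 0 t (f i (qq t).1)) = 0.
Proof.
move=> lreg t tT; have [nu nuE] : {nu : {linear 'rV[R]_n -> R^o} | forall v, nu v = l (DF 0 t v)}.
  by apply: mk_linear => a v w; rewrite DFlin linearP.
have [K K0 HK] := linear_bound (@row_coordinates R n) nu.
have Yc : {for chart A (qq t).1 (qq t).1, continuous (local_rep A (f i) (qq t).1)}.
  have [h _] := frame_c1 hM hf i (c1_dom_mem hM _) (qW tT).
  exact: differentiable_continuous h.
rewrite -nuE; apply/eqP; rewrite -normr_le0; apply/ler_addgt0Pl => e e0; rewrite addr0.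
have K1 : 0 < K + 1 by rewrite ltr_wpDl.
have [d0 d00 Hd] := flow_tangent_continuous hM hX T0 hq tT Yc (divr_gt0 e0 K1).
(* This open window inside [(0, T)] is nonempty also for [t = 0] and [t = T], so the end times are
   reached as limits of regular ones. *)
have [s /andP[s1 s2] sreg] : exists2 s, Num.max 0 (t - d0) < s < Num.min T (t + d0) & regular_point T u s.
  have /andP[t0 t1] := tT.
  have ab : Num.max 0 (t - d0) < Num.min T (t + d0).
    by rewrite lt_min !gt_max hT; apply/andP; split; apply/andP; split; lra.
  have [s sab sP] := ae_dense ab (regular_point_ae hu); exists s => //; apply: sP.
  by move: sab; rewrite gt_max lt_min => /andP[/andP[-> _] /andP[-> _]].
move: s1 s2; rewrite gt_max lt_min => /andP[s0 s1] /andP[s2 s3].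
have sT : 0 <= s <= T by rewrite !ltW.
have st : `|s - t| < d0 by rewrite ltr_norml; apply/andP; split; lra.
have h := Hd s sT st.
have E : nu (f i (qq t).1) = - nu (DF t s (f i (qq s).1) - f i (qq t).1).
  by rewrite (linearB nu) [nu (DF t s _)]nuE DFcomp// lreg// sub0r opprK.
rewrite E normrN; apply: le_trans (HK _) _.
apply: (@le_trans _ _ ((K + 1) * (e / (K + 1)))); last by rewrite mulrC divfK// gt_eqF.
apply: ler_pM => //; first by rewrite lerDl.
Qed.

Lemma abnormal_rank_lt : abnormal_sr_extremal A g W f T u qq -> rank_lt_dim T B.
Proof.
move=> [H [[Htr Hsep] Hcost]].
have [l0 [[z0 z0l] H0 _ _]] := Hsep 0 zT.
have [lam lamE] : {lam : {linear 'rV[R]_n -> R^o} | forall v, lam v = l0 (v, 0)}.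
  apply: mk_linear => a v w; rewrite -linearP; congr (l0 _).
  by congr pair => /=; rewrite scaler0 addr0.
(* A functional whose kernel contains the cost line does not see the cost component. *)
have vert t (l : {linear ('rV[R]_n * R^o)%type -> R^o}) : 0 <= t <= T -> H t = [set v | l v = 0] ->
    forall z, l z = l (z.1, 0).
  move=> tT HE z; have -> : z = (z.1, 0) + (0, z.2).
    by case: z => z1 z2; congr pair => /=; rewrite ?addr0 ?add0r.
  rewrite linearD /= addr0; have : H t (0, z.2) by apply: Hcost => //; exists z.2.
  by rewrite HE /= => ->; rewrite addr0.
have lam0 i t : 0 <= t <= T -> lam (DF 0 t (f i (qq t).1)) = 0.
  apply: kill_frame_continuous => s sreg.
  have /andP[s0 s1] := sreg.1; have sT : 0 <= s <= T by rewrite !ltW.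
  have [ls [_ Hs Hcone _]] := Hsep s sT.
  (* A single variation at the time [s] itself with weight 1, where the transport is the identity;
     its cost component is removed by [vert]. *)
  have cone v : ls (control_field f v (qq s).1 - control_field f (u s) (qq s).1, 0) <= 0.
    rewrite -(vert s ls sT Hs (extended_field g f v (qq s) - extended_field g f (u s) (qq s))).
    apply: Hcone; right; left; split=> //; split=> //; apply: subset_closure.
    exists 1%N, (fun=> s), (fun=> v), (fun=> 1); split=> //.
    by rewrite big_ord1 scale1r transport_id.
  have cfD (v w : 'rV[R]_d) x : control_field f (v + w) x = control_field f v x + control_field f w x.
    by rewrite /control_field -big_split; apply: eq_bigr => j _; rewrite mxE scalerDl.
  have cfN (v : 'rV[R]_d) x : control_field f (- v) x = - control_field f v x.
    by rewrite /control_field -sumrN; apply: eq_bigr => j _; rewrite mxE scaleNr.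
  have lsf w : ls (control_field f w (qq s).1, 0) = 0.
    apply/eqP; rewrite eq_le; apply/andP; split.
      by have := cone (u s + w); rewrite cfD [_ + control_field f w _]addrC addrK.
    rewrite -oppr_le0 -linearN; have := cone (u s - w); rewrite cfD cfN [control_field f (u s) _ + _]addrC addrK.
    by congr (ls _ <= 0); congr pair => /=; rewrite oppr0.
  have fiE : control_field f (delta_mx 0 i) (qq s).1 = f i (qq s).1.
    rewrite /control_field (bigD1 i)//= big1 ?addr0 => [|j ji].
      by rewrite mxE !eqxx scale1r.
    by rewrite mxE (negPf ji) andbF scale0r.
  have : H s (f i (qq s).1, 0) by rewrite Hs /= -fiE lsf.
  rewrite -(Htr 0 s)// ?ltW// => -[z Hz zE].
  (* Transporting back from [s] to 0 recovers [z], and first components are moved by the flow on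
     [Q]. *)
  have z1 : z.1 = DF 0 s (f i (qq s).1).
    rewrite -[z in LHS](transport_id z zT) -(transport_comp z zT sT zT) zE.
    by rewrite transport_fst.
  by rewrite -z1 lamE -(vert 0 l0 zT H0); move: Hz; rewrite H0.
have [v0 lv0] : exists v, lam v != 0 by exists z0.1; rewrite lamE -(vert 0 l0 zT H0).
(* A proper subspace is required at every time: the vector [v0], on which [lam] is nonzero, is moved
   to time [t] and stays outside the span. *)
move=> t tT; have [U UE] := flow_span_vspace A D T (frame_domain W) fu q t.
exists U; split; first exact: UE.
apply/dimv_lt_ex; exists (DF t 0 v0); apply/negP => vU.
have [nu nuE] : {nu : {linear 'rV[R]_n -> R^o} | forall v, nu v = lam (DF 0 t v)}.
  by apply: mk_linear => a v w; rewrite DFlin linearP.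
move: lv0; rewrite -(DFid v0 zT) -(DFcomp v0 zT tT zT) -nuE; apply/negP/negPn/eqP.
apply: (@flow_span_kill R n Q A D T (frame_domain W) fu q t); last by rewrite UE.
move=> tau Y sT YD; rewrite nuE DFcomp//.
have [nu2 nu2E] : {nu2 : {linear 'rV[R]_n -> R^o} | forall v, nu2 v = lam (DF 0 tau v)}.
  by apply: mk_linear => a v w; rewrite DFlin linearP.
rewrite -nu2E; apply: (frame_kill hf (qW sT)) => // i.
by rewrite nu2E; exact: lam0.
Qed.

Lemma rank_lt_abnormal : rank_lt_dim T B -> abnormal_sr_extremal A g W f T u qq.
Proof.
move=> /(_ 0 zT)[U [UE /dimv_lt_ex[v0 /separating_functional[lam lamU lam0]]]].
have [l lE] : {l : R -> {linear ('rV[R]_n * R^o)%type -> R^o} | forall t z, l t z = lam (DF 0 t z.1)}.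
  have H t : {l : {linear ('rV[R]_n * R^o)%type -> R^o} | forall z, l z = lam (DF 0 t z.1)}.
    by apply: mk_linear => a v w; rewrite /= DFlin linearP.
  by exists (fun t => projT1 (H t)) => t z; case: (H t).
have ltr t tau z : 0 <= t <= T -> 0 <= tau <= T -> l t (DF' t tau z) = l tau z.
  by move=> tT sT; rewrite !lE transport_fst// DFcomp.
have lD t v : 0 <= t <= T -> v \in D (qq t).1 -> lam (DF 0 t v) = 0.
  move=> tT vD; apply: lamU; have : B 0 (DF 0 t v) by exact: flow_span_mem.
  by rewrite UE.
(* The functional vanishes on every generator, and its kernel is closed, so the closure adds nothing
   and the separating inequality holds with equality. *)
have cone0 t w : 0 <= t <= T -> regular_cone A g W f T u qq t w -> l t w = 0.
  move=> tT; have lc : continuous (l t) by exact: (linear_continuous_coord (product_coordinates (@row_coordinates R n))).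
  have cl : closed (l t @^-1` [set 0]) by apply: preimage_closed.
  move: w; rewrite -[forall w, _]/(regular_cone A g W f T u qq t `<=` l t @^-1` [set 0]).
  rewrite [X in _ `<=` X](closure_id _).1//; apply: closure_subset.
  move=> _ [k [s [v [ds [sreg _ _ ->]]]]] /=; rewrite linear_sum big1// => i _.
  have /andP[s0 s1] := (sreg i).1.1; have sT : 0 <= s i <= T by rewrite !ltW.
  rewrite linearZ_LR ltr// lE /= lD ?scaler0//.
  by apply: rpredB; apply: (control_field_mem hf); exact: qW.
exists (fun t => [set z | l t z = 0]); split; last first.
  by move=> t tT _ [r _ <-] /=; rewrite lE DF0 linear0.
split.
  move=> tau t t0 st tT; have sT : 0 <= tau <= T by rewrite t0 (le_trans st).
  have ttT : 0 <= t <= T by rewrite (le_trans t0).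
  apply/seteqP; split=> [_ [z lz <-]|z lz] /=; first by rewrite ltr.
  by exists (DF' tau t z) => /=; [rewrite ltr|rewrite transport_comp// transport_id].
move=> t tT; exists (l t); split=> //.
- by exists (DF t 0 v0, 0); rewrite lE /= DFcomp// DFid.
- move=> k [[_ ->]|[[_ [_ /(cone0 t _ tT) ->]]|[_ [_ [tau [st treg [w /cone0 w0 <-]]]]]]] //.
    by rewrite linear0.
  have /andP[s0 s1] := treg.1; have sT : 0 <= tau <= T by rewrite !ltW.
  by rewrite ltr// w0.
- by move=> _ [r _ <-]; rewrite lE DF0 linear0.
Qed.

(** The curve [q] has almost everywhere the velocity prescribed by [X], so it is an integral curve
    of both fields. The situation is then symmetric and [flow_span_sub] applies in both
    directions. *)
Lemma velocity_extension_flow_span O X :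
  velocity_extension A T q D (fun t => control_field f (u t) (q t)) O X ->
  forall t, 0 <= t <= T -> flow_span A T q (flow A O X) D t = B t.
Proof.
move=> [oO qO hcX XD XE] t tT; have hX2 := row_caratheodory hcX.
have hq2 : integral_curve A O X 0 T q.
  have [_ cac cv] := hq; split=> //.
  by apply: ae_impl2 XE cv => s sE h sT; rewrite sE//; exact: h.
have oF : open (frame_domain W : set (R * Q)).
  have [oW _ _] := hf; have := @open_setX _ _ [set: R] W openT oW.
  by rewrite (_ : [set: R] `*` W = frame_domain W :> set (R * Q))//; apply/seteqP; split=> x; [case|].
have fD s p : 0 <= s <= T -> frame_domain W (s, p) -> control_field f (u s) p \in D p.
  by move=> _; exact: (control_field_mem hf (u s)).
apply/seteqP; split.
- exact: (flow_span_sub hM hf hD T0 hX hX2 hq hq2 oF oO qW fD XD (ae_impl (fun s h sT => esym (h sT)) XE) tT).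
- exact: (flow_span_sub hM hf hD T0 hX2 hX hq2 hq oO oF qW XD fD XE tT).
Qed.

End Abnormal.

Theorem theorem6p7 (R : realType) (n d : nat) (Q : topologicalType)
  (A : atlas 'rV[R]_n Q) (hQ : smooth_manifold A)
  (D : Q -> {vspace 'rV[R]_n}) (hD : smooth_distribution A d D)
  (g : Q -> 'rV[R]_n -> 'rV[R]_n -> R) (hg : sr_metric A D g)
  (W : set Q) (f : 'I_d -> Q -> 'rV[R]_n) (hf : local_frame A D W f)
  (T : R) (hT : 0 < T)
  (u : R -> 'rV[R]_d) (hu : admissible_control T u)
  (qq : R -> Q * R) (hqq : sr_trajectory A g W f T u qq) :
  let q := fun t => (qq t).1 in
  let F := control_flow A W f u in
  [/\ smallest_invariant A T q F D (flow_span A T q F D),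
      abnormal_sr_extremal A g W f T u qq
        <-> rank_lt_dim T (flow_span A T q F D)
    & forall (O : set (R * Q)) (X : R -> Q -> 'rV[R]_n),
        velocity_extension A T q D (fun t => control_field f (u t) (q t)) O X ->
        (rank_lt_dim T (flow_span A T q (flow A O X) D)
          <-> rank_lt_dim T (flow_span A T q F D))].
Proof.
move=> q F; have hM := smooth_c1_manifold hQ.
split.
- exact: (flow_span_smallest D hM (control_caratheodory hM hf hu) (ltW hT) hqq.1).
- split; [exact: (abnormal_rank_lt hM hg hf hT hu hqq)|exact: (rank_lt_abnormal hM hg hf hT hu hqq)].
- move=> O X hO; have E := velocity_extension_flow_span hM hf hD.1 hT hu hqq hO.
  by split=> H t tT; have [U [UE dU]] := H t tT; exists U; rewrite -UE ?E.
Qed.
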